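(* Let $X,Y,A,B,F,V,\psi$ be as in the context, and suppose that $B$ is an entire function. Let $\alpha<0$ and suppose $F$ (restricted to the negative real axis) is of exponential order $-\alpha$ at $-\infty$. Suppose that the zeroes of $F$ with strictly negative real part, listed with multiplicity, have an enumeration $\{\zeta_n: n\in\mathbb Z\}$ such that $\zeta_{-n}=\overline{\zeta}_n$ for all $n$ and, as $n\to+\infty$, $\Re \zeta_n=o(n^{1/2})$ and $\Im \zeta_n=-2\pi n/\alpha+\beta+o(1)$ for a real constant $\beta$. Suppose that there exist $\eta>0$, $\epsilon>0$ and an $\eta$-sublinear sequence of radii $\{r_n,\ n\ge n_1\}$ with $r_n\to\infty$ such that $|F(\theta)|>\epsilon$ whenever $\Re\theta<0$ and $|\theta|=r_n$. Let $\{z_n: n\in\mathbb Z\}$, with $z_{-n}=\overline z_n$ and $|z_n|$ non-decreasing in $n$ for all sufficiently large $n$, enumerate the distinct zeroes of $F$ with strictly negative real part, and let $k_n$ be the multiplicity of $z_n$. Then $$\psi(\theta)=1+\sum_{n=-\infty}^{\infty}\sum_{j=1}^{k_n}A_{n,j}\big((\theta-z_n)^{-j}-(-z_n)^{-j}\big),$$ where $A_{n,j}$ is the coefficient of $(\theta-z_n)^{-j}$ in the Laurent expansion of $\psi$ around $z_n$.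
   Context: $X\ge 0$ (interarrival time) and $Y\ge0$ (service time) are independent random variables with $E[Y]<E[X]$, at least one of which is non-lattice; $U=Y-X$. Their Laplace transforms are $A(\theta)=E[\exp(-\theta X)]$ and $B(\theta)=E[\exp(-\theta Y)]$, both assumed analytic in a strip $\{\theta:-\epsilon_0<\Re\theta<\epsilon_0\}$ with $\epsilon_0>0$. Put $F(\theta)=B(\theta)A(-\theta)-1$; when $B$ is entire, $F$ is analytic on $\{\Re\theta<\epsilon_0\}$. $V\ge 0$ is the steady-state unfinished workload just prior to an arrival, i.e. $V$ has the unique distribution such that $V$ and $(V+U)^+$ are equal in law, with $V$ and $U$ independent in the second expression; $\psi(\theta)=E[\exp(-\theta V)]$, continued meromorphically to the plane. Known fact (W. L. Smith): $\psi$ extends analytically and without zeroes to a half-plane $\{\Re\theta>-\epsilon_1\}$, $\epsilon_1>0$, and the poles of $\psi$ coincide with the zeroes of $F$ of negative real part. Exponential order: a real function $f$ is of exponential order $a$ at $b\in\{\pm\infty\}$ if for every $\epsilon>0$, $\lim_{x\to b}f(x)\exp(-(a+\epsilon)|x|)=\lim_{x\to b}\exp((a-\epsilon)|x|)/f(x)=0$. A non-decreasing sequence $\{r_n\}$ is $\eta$-sublinear if there is $n_0$ with $r_{n+1}-r_n<\eta$ whenever $n\ge n_0$. The bilateral sum denotes $\lim_{N\to\infty}\sum_{n=-N}^{N}$, and the identity is for $\theta$ not a pole of $\psi$. *)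

(* Defs.v *)
From HB Require Import structures.
From mathcomp Require Import all_boot all_order all_algebra.
From mathcomp Require Export complex.
From mathcomp Require Import all_classical all_reals all_analysis.

Set Implicit Arguments.
Unset Strict Implicit.
Unset Printing Implicit Defensive.

Import Order.TTheory GRing.Theory Num.Theory.
Import numFieldNormedType.Exports.

Local Open Scope classical_set_scope.
Local Open Scope complex_scope.
Local Open Scope ring_scope.

Definition cexp (R : realType) (z : R[i]) : R[i] :=
  (expR (complex.Re z))%:C * (cos (complex.Im z) +i* sin (complex.Im z)).

Definition cintegrable d (T : measurableType d) (R : realType)
    (P : probability T R) (Z : T -> R[i]) : Prop :=
  P.-integrable setT (EFin \o (fun t => complex.Re (Z t))) /\
  P.-integrable setT (EFin \o (fun t => complex.Im (Z t))).

Definition cexpectation d (T : measurableType d) (R : realType)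
    (P : probability T R) (Z : T -> R[i]) : R[i] :=
  fine ('E_P[fun t => complex.Re (Z t)]) +i*
  fine ('E_P[fun t => complex.Im (Z t)]).

(* Only meaningful where the integral converges: for divergent integrals the
   value is arbitrary, see [laplace_analytic_on]. *)
Definition laplace d (T : measurableType d) (R : realType)
    (P : probability T R) (X : T -> R) (theta : R[i]) : R[i] :=
  cexpectation P (fun t => cexp (- theta * (X t)%:C)).

Definition independent d (T : measurableType d) (R : realType)
    (P : probability T R) (X Y : T -> R) : Prop :=
  forall A B : set R, measurable A -> measurable B ->
    P (X @^-1` A `&` Y @^-1` B) = (P (X @^-1` A) * P (Y @^-1` B))%E.

(* A variable concentrated on a shifted lattice [c + h Z] that lies in no
   [h' Z] is not a lattice variable in this sense.  As non-latticeness is only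
   ever assumed, this is the most permissive of the usual conventions. *)
Definition lattice d (T : measurableType d) (R : realType)
    (P : probability T R) (X : T -> R) : Prop :=
  exists2 h : R, 0 < h & {ae P, forall t, exists n : int, X t = n%:~R * h}.

(* The law of V is stationary for v |-> (v + U)^+.  V and U live on their own
   probability spaces, so that the product measure makes them independent. *)
Definition stationary_workload d' (T' : measurableType d') d
    (T : measurableType d) (R : realType) (P' : probability T' R)
    (P : probability T R) (V : T' -> R) (U : T -> R) : Prop :=
  forall S : set R, measurable S ->
    P' (V @^-1` S) =
    (P' \x P)%E ((fun t : T' * T => Num.max (V t.1 + U t.2) 0) @^-1` S).

(* The notions of complex analysis are stated over a numeric field K, to be
   instantiated by R[i], so as to use the topology that the library gives to
   every numFieldType. *)
Definition analytic_at (K : numFieldType) (f : K -> K) (w : K) : Prop :=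
  exists (a : nat -> K) (rho : K), 0 < rho /\
    forall z : K, `|z - w| < rho ->
      series (fun n => a n * (z - w) ^+ n) @ \oo --> f z.

Definition laplace_analytic_on d (T : measurableType d) (R : realType)
    (P : probability T R) (X : T -> R) (D : set R[i]) : Prop :=
  forall theta : R[i], D theta ->
    cintegrable P (fun t => cexp (- theta * (X t)%:C)) /\
    analytic_at (laplace P X) theta.

(* Order of a meromorphic function: zeroes of multiplicity k are points of
   order k, poles of order k are points of order -k. *)
Definition has_order (K : numFieldType) (f : K -> K) (w : K) (m : int) : Prop :=
  exists g : K -> K, [/\ analytic_at g w, g w != 0 &
    \forall z \near w^', f z = (z - w) ^ m * g z].

Definition is_pole (K : numFieldType) (f : K -> K) (w : K) : Prop :=
  exists2 k : nat, (0 < k)%N & has_order f w (- k%:Z).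

(* The value at a pole is arbitrary; at any other point the function is
   analytic, which excludes removable singularities. *)
Definition meromorphic (K : numFieldType) (f : K -> K) : Prop :=
  forall w : K, analytic_at f w \/ is_pole f w.

Definition laurent_expansion (K : numFieldType) (f : K -> K) (w : K)
    (c : int -> K) : Prop :=
  exists2 rho : K, 0 < rho &
    forall z : K, 0 < `|z - w| < rho ->
      exists s t : K,
        [/\ series (fun n : nat => c n%:Z * (z - w) ^ n%:Z) @ \oo --> s,
            series (fun n : nat => c (- n.+1%:Z) * (z - w) ^ (- n.+1%:Z))
              @ \oo --> t &
            f z = s + t].

Definition laurent_coef (K : numFieldType) (f : K -> K) (w : K) : int -> K :=
  xget (fun=> 0) [set c | laurent_expansion f w c].

Definition is_bilateral_sum (K : numFieldType) (u : int -> K) (s : K) : Prop :=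
  (fun N : nat => \sum_(0 <= i < N.*2.+1) u (i%:Z - N%:Z)) @ \oo --> s.

(* As x / 0 = 0 here, the non-vanishing of f near b, which is implicit in the
   second limit, has to be stated. *)
Definition exponential_order (R : realType) (f : R -> R) (a : R)
    (b : set_system R) : Prop :=
  (\forall x \near b, f x != 0) /\
  forall e : R, 0 < e ->
    (f x * expR (- (a + e) * `|x|) @[x --> b] --> (0 : R)) /\
    (expR ((a - e) * `|x|) / f x @[x --> b] --> (0 : R)).

Definition sublinear (R : realType) (eta : R) (n1 : nat) (r : nat -> R) : Prop :=
  (forall n : nat, (n1 <= n)%N -> r n <= r n.+1) /\
  exists2 n0 : nat, (n1 <= n0)%N &
    forall n : nat, (n0 <= n)%N -> r n.+1 - r n < eta.

Definition left_zeroes (R : realType) (f : R[i] -> R[i]) : set R[i] :=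
  [set w | complex.Re w < 0 /\ f w = 0].

(* Every zero occurs exactly as many times as its multiplicity. *)
Definition lists_left_zeroes (R : realType) (f : R[i] -> R[i])
    (zeta : int -> R[i]) : Prop :=
  (forall n : int, left_zeroes f (zeta n)) /\
  forall (w : R[i]) (m : nat), left_zeroes f w -> has_order f w m%:Z ->
    ([set n : int | zeta n = w] #= `I_m)%card.

(* Main.v *)
Require Import Defs.
From HB Require Import structures.
From mathcomp Require Import all_boot all_order all_algebra.
From mathcomp Require Import all_classical all_reals all_analysis.
From mathcomp Require Import measurable_realfun.
From mathcomp Require Import ring lra zify.

(** Let [W = (V + Y - X)^-] be the idle time before an arrival.  Integrating
    [exp (- x s) + 1 = exp (- x s^+) + exp (x s^-)] at [s = V + Y - X], the
    stationarity of [V] and the independence of [V], [X] and [Y] give, for small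
    real [x > 0],

      [psi x * F x = G x],  where [G theta = E (exp (theta W)) - 1].

    Both sides are meromorphic to the left of [eps0], so the equation holds
    there ([functional_equation]); in particular the poles of [psi] are zeros of
    [F].  Since [V] and [W] are nonnegative, [psi] is bounded for
    [Re theta >= 0] and [G] is bounded for [Re theta <= 0].  The circles of radius
    [r_n] keep [F] away from 0 on their left halves, and [psi = G / F] there:
    hence [psi] is bounded on all these circles by one constant.

    The asymptotics of the zeros [zeta_n] give [|zeta_n| = a n + beta + o(1)] with
    [a = - 2 pi / alpha], because [Re zeta_n = o(sqrt n)].  Hence all but finitely
    many zeros are simple, zeros of large and different moduli have moduli at
    least [a / 2] apart, and so are the two members of a conjugate pair
    ([zero_enumeration_gaps]).

    What remains is a partial fraction theorem for functions with such poles and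
    such circles ([mittag_leffler]).  Between two consecutive circles there is a
    bounded number of poles; cancelling them by bounded factors, the maximum
    modulus principle on the annulus shows that [psi] is bounded at positive
    distance from the poles ([bounded_away]), so that its residues are bounded
    ([residues_bounded]).  Let [E_N] be [psi] minus the terms of the expansion of
    index at most [N] in absolute value.  It extends analytically to a disc of radius [R_N]
    slightly larger than [|z_N|], and on the boundary circle

      [|E_N| <= O(1) + O(R_N) * sum_(i <= N) 1 / (i (N - i + 1)) = o(R_N)].

    Schwarz's lemma yields [E_N theta - E_N 0 -> 0], and [E_N 0 = psi 0 = 1], which
    is the claim.

    The complex analysis rests on power series alone: products and re-expansions
    come from summing an absolutely convergent double series in two ways
    ([double_series]), and the maximum modulus principle from the local form of an
    analytic function and compactness, without contour integrals. *)

Set Implicit Arguments.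
Unset Strict Implicit.
Unset Printing Implicit Defensive.

Import Order.TTheory GRing.Theory Num.Theory.
Import numFieldNormedType.Exports.

Local Open Scope classical_set_scope.
Local Open Scope complex_scope.
Local Open Scope ring_scope.

(** * The modulus and limits of complex sequences *)

Section ComplexTopology.
Variable R : realType.

(** The topology of [R[i]] is the one that it carries as a numeric field. *)
HB.instance Definition _ := NormedModule.copy R[i] (R[i] : numFieldType).

End ComplexTopology.

(** The modulus as a real number, while the norm of [R[i]] has complex values. *)
Notation cabs := ComplexField.Normc.normc.

Section Modulus.
Variable R : realType.
Implicit Types (x y z w : R[i]) (r s : R).

Lemma normC_cabs z : `|z| = (cabs z)%:C. Proof. by []. Qed.

Lemma cabs_ge0 z : 0 <= cabs z.
Proof. by rewrite -ler0c -normC_cabs. Qed.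

Lemma cabs0 : cabs (0 : R[i]) = 0. Proof. exact: ComplexField.Normc.normc0. Qed.

Lemma cabs1 : cabs (1 : R[i]) = 1. Proof. exact: ComplexField.Normc.normc1. Qed.

Lemma cabs_eq0 z : (cabs z == 0) = (z == 0).
Proof.
apply/eqP/eqP => [|->]; last exact: cabs0.
exact: ComplexField.Normc.eq0_normc.
Qed.

Lemma cabs_gt0 z : (0 < cabs z) = (z != 0).
Proof. by rewrite lt0r cabs_ge0 cabs_eq0 andbT. Qed.

Lemma cabsM z w : cabs (z * w) = cabs z * cabs w.
Proof. exact: ComplexField.Normc.normcM. Qed.

Lemma cabsV z : cabs z^-1 = (cabs z)^-1.
Proof. exact: ComplexField.Normc.normcV. Qed.

Lemma cabsN z : cabs (- z) = cabs z. Proof. exact: normcN. Qed.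

Lemma cabsB z w : cabs (z - w) = cabs (w - z).
Proof. by rewrite -cabsN opprB. Qed.

Lemma cabsX z n : cabs (z ^+ n) = cabs z ^+ n.
Proof.
by elim: n => [|n IH]; rewrite ?expr0 ?cabs1 // !exprS cabsM IH.
Qed.

Lemma cabsR r : cabs r%:C = `|r|.
Proof. by rewrite /= expr0n addr0 sqrtr_sqr. Qed.

Lemma cabsD z w : cabs (z + w) <= cabs z + cabs w. Proof. exact: le_normcD. Qed.

Lemma cabs_sub z w : cabs (z - w) <= cabs z + cabs w.
Proof. by rewrite -(cabsN w) cabsD. Qed.

Lemma cabs_tri z w x : cabs (z - x) <= cabs (z - w) + cabs (w - x).
Proof. by rewrite (le_trans _ (cabsD _ _))// addrA subrK. Qed.

Lemma cabs_lb z w : cabs z - cabs w <= cabs (z - w).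
Proof. by rewrite lerBlDr -{1}(subrK w z) cabsD. Qed.

Lemma cabs_sum I (s : seq I) (P : pred I) (f : I -> R[i]) :
  cabs (\sum_(i <- s | P i) f i) <= \sum_(i <- s | P i) cabs (f i).
Proof.
elim/big_ind2 : _ => [|x1 x2 y1 y2 h1 h2|//]; first by rewrite cabs0.
by rewrite (le_trans (cabsD _ _))// lerD.
Qed.

Lemma Re_le_cabs z : `|complex.Re z| <= cabs z.
Proof.
case: z => a b /=; rewrite -sqrtr_sqr ler_sqrt ?addr_ge0 ?sqr_ge0//.
by rewrite lerDl sqr_ge0.
Qed.

Lemma Im_le_cabs z : `|complex.Im z| <= cabs z.
Proof.
case: z => a b /=; rewrite -sqrtr_sqr ler_sqrt ?addr_ge0 ?sqr_ge0//.
by rewrite lerDr sqr_ge0.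
Qed.

Lemma cabs_le_ReIm z : cabs z <= `|complex.Re z| + `|complex.Im z|.
Proof.
case: z => a b /=.
rewrite -(@ler_pXn2r _ 2) ?nnegrE ?sqrtr_ge0 ?addr_ge0 //.
rewrite sqr_sqrtr ?addr_ge0 ?sqr_ge0// sqrrD !real_normK ?num_real//.
by rewrite lerD2r lerDl mulrn_wge0 // mulr_ge0.
Qed.

Lemma cabs_conj z : cabs z^* = cabs z.
Proof. by case: z => a b /=; rewrite sqrrN. Qed.

Lemma normC_lt z r : (`|z| < r%:C) = (cabs z < r).
Proof. by rewrite normC_cabs ltcR. Qed.

Lemma gt0_complexE z : 0 < z -> z = (complex.Re z)%:C /\ 0 < complex.Re z.
Proof. by case: z => a b; rewrite ltcE /= => /andP[/eqP ->]. Qed.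

Lemma nbhsCP (w : R[i]) (P : set R[i]) :
  nbhs w P <-> exists2 r : R, 0 < r & forall z, cabs (z - w) < r -> P z.
Proof.
split=> [/nbhs_normP[e e0 he]|[r r0 h]].
  have [eE e0'] := gt0_complexE e0; exists (complex.Re e) => // z hz.
  by apply: he; rewrite /= /ball_ /= distrC eE normC_lt.
apply/nbhs_normP; exists r%:C; first by rewrite /= ltcR.
by move=> z; rewrite /= /ball_ /= distrC normC_lt; exact: h.
Qed.

Lemma dnbhsCP (w : R[i]) (P : set R[i]) :
  w^' P <-> exists2 r : R, 0 < r & forall z, z != w -> cabs (z - w) < r -> P z.
Proof.
by split=> [/nbhsCP[r r0 h]|[r r0 h]]; [exists r|apply/nbhsCP; exists r] => //;
  move=> z; [move=> zw hz; exact: h|move=> hz zw; exact: h].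
Qed.

Lemma cvgCP T (F : set_system T) (FF : Filter F) (f : T -> R[i]) (l : R[i]) :
  f @ F --> l <-> forall e : R, 0 < e -> \forall x \near F, cabs (f x - l) < e.
Proof.
split=> [/cvgrPdist_lt h e e0|h].
  have /h : (0 : R[i]) < e%:C by rewrite ltcR.
  by apply: filterS => x; rewrite distrC normC_lt.
apply/cvgrPdist_lt => e e0; have [-> e0'] := gt0_complexE e0.
by apply: filterS (h _ e0') => x hx; rewrite distrC normC_lt.
Qed.

(** Convergence measured by the real modulus, so that estimates stay in [R]. *)
Definition ctends (u : nat -> R[i]) (l : R[i]) : Prop :=
  forall e : R, 0 < e ->
    exists N : nat, forall n, (N <= n)%N -> cabs (u n - l) < e.

Implicit Types (u v : nat -> R[i]) (a b : R[i]).

Lemma ctends_cvg u a : u @ \oo --> a <-> ctends u a.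
Proof.
rewrite cvgCP; split=> h e e0; have := h e e0.
  by case=> N _ hN; exists N => n; exact: hN.
by case=> N hN; exists N.
Qed.

Lemma eq_ctends u v a : u =1 v -> ctends u a -> ctends v a.
Proof. by move=> /funext ->. Qed.

Lemma ctends_cst a : ctends (fun=> a) a.
Proof. by move=> e e0; exists 0%N => n _; rewrite subrr cabs0. Qed.

Lemma ctendsD u v a b :
  ctends u a -> ctends v b -> ctends (fun n => u n + v n) (a + b).
Proof.
move=> hu hv e e0; have e2 : 0 < e / 2 by rewrite divr_gt0.
have [N hN] := hu _ e2; have [M hM] := hv _ e2; exists (maxn N M) => n.
rewrite geq_max => /andP[Nn Mn]; rewrite opprD addrACA (splitr e).
by rewrite (le_lt_trans (cabsD _ _))// ltrD ?hN ?hM.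
Qed.

Lemma ctendsZ u a b : ctends u a -> ctends (fun n => b * u n) (b * a).
Proof.
move=> h e e0; have b0 : 0 < cabs b + 1 by rewrite ltr_wpDl ?cabs_ge0.
have [|N hN] := h (e / (cabs b + 1)); first by rewrite divr_gt0.
exists N => n /hN; rewrite ltr_pdivlMr //; apply: le_lt_trans.
by rewrite -mulrBr cabsM [leLHS]mulrC ler_wpM2l ?cabs_ge0 // lerDl.
Qed.

Lemma ctendsB u v a b :
  ctends u a -> ctends v b -> ctends (fun n => u n - v n) (a - b).
Proof.
move=> hu hv; rewrite -mulN1r.
by apply: eq_ctends (ctendsD hu (ctendsZ (-1) hv)) => n; rewrite mulN1r.
Qed.

Lemma ctends_cabs_le u a M :
  ctends u a -> (exists N : nat, forall n, (N <= n)%N -> cabs (u n) <= M) ->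
  cabs a <= M.
Proof.
move=> h [N hN]; apply/ler_addgt0Pr => e /h[L hL].
have := hL _ (leq_maxl L N); have := hN _ (leq_maxr L N).
move: (u _) => w hw wa; rewrite -(subrK w a) (le_trans (cabsD _ _))// addrC.
by rewrite lerD // cabsB ltW.
Qed.

Lemma ctends_uniq u a b : ctends u a -> ctends u b -> a = b.
Proof.
move=> h1 h2; apply/eqP; rewrite -subr_eq0 -cabs_eq0 eq_le cabs_ge0 andbT.
apply: (ctends_cabs_le (ctendsB h1 h2)); exists 0%N => n _.
by rewrite subrr cabs0.
Qed.

Lemma ctends_shift u a m : ctends (fun n => u (n + m)%N) a <-> ctends u a.
Proof.
split=> h e /h[N hN].
  exists (N + m)%N => n Nn; rewrite -(subnK (leq_trans (leq_addl N m) Nn)).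
  by apply: hN; lia.
by exists N => n Nn; apply: hN; lia.
Qed.

Lemma ctends_squeeze u a (v : nat -> R) :
  (forall n, cabs (u n - a) <= v n) -> v @ \oo --> (0 : R) -> ctends u a.
Proof.
move=> h /cvgrPdist_lt hv e /hv[N _ hN]; exists N => n Nn.
apply: le_lt_trans (h n) _; rewrite (le_lt_trans (ler_norm _))//.
by have := hN n Nn; rewrite /= sub0r normrN.
Qed.

Lemma ctends_sum (w : nat -> nat -> R[i]) (l : nat -> R[i]) m :
  (forall i, ctends (w i) (l i)) ->
  ctends (fun n => \sum_(0 <= i < m) w i n) (\sum_(0 <= i < m) l i).
Proof.
move=> h; elim: m => [|m IH].
  by rewrite big_geq //; apply: eq_ctends (ctends_cst _) => n; rewrite big_geq.
rewrite [X in ctends _ X]big_nat_recr //=.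
by apply: eq_ctends (ctendsD IH (h m)) => n; rewrite [RHS]big_nat_recr.
Qed.

Lemma ctends_ReIm u (p q : R) :
  (fun n => complex.Re (u n)) @ \oo --> p ->
  (fun n => complex.Im (u n)) @ \oo --> q -> ctends u (p +i* q).
Proof.
move=> /cvgrPdist_lt ha /cvgrPdist_lt hb e e0.
have e2 : 0 < e / 2 by rewrite divr_gt0.
have [N _ hN] := ha _ e2; have [M _ hM] := hb _ e2.
exists (maxn N M) => n; rewrite geq_max => /andP[/hN/= h1 /hM/= h2].
rewrite (splitr e); apply: le_lt_trans (cabs_le_ReIm _) _.
have -> : complex.Re (u n - p +i* q) = complex.Re (u n) - p by case: (u n).
have -> : complex.Im (u n - p +i* q) = complex.Im (u n) - q by case: (u n).
by rewrite distrC (distrC (complex.Im _)) ltrD.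
Qed.

Lemma continuous_Re : continuous (@complex.Re R : R[i] -> R).
Proof.
move=> w; apply/(@cvgrPdist_lt _ _ _ (nbhs w)) => e e0; apply/nbhsCP; exists e => // z hz.
apply: le_lt_trans hz; rewrite cabsB.
by apply: le_trans (Re_le_cabs _); case: (w) (z) => ? ? [? ?].
Qed.

End Modulus.

#[global] Arguments ComplexField.Normc.normc : simpl never.

(** * Absolutely convergent complex series *)

Section ComplexSeries.
Variable R : realType.
Local Notation C := R[i].
Implicit Types (x a : nat -> C) (M : R).

Lemma abs_cvg_series x M :
  (forall n, \sum_(0 <= i < n) cabs (x i) <= M) ->
  exists s : C, ctends (series x) s.
Proof.
move=> hM.
have cv (g : C -> R) : (forall z, `|g z| <= cabs z) ->
    cvgn (series (fun n => g (x n))).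
  move=> hg; apply: normed_cvg; apply: nondecreasing_is_cvgn.
    by apply: (@nondecreasing_series _ _ xpredT 0) => *; exact: normr_ge0.
  exists M => _ [n _ <-]; apply: le_trans (hM n).
  by rewrite /series /=; apply: ler_sum => i _; exact: hg.
have /cvg_ex[a ha] := cv _ (@Re_le_cabs R).
have /cvg_ex[b hb] := cv _ (@Im_le_cabs R).
exists (a +i* b); apply: ctends_ReIm.
  rewrite (_ : (fun _ => _) = series (fun n => complex.Re (x n)))//.
  apply/funext => n; rewrite /series /=.
  by elim/big_ind2 : _ => // ? z1 ? z2 <- <-; case: z1 z2 => ? ? [].
rewrite (_ : (fun _ => _) = series (fun n => complex.Im (x n)))//.
apply/funext => n; rewrite /series /=.
by elim/big_ind2 : _ => // ? z1 ? z2 <- <-; case: z1 z2 => ? ? [].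
Qed.

Section DoubleSeries.
Variables (x : nat -> nat -> C) (M : R).
Let D N := \sum_(0 <= n < N) \sum_(0 <= k < N) x n k.
Let A N := \sum_(0 <= n < N) \sum_(0 <= k < N) cabs (x n k).
Hypothesis hM : forall N, A N <= M.

Let squareS (V : zmodType) (y : nat -> nat -> V) N :
  \sum_(0 <= n < N.+1) \sum_(0 <= k < N.+1) y n k -
    \sum_(0 <= n < N) \sum_(0 <= k < N) y n k =
  \sum_(0 <= n < N) y n N + \sum_(0 <= k < N.+1) y N k.
Proof.
rewrite big_nat_recr //= (eq_bigr (fun n => \sum_(0 <= k < N) y n k + y n N)).
  by rewrite big_split /= [LHS]addrC -!addrA addKr.
by move=> n _; rewrite big_nat_recr.
Qed.

(** Passing from one square to the next adds a row and a column, so the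
    increments are dominated by those of the sums of moduli. *)
Lemma square_sums_cvg : exists S : C, ctends D S.
Proof.
have [S hS] : exists S : C, ctends (series (fun n => D n.+1 - D n)) S.
  apply: (@abs_cvg_series _ M) => n; apply: le_trans (hM n).
  have -> : A n = \sum_(0 <= i < n) (A i.+1 - A i).
    by rewrite telescope_sumr // [A 0%N]big_geq // subr0.
  apply: ler_sum => i _; rewrite /D /A !squareS (le_trans (cabsD _ _))// lerD//.
    exact: cabs_sum.
  exact: cabs_sum.
exists S; rewrite (_ : D = series (fun n => D n.+1 - D n))//; apply/funext => n.
by rewrite /series /= telescope_sumr // [D 0%N]big_geq // subr0.
Qed.

(** The first [N] full rows differ from the square of side [N] by at most what
    the sum of moduli still gains beyond that square. *)
Lemma row_sums_cvg (s : nat -> C) (S : C) :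
  ctends D S -> (forall n, ctends (series (x n)) (s n)) ->
  ctends (series s) S.
Proof.
move=> hD hs.
have Amono : {homo A : m n / (m <= n)%N >-> m <= n}.
  apply/nondecreasing_seqP => n; rewrite -subr_ge0 squareS addr_ge0 //;
    by apply: sumr_ge0 => *; exact: cabs_ge0.
have /cvg_ex[/= a ha] : cvgn A.
  apply: nondecreasing_is_cvgn => //; exists M => _ [n _ <-]; exact: hM.
have Aa n : A n <= a.
  by rewrite -(cvg_lim _ ha)//; apply: nondecreasing_cvgn_le => //; apply/cvg_ex; exists a.
have key N : cabs (series s N - D N) <= a - A N.
  apply: (@ctends_cabs_le _ (fun L => \sum_(0 <= n < N) series (x n) L - D N)).
    exact: ctendsB (ctends_sum _ hs) (ctends_cst _).
  exists N => L NL; rewrite /D -sumrB (le_trans (cabs_sum _ _ _))//.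
  apply: (@le_trans _ _ (A L - A N)); last by rewrite lerD2r.
  apply: (@le_trans _ _ (\sum_(0 <= n < N) \sum_(N <= k < L) cabs (x n k))).
    apply: ler_sum => n _; rewrite /series /= (big_cat_nat _ NL) //= addrAC subrr add0r.
    exact: cabs_sum.
  rewrite lerBrDr -big_split /=.
  rewrite [leRHS](big_cat_nat _ NL) //= -[leLHS]addr0 lerD//.
    by apply: ler_sum => n _; rewrite addrC -big_cat_nat.
  by do 2![apply: sumr_ge0 => ? _]; exact: cabs_ge0.
rewrite -[S]add0r.
apply: (@eq_ctends _ (fun N => (series s N - D N) + D N)) => [n|].
  by rewrite subrK.
apply: ctendsD hD; apply: (@ctends_squeeze _ _ _ (fun N => a - A N)).
  by move=> n; rewrite subr0 key.
by rewrite -(subrr a); apply: cvgB => //; exact: cvg_cst.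
Qed.

End DoubleSeries.

(** Summation of an absolutely convergent double series by rows and by columns:
    both iterated sums are the limit of the sums over growing squares. *)
Lemma double_series (x : nat -> nat -> C) M (s t : nat -> C) :
  (forall N, \sum_(0 <= n < N) \sum_(0 <= k < N) cabs (x n k) <= M) ->
  (forall n, ctends (series (x n)) (s n)) ->
  (forall k, ctends (series (x^~ k)) (t k)) ->
  exists S : C, ctends (series s) S /\ ctends (series t) S.
Proof.
move=> hM hs ht; have [S hS] := square_sums_cvg hM.
exists S; split; first exact: row_sums_cvg hM _ _ hS hs.
apply: (@row_sums_cvg (fun k n => x n k) M) ht.
  by move=> N; rewrite exchange_big.
by under eq_fun do rewrite exchange_big.
Qed.

(** The Cauchy product, as a double series summed along its diagonals. *)
Lemma cauchy_product (x y : nat -> C) (X Y : C) M N :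
  (forall n, \sum_(0 <= i < n) cabs (x i) <= M) ->
  (forall n, \sum_(0 <= i < n) cabs (y i) <= N) ->
  ctends (series x) X -> ctends (series y) Y ->
  let c k := \sum_(0 <= n < k.+1) x n * y (k - n)%N in
  ctends (series c) (X * Y) /\ forall n, \sum_(0 <= k < n) cabs (c k) <= M * N.
Proof.
move=> hM hN hX hY c.
have N0 : 0 <= N by apply: le_trans (hN 0%N); rewrite big_geq.
pose t n k : C := if (n <= k)%N then x n * y (k - n)%N else 0.
have rowS n L : \sum_(0 <= k < L) (if (n <= k)%N then cabs (y (k - n)%N) else 0) <= N.
  apply: le_trans (hN L); have [nL|Ln] := leqP n L; last first.
    rewrite big_nat_cond big1; first by rewrite sumr_ge0 // => i _; exact: cabs_ge0.
    by move=> i /andP[/andP[_ iL] _]; case: ifP => //; lia.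
  rewrite (big_cat_nat (leq0n _) nL) //= big_nat_cond big1 ?add0r; last first.
    by move=> i /andP[/andP[_ iL] _]; case: ifP => //; lia.
  rewrite -{1}(add0n n) big_addn; under eq_bigr do rewrite leq_addl addnK.
  rewrite [leRHS](big_cat_nat (leq0n _) (leq_subr n L)) //= lerDl sumr_ge0 //.
  by move=> i _; exact: cabs_ge0.
have tM L : \sum_(0 <= n < L) \sum_(0 <= k < L) cabs (t n k) <= M * N.
  apply: (@le_trans _ _ (\sum_(0 <= n < L) cabs (x n) * N)); last first.
    by rewrite -mulr_suml ler_wpM2r.
  apply: ler_sum => n _.
  apply: le_trans (ler_wpM2l (cabs_ge0 (x n)) (rowS n L)).
  rewrite mulr_sumr; apply: ler_sum => k _; rewrite /t; case: ifP => _.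
    by rewrite cabsM.
  by rewrite cabs0 mulr0.
have colE k L : (k < L)%N -> \sum_(0 <= n < L) t n k = c k.
  move=> kL; rewrite (big_cat_nat (leq0n _) kL) //= [X in _ + X]big_nat_cond.
  rewrite [X in _ + X]big1 ?addr0; last first.
    by move=> n /andP[/andP[kn _] _]; rewrite /t leqNgt kn.
  rewrite /c big_nat_cond [RHS]big_nat_cond; apply: eq_bigr => n.
  by rewrite andbT ltnS => /andP[_ nk]; rewrite /t nk.
split=> [|n]; last first.
  apply: le_trans (tM n); rewrite exchange_big /= big_nat_cond [leRHS]big_nat_cond.
  apply: ler_sum => k /andP[/andP[_ kn] _].
  by rewrite -(colE _ _ kn) cabs_sum.
have hs n : ctends (series (t n)) (x n * Y).
  apply/(ctends_shift _ _ n); apply: eq_ctends (ctendsZ (x n) hY) => L.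
  rewrite /series /= (big_cat_nat (leq0n _) (leq_addl L n)) //= [X in _ = X + _]big_nat_cond.
  rewrite [X in _ = X + _]big1 ?add0r; last first.
    by move=> i /andP[/andP[_ iL] _]; rewrite /t; case: ifP => //; lia.
  rewrite (_ : \sum_(n <= i < _) _ = \sum_(0 + n <= i < L + n) t n i) // big_addn addnK.
  by rewrite mulr_sumr; apply: eq_bigr => i _; rewrite /t leq_addl addnK.
have ht k : ctends (series (t ^~ k)) (c k).
  apply/(ctends_shift _ _ k.+1); apply: eq_ctends (ctends_cst _) => L.
  by rewrite /series /= colE // addnS ltnS leq_addl.
have [S [h1 h2]] := double_series tM hs ht.
have <- : S = X * Y => //; apply: ctends_uniq h1 _; rewrite mulrC.
apply: eq_ctends (ctendsZ Y hX) => L.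
by rewrite /series /= mulr_sumr; apply: eq_bigr => i _; rewrite mulrC.
Qed.

(** Absolute convergence on the closed disc of radius [r], in the form of a bound
    on partial sums: [M] then also bounds the sum. *)
Definition power_bounded a (r : R) (M : R) :=
  forall n, \sum_(0 <= i < n) cabs (a i) * r ^+ i <= M.

Lemma power_bounded_le a (r s : R) M :
  0 <= s -> s <= r -> power_bounded a r M -> power_bounded a s M.
Proof.
move=> s0 sr h n; apply: le_trans (h n); apply: ler_sum => i _.
by rewrite ler_wpM2l ?cabs_ge0 // lerXn2r // nnegrE // (le_trans s0).
Qed.

(** Abel's lemma: the terms of a convergent series are bounded, so on a smaller
    disc the series is dominated by a geometric one. *)
Lemma power_bounded_cvg a (r : R) (s : R) (l : C) :
  0 <= s -> s < r -> ctends (series (fun n => a n * r%:C ^+ n)) l ->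
  exists M, power_bounded a s M.
Proof.
move=> s0 sr h; have r0 : 0 < r by exact: le_lt_trans sr.
have [K hK] : exists K, forall n, cabs (a n) * r ^+ n <= K.
  have [N hN] := h 1 ltr01.
  exists (2 + \sum_(0 <= i < N) cabs (a i) * r ^+ i) => n.
  have p0 i : 0 <= cabs (a i) * r ^+ i by rewrite mulr_ge0 ?cabs_ge0 ?exprn_ge0 // ltW.
  have [Nn|nN] := leqP N n; last first.
    apply: ler_wpDl => //; rewrite (bigD1_seq n) ?mem_index_iota ?iota_uniq //=.
    by rewrite lerDl sumr_ge0.
  rewrite ler_wpDr ?sumr_ge0 //.
  have -> : cabs (a n) * r ^+ n = cabs (a n * r%:C ^+ n).
    by rewrite cabsM cabsX cabsR gtr0_norm.
  have -> : a n * r%:C ^+ n = (series (fun n => a n * r%:C ^+ n) n.+1 - l) -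
                              (series (fun n => a n * r%:C ^+ n) n - l).
    by rewrite /series /= [in RHS]big_nat_recr //=; ring.
  apply: le_trans (cabs_sub _ _) _; rewrite -[2]/(1 + 1) lerD // ltW //.
    by apply: hN; exact: leqW.
  exact: hN.
have K0 : 0 <= K by apply: le_trans (hK 0%N); rewrite mulr_ge0 ?cabs_ge0.
have q1 : s / r < 1 by rewrite ltr_pdivrMr // mul1r.
have q0 : 0 <= s / r by rewrite divr_ge0 // ltW.
exists (limn (series (geometric K (s / r)))) => n.
apply: (@le_trans _ _ (series (geometric K (s / r)) n)); last first.
  apply: nondecreasing_cvgn_le; last first.
    by apply: is_cvg_geometric_series; rewrite ger0_norm.
  apply: (@nondecreasing_series _ _ xpredT 0) => i _ _; exact: geometric_ge0.
rewrite /series /=; apply: ler_sum => i _.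
rewrite expr_div_n mulrA ler_pdivlMr ?exprn_gt0 // mulrAC.
by rewrite ler_wpM2r ?exprn_ge0.
Qed.

Lemma power_bounded_cvg_at a (r : R) M (z : C) :
  power_bounded a r M -> cabs z <= r ->
  exists2 l : C, ctends (series (fun n => a n * z ^+ n)) l & cabs l <= M.
Proof.
move=> h zr; have h1 n : \sum_(0 <= i < n) cabs (a i * z ^+ i) <= M.
  apply: le_trans (power_bounded_le (cabs_ge0 _) zr h n).
  by apply: ler_sum => i _; rewrite cabsM cabsX.
have [l hl] := abs_cvg_series h1; exists l => //.
apply: (ctends_cabs_le hl); exists 0%N => n _.
exact: le_trans (cabs_sum _ _ _) (h1 n).
Qed.

End ComplexSeries.

(** * Algebra of analytic functions *)

Section AnalyticFunctions.
Variable R : realType.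
Local Notation C := R[i].
Implicit Types (f g h : C -> C) (w c z : C) (a b : nat -> C) (r s M : R).

(** The data behind analyticity that estimates need: a closed disc on which the
    series converges absolutely, and a bound for the sum of its moduli. *)
Definition expansion f w a r M :=
  [/\ 0 < r, power_bounded a r M &
    forall z, cabs (z - w) <= r ->
      ctends (series (fun n => a n * (z - w) ^+ n)) (f z)].

Lemma expansion_le f w a r s M :
  0 < s -> s <= r -> expansion f w a r M -> expansion f w a s M.
Proof.
move=> s0 sr [r0 hM h]; split=> // [|z zs]; last exact: h (le_trans zs sr).
exact: power_bounded_le (ltW s0) sr hM.
Qed.

(** Shrinking the disc of convergence makes the convergence absolute on it. *)
Lemma analyticP f w :
  analytic_at f w <-> exists a r M, expansion f w a r M.
Proof.
split=> [[a [rho [rho0 h]]]|[a [r [M [r0 hM h]]]]]; last first.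
  exists a, r%:C; split; first by rewrite ltcR.
  by move=> z; rewrite normC_lt => /ltW/h/ctends_cvg.
have [rhoE r0] := gt0_complexE rho0; set r := complex.Re rho in rhoE r0.
have hr z : cabs (z - w) < r -> ctends (series (fun n => a n * (z - w) ^+ n)) (f z).
  by move=> hz; apply/ctends_cvg; apply: h; rewrite rhoE normC_lt.
have [r2 r3] : 0 < r / 2 /\ r / 2 < r by lra.
have [M hM] : exists M, power_bounded a (r / 2) M.
  have h1 : cabs ((w + (3 / 4 * r)%:C) - w) < r.
    by rewrite addrAC subrr add0r cabsR gtr0_norm; lra.
  apply: (power_bounded_cvg _ _ (r := 3 / 4 * r)); last first.
  - by have := hr _ h1; rewrite addrAC subrr add0r; exact.
  - lra.
  - lra.
by exists a, (r / 2), M; split=> // z hz; apply: hr; lra.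
Qed.

Lemma expansion_analytic f w a r M : expansion f w a r M -> analytic_at f w.
Proof. by move=> h; apply/analyticP; exists a, r, M. Qed.

Lemma series_coef0 a w : ctends (series (fun n => a n * (w - w) ^+ n)) (a 0%N).
Proof.
rewrite subrr; apply/ctends_shift; instantiate (1 := 1%N).
apply: eq_ctends (ctends_cst _) => n; rewrite addn1 /series /= big_nat_recl //=.
by rewrite expr0 mulr1 big1 ?addr0 // => i _; rewrite expr0n mulr0.
Qed.

Lemma expansion_coef0 f w a r M : expansion f w a r M -> a 0%N = f w.
Proof.
move=> [r0 _ h]; apply: ctends_uniq (series_coef0 a w) (h w _).
by rewrite subrr cabs0 ltW.
Qed.

Lemma eq_analytic f g w :
  (\forall z \near w, f z = g z) -> analytic_at f w -> analytic_at g w.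
Proof.
move=> /nbhsCP[d d0 fg] /analyticP[a [r [M h]]].
have s0 : 0 < Num.min (d / 2) r by rewrite lt_min divr_gt0 //; case: h.
apply/analyticP; exists a, (Num.min (d / 2) r), M.
have [] := expansion_le s0 _ h; first by rewrite ge_min lexx orbT.
move=> _ hM hs; split=> // z zs; rewrite -fg; first exact: hs.
by apply: le_lt_trans zs _; rewrite gt_min; apply/orP; left; lra.
Qed.

Lemma analytic_poly1 w c0 c1 : analytic_at (fun z => c0 + c1 * (z - w)) w.
Proof.
pose a n : C := if n is n'.+1 then if n' is _.+1 then 0 else c1 else c0.
have a2 n : a n.+2 = 0 by [].
apply/analyticP; exists a, 1, (cabs c0 + cabs c1); split=> //.
  move=> n; apply: (@le_trans _ _ (\sum_(0 <= i < n.+2) cabs (a i) * 1 ^+ i)).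
    rewrite [leRHS](big_cat_nat _ (leqW (leqW (leqnn n)))) //= lerDl sumr_ge0 //.
    by move=> i _; rewrite expr1n mulr1 cabs_ge0.
  rewrite big_nat_recl // big_nat_recl //= !expr1n !mulr1 big1 ?addr0 //.
  by move=> i _; rewrite cabs0 mul0r.
move=> z _; apply/(ctends_shift _ _ 2).
apply: eq_ctends (ctends_cst _) => n; rewrite addn2 /series /=.
rewrite big_nat_recl // big_nat_recl //= expr0 mulr1 expr1 big1 ?addr0 //.
by move=> i _; rewrite mul0r.
Qed.

Lemma analytic_cst w c : analytic_at (fun _ : C => c) w.
Proof.
apply: eq_analytic (analytic_poly1 w c 0).
by apply/nbhsCP; exists 1 => // z _; rewrite mul0r addr0.
Qed.

Lemma analytic_sub w c : analytic_at (fun z : C => z - c) w.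
Proof.
apply: eq_analytic (analytic_poly1 w (w - c) 1).
by apply/nbhsCP; exists 1 => // z _; rewrite mul1r addrC addrA subrK.
Qed.

Lemma analyticD f g w :
  analytic_at f w -> analytic_at g w -> analytic_at (fun z => f z + g z) w.
Proof.
move=> /analyticP[a [r [M hf]]] /analyticP[b [s [N hg]]].
have m0 : 0 < Num.min r s by rewrite lt_min; case: hf hg => -> _ _ [->].
have [] := expansion_le m0 _ hf; first by rewrite ge_min lexx.
have [] := expansion_le m0 _ hg; first by rewrite ge_min lexx orbT.
move=> _ hN hg' _ hM hf'; apply/analyticP.
exists (fun n => a n + b n), (Num.min r s), (M + N); split=> // [n|z hz].
  apply: le_trans (lerD (hM n) (hN n)); rewrite -big_split /=; apply: ler_sum => i _.
  by rewrite -mulrDl ler_wpM2r ?cabsD // exprn_ge0 // ltW.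
apply: eq_ctends (ctendsD (hf' z hz) (hg' z hz)) => n.
by rewrite /series /= -big_split /=; apply: eq_bigr => i _; rewrite mulrDl.
Qed.

Lemma analyticM f g w :
  analytic_at f w -> analytic_at g w -> analytic_at (fun z => f z * g z) w.
Proof.
move=> /analyticP[a [r [M hf]]] /analyticP[b [s [N hg]]].
have m0 : 0 < Num.min r s by rewrite lt_min; case: hf hg => -> _ _ [->].
have [] := expansion_le m0 _ hf; first by rewrite ge_min lexx.
have [] := expansion_le m0 _ hg; first by rewrite ge_min lexx orbT.
set q := Num.min r s in m0 *; move=> _ hN hg' _ hM hf'.
pose c k : C := \sum_(0 <= n < k.+1) a n * b (k - n)%N.
have cE (u : C) k : \sum_(0 <= n < k.+1) a n * u ^+ n * (b (k - n)%N * u ^+ (k - n)) =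
    c k * u ^+ k.
  rewrite /c mulr_suml big_nat_cond [RHS]big_nat_cond; apply: eq_bigr => n.
  by rewrite andbT ltnS => /andP[_ nk]; rewrite mulrACA -exprD subnKC.
have bnd (e : nat -> C) K (u : C) n : power_bounded e q K -> cabs u <= q ->
    \sum_(0 <= i < n) cabs (e i * u ^+ i) <= K.
  move=> hK uq; apply: le_trans (power_bounded_le (cabs_ge0 _) uq hK n).
  by apply: ler_sum => i _; rewrite cabsM cabsX.
have qC : cabs q%:C = q by rewrite cabsR gtr0_norm.
apply/analyticP; exists c, q, (M * N); split=> // [n|z hz].
  have cq : cabs q%:C <= q by rewrite qC.
  have [A hA _] := power_bounded_cvg_at hM cq.
  have [B hB _] := power_bounded_cvg_at hN cq.
  have [_ h] := cauchy_product (fun n => bnd _ _ _ n hM cq) (fun n => bnd _ _ _ n hN cq) hA hB.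
  by apply: le_trans (h n); apply: ler_sum => i _; rewrite cE cabsM cabsX qC.
have [h _] := cauchy_product (fun n => bnd _ _ _ n hM hz) (fun n => bnd _ _ _ n hN hz)
  (hf' z hz) (hg' z hz).
by apply: eq_ctends h => n; rewrite /series /=; apply: eq_bigr => i _; rewrite cE.
Qed.

End AnalyticFunctions.

(** * Local behaviour of analytic functions *)

Section AnalyticLocal.
Variable R : realType.
Local Notation C := R[i].
Implicit Types (f g h : C -> C) (w c z : C) (a b : nat -> C) (r s M : R).

(** The geometric series in [- (z - w) / (w - c)]. *)
Lemma analytic_inv w c : w != c -> analytic_at (fun z : C => (z - c)^-1) w.
Proof.
rewrite -subr_eq0; set d := w - c => d0.
have cd : 0 < cabs d by rewrite cabs_gt0.
pose a n : C := d^-1 * (- d^-1) ^+ n.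
have r0 : 0 < cabs d / 2 by rewrite divr_gt0.
have ca n (u : R) : cabs (a n) * u ^+ n = (cabs d)^-1 * (u / cabs d) ^+ n.
  by rewrite cabsM cabsX cabsN cabsV expr_div_n exprVn -mulrA; congr *%R; rewrite mulrC.
have geo (q : R) n : 0 <= q -> q <= 1 / 2 -> \sum_(0 <= i < n) q ^+ i <= 2.
  move=> q0 q2; suff : \sum_(0 <= i < n) q ^+ i <= 2 - 2 * q ^+ n.
    by move=> /le_trans; apply; rewrite lerBlDr lerDl mulr_ge0 ?exprn_ge0.
  elim: n => [|n IH]; first by rewrite big_geq // expr0; lra.
  rewrite big_nat_recr //= exprS; have := exprn_ge0 n q0; nra.
apply/analyticP; exists a, (cabs d / 2), ((cabs d)^-1 * 2); split=> // [n|z hz].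
  under eq_bigr do rewrite ca.
  rewrite -mulr_sumr ler_wpM2l ?invr_ge0 ?cabs_ge0 //; apply: geo.
    by rewrite divr_ge0 ?cabs_ge0 // ltW.
  by rewrite mulrAC divff ?gt_eqF // mul1r.
set u := z - w in hz.
have zc : z - c = d + u by rewrite /u /d; ring.
have zc0 : z - c != 0.
  rewrite -cabs_gt0 zc -[u]opprK; apply: lt_le_trans (cabs_lb _ _).
  by rewrite cabsN; lra.
pose q := - (d^-1 * u).
have sE n : series (fun n => a n * u ^+ n) n - (z - c)^-1 = - (z - c)^-1 * q ^+ n.
  elim: n => [|n IH]; first by rewrite /series /= big_geq // sub0r expr0 mulr1.
  rewrite /series /= big_nat_recr //= addrAC [X in X + _]IH.
  have -> : a n * u ^+ n = d^-1 * q ^+ n by rewrite /a -mulrA -exprMn mulNr.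
  rewrite exprS; move: (q ^+ n) => Q; rewrite /q zc; field.
  by rewrite -zc zc0 d0.
have q2 : cabs q <= 1 / 2.
  rewrite cabsN cabsM cabsV mulrC ler_pdivrMr //; lra.
have h1 : `|cabs q| < 1 by rewrite ger0_norm ?cabs_ge0 //; lra.
apply: (@ctends_squeeze _ _ _ (geometric (cabs (z - c)^-1) (cabs q))).
  by move=> n; rewrite sE cabsM cabsN cabsX.
exact: cvg_geometric.
Qed.

(** Re-expansion about another point of the disc of convergence: the binomial
    theorem gives an absolutely convergent double series. *)
Lemma analytic_recenter f w a r M w' :
  expansion f w a r M -> cabs (w' - w) < r -> analytic_at f w'.
Proof.
move=> [r0 hM hf] hw'; set d := w' - w in hw'.
pose q := (r - cabs d) / 2.
have q0 : 0 < q by rewrite /q; lra.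
have dq : cabs d + q <= r by rewrite /q; have := cabs_ge0 d; lra.
pose x (u : C) n k : C := a n * (d ^+ (n - k) * u ^+ k *+ 'C(n, k)).
have x0 u n k : (n < k)%N -> x u n k = 0.
  by move=> nk; rewrite /x bin_small // mulr0n mulr0.
have xM (u : C) : cabs u <= q -> forall L,
    \sum_(0 <= n < L) \sum_(0 <= k < L) cabs (x u n k) <= M.
  move=> uq L; have rs : cabs d + cabs u <= r by lra.
  have rs0 : 0 <= cabs d + cabs u by rewrite addr_ge0 ?cabs_ge0.
  apply: le_trans (power_bounded_le rs0 rs hM L).
  rewrite big_nat_cond [leRHS]big_nat_cond.
  apply: ler_sum => n /andP[/andP[_ nL] _].
  rewrite (big_cat_nat (leq0n _) nL) //= [X in _ + X]big_nat_cond.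
  rewrite [X in _ + X]big1 ?addr0; last first.
    by move=> k /andP[/andP[nk _] _]; rewrite x0 ?cabs0.
  rewrite exprDn mulr_sumr big_mkord; apply: ler_sum => k _.
  by rewrite /x cabsM normcMn cabsM !cabsX.
have hb k : exists l : C, ctends (series (fun n => a n * (d ^+ (n - k) *+ 'C(n, k)))) l.
  apply: (@abs_cvg_series _ _ (M / q ^+ k)) => L; rewrite ler_pdivlMr ?exprn_gt0 //.
  have qC : cabs q%:C = q by rewrite cabsR gtr0_norm.
  have := xM q%:C; rewrite qC => /(_ (lexx _) (maxn L k.+1)); apply: le_trans.
  rewrite mulr_suml [leRHS](big_cat_nat (leq0n _) (leq_maxl L k.+1)) //=.
  rewrite ler_wpDr ?sumr_ge0 // => [n _|]; first by rewrite sumr_ge0 // => i _; exact: cabs_ge0.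
  apply: ler_sum => n _; rewrite [leRHS](bigD1_seq k) ?iota_uniq ?mem_index_iota ?leq_maxr //=.
  rewrite ler_wpDr ?sumr_ge0 // => [i _|]; first exact: cabs_ge0.
  by rewrite /x -mulrnAl mulrA [leRHS]cabsM cabsX qC.
have [b hb'] := choice hb.
exists b, q%:C; split=> [|z]; first by rewrite ltcR.
rewrite normC_lt => /ltW hz; apply/ctends_cvg.
have hs n : ctends (series (x (z - w') n)) (a n * (z - w) ^+ n).
  apply/(ctends_shift _ _ n.+1); apply: eq_ctends (ctends_cst _) => L.
  rewrite /series /= (big_cat_nat (leq0n _) (leq_addl L n.+1)) //=.
  rewrite [X in _ = _ + X]big_nat_cond [X in _ = _ + X]big1 ?addr0; last first.
    by move=> i /andP[/andP[ni _] _]; rewrite x0.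
  rewrite /x -mulr_sumr big_mkord -exprDn; congr (_ * _ ^+ n).
  by rewrite /d; ring.
have ht k : ctends (series (x (z - w') ^~ k)) (b k * (z - w') ^+ k).
  rewrite mulrC; apply: eq_ctends (ctendsZ ((z - w') ^+ k) (hb' k)) => L.
  rewrite /series /= mulr_sumr; apply: eq_bigr => n _.
  by rewrite /x -mulrnAl [LHS]mulrCA; congr (_ * _); rewrite mulrC.
have [S [h1 h2]] := double_series (xM _ hz) hs ht.
have <- : S = f z => //; apply: ctends_uniq h1 _; apply: hf.
by apply: le_trans (cabs_tri _ w' _) _; rewrite -/d /q in hz *; lra.
Qed.

(** Dividing [f z - f w] by [z - w] shifts the sequence of coefficients. *)
Lemma expansion_quotient f w a r M :
  expansion f w a r M -> exists g, [/\ expansion g w (fun n => a n.+1) r (M / r) &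
    forall z, cabs (z - w) <= r -> f z = f w + (z - w) * g z].
Proof.
move=> hf; have [r0 hM h] := hf; have a0 := expansion_coef0 hf.
exists (fun z => if z == w then a 1%N else (f z - f w) / (z - w)); split; last first.
  move=> z _; case: eqP => [->|/eqP]; first by rewrite subrr mul0r addr0.
  by rewrite -subr_eq0 => zw; rewrite mulrC divfK // addrC subrK.
split=> // [n|z hz].
  rewrite ler_pdivlMr // mulr_suml; apply: le_trans (hM n.+1).
  rewrite [leRHS]big_nat_recl // ler_wpDl ?mulr_ge0 ?cabs_ge0 //.
  by apply: ler_sum => i _; rewrite -mulrA -exprSr.
case: eqP => [->|/eqP]; first exact: (series_coef0 (fun n => a n.+1)).
rewrite -subr_eq0 => zw.
have h1 : ctends (fun n => (z - w)^-1 * (series (fun n => a n * (z - w) ^+ n) n.+1 - a 0%N))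
     ((z - w)^-1 * (f z - a 0%N)).
  apply: ctendsZ; apply: ctendsB (ctends_cst _).
  by apply: eq_ctends ((ctends_shift _ _ 1).2 (h z hz)) => n; rewrite addn1.
rewrite -a0 mulrC; apply: eq_ctends h1 => n.
rewrite /series /= big_nat_recl //= expr0 mulr1 addrAC subrr add0r mulr_sumr.
by apply: eq_bigr => i _; rewrite exprS mulrCA mulKf.
Qed.

Lemma expansion_bound f w a r M z :
  expansion f w a r M -> cabs (z - w) <= r -> cabs (f z) <= M.
Proof.
move=> [r0 hM h] hz; have [l hl lM] := power_bounded_cvg_at hM hz.
by rewrite (ctends_uniq (h z hz) hl).
Qed.

Lemma analytic_quotient f w : analytic_at f w ->
  exists2 g, analytic_at g w & \forall z \near w, f z = f w + (z - w) * g z.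
Proof.
move=> /analyticP[a [r [M h]]]; have [g [hg fg]] := expansion_quotient h.
exists g; first exact: expansion_analytic hg.
by apply/nbhsCP; exists r => [|z /ltW]; [case: h|exact: fg].
Qed.

Lemma analytic_bounded f w : analytic_at f w ->
  exists2 M, 0 < M & \forall z \near w, cabs (f z) <= M.
Proof.
move=> /analyticP[a [r [M h]]]; exists (M + 1).
  by rewrite ltr_wpDl // (le_trans (cabs_ge0 (f w))) // (expansion_bound h) // subrr cabs0 ltW //; case: h.
apply/nbhsCP; exists r => [|z /ltW hz]; first by case: h.
by rewrite ler_wpDr // (expansion_bound h).
Qed.

Lemma analytic_continuous f w e : analytic_at f w -> 0 < e ->
  \forall z \near w, cabs (f z - f w) < e.
Proof.
move=> /analytic_quotient[g /analytic_bounded[M M0 /nbhsCP[r r0 hr]]].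
move=> /nbhsCP[s s0 hs] e0; apply/nbhsCP; exists (Num.min (Num.min r s) (e / M)).
  by rewrite !lt_min r0 s0 divr_gt0.
move=> z; rewrite !lt_min -andbA => /and3P[/hr h1 /hs -> h2].
rewrite addrAC subrr add0r cabsM; move: h2; rewrite ltr_pdivlMr //.
by apply: le_lt_trans; rewrite ler_wpM2l ?cabs_ge0.
Qed.

Lemma analytic_neq0 f w : analytic_at f w -> f w != 0 ->
  \forall z \near w, cabs (f w) / 2 < cabs (f z).
Proof.
move=> hf f0; have c0 : 0 < cabs (f w) / 2 by rewrite divr_gt0 // cabs_gt0.
have /nbhsCP[r r0 h] := analytic_continuous hf c0; apply/nbhsCP; exists r => // z /h.
by rewrite cabsB => hz; have := cabs_lb (f w) (f z); lra.
Qed.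

(** The order of the zero is the index of the first coefficient that does not
    vanish; it is reached by factoring out [z - w] repeatedly. *)
Lemma analytic_order f w : analytic_at f w ->
  (\forall z \near w, f z = 0) \/
  exists m g, [/\ analytic_at g w, g w != 0 &
    \forall z \near w, f z = (z - w) ^+ m * g z].
Proof.
move=> /analyticP[a [r [M h]]].
have [a0|] := pselect (forall n, a n = 0).
  left; have [r0 _ hz] := h; apply/nbhsCP; exists r => // z /ltW/hz h1.
  apply: ctends_uniq h1 _; apply: eq_ctends (ctends_cst _) => n.
  by rewrite /series /= big1 // => i _; rewrite a0 mul0r.
move=> /existsNP[m am]; right.
elim: m => [|m IH] in f a M h am *.
  exists 0%N, f; split; first exact: expansion_analytic h.
    by rewrite -(expansion_coef0 h); apply/eqP.
  by apply/nbhsCP; exists 1 => // z _; rewrite expr0 mul1r.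
have [g [hg fg]] := expansion_quotient h; have [r0 _ _] := h.
have [f0|f0] := eqVneq (f w) 0; last first.
  exists 0%N, f; split=> //; first exact: expansion_analytic h.
  by apply/nbhsCP; exists 1 => // z _; rewrite expr0 mul1r.
have [n [k [hk k0 /nbhsCP[s s0 hs]]]] := IH _ _ _ hg am.
exists n.+1, k; split=> //; apply/nbhsCP; exists (Num.min r s).
  by rewrite lt_min r0.
move=> z; rewrite lt_min => /andP[/ltW/fg -> /hs ->].
by rewrite f0 add0r exprS mulrA.
Qed.

(** After factoring out the zero at [w], the remaining factor has no zero near
    [w], unless [f] vanishes identically there. *)
Lemma analytic_isolated_zeros f w : analytic_at f w ->
  (forall e : R, 0 < e -> exists z, [/\ z != w, cabs (z - w) < e & f z = 0]) ->
  \forall z \near w, f z = 0.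
Proof.
move=> /analytic_order[//|[m [g [hg g0 /nbhsCP[r r0 fg]]]]] h.
have /nbhsCP[s s0 hs] := analytic_neq0 hg g0.
have [|z [zw]] := h (Num.min r s); first by rewrite lt_min r0.
rewrite lt_min => /andP[/fg -> /hs gz] /eqP.
rewrite mulf_eq0 expf_eq0 subr_eq0 (negbTE zw) andbF /= => /eqP gz0.
by move: gz; rewrite gz0 cabs0; have := cabs_ge0 (g w); lra.
Qed.

End AnalyticLocal.

(** * The maximum modulus principle *)

Section MaximumModulus.
Variable R : realType.
Local Notation C := R[i].
Implicit Types (f g h : C -> C) (w c z : C) (r s M : R).

Lemma analytic_near f w :
  analytic_at f w -> \forall z \near w, analytic_at f z.
Proof.
move=> /analyticP[a [r [M h]]]; apply/nbhsCP; exists r; first by case: h.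
by move=> z; exact: analytic_recenter h.
Qed.

(** Points where [f] is analytic are included: what matters is that some analytic
    function agrees with [f] around [w]. *)
Definition removable f w :=
  exists2 g, analytic_at g w & \forall z \near w^', f z = g z.

Lemma analytic_removable f w : analytic_at f w -> removable f w.
Proof. by move=> h; exists f => //; apply/dnbhsCP; exists 1. Qed.

Lemma removableD f g w :
  removable f w -> removable g w -> removable (fun z => f z + g z) w.
Proof.
move=> [f' hf /dnbhsCP[r r0 hr]] [g' hg /dnbhsCP[s s0 hs]].
exists (fun z => f' z + g' z); first exact: analyticD.
apply/dnbhsCP; exists (Num.min r s); first by rewrite lt_min r0.
by move=> z zw; rewrite lt_min => /andP[/(hr _ zw) -> /(hs _ zw) ->].
Qed.

Lemma removableM f g w :
  removable f w -> removable g w -> removable (fun z => f z * g z) w.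
Proof.
move=> [f' hf /dnbhsCP[r r0 hr]] [g' hg /dnbhsCP[s s0 hs]].
exists (fun z => f' z * g' z); first exact: analyticM.
apply/dnbhsCP; exists (Num.min r s); first by rewrite lt_min r0.
by move=> z zw; rewrite lt_min => /andP[/(hr _ zw) -> /(hs _ zw) ->].
Qed.

Lemma eq_removable f g w :
  (\forall z \near w^', f z = g z) -> removable f w -> removable g w.
Proof.
move=> /dnbhsCP[r r0 hr] [f' hf /dnbhsCP[s s0 hs]]; exists f' => //.
apply/dnbhsCP; exists (Num.min r s); first by rewrite lt_min r0.
by move=> z zw; rewrite lt_min => /andP[/(hr _ zw) <- /(hs _ zw) ->].
Qed.

(** All removable singularities are filled in at once, whatever the values of [f]
    there, so that the maximum principle applies to a single function. *)
Definition regularize f w : C :=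
  xget (f w) [set v | exists2 g, analytic_at g w &
    (\forall z \near w^', f z = g z) /\ v = g w].

Lemma punctured_eq_center f g w : analytic_at f w -> analytic_at g w ->
  (\forall z \near w^', f z = g z) -> f w = g w.
Proof.
move=> hf hg /dnbhsCP[r r0 fg]; apply/eqP; rewrite -subr_eq0.
have h : analytic_at (fun z => f z + (-1) * g z) w.
  exact: (analyticD hf (analyticM (analytic_cst w (-1)) hg)).
have /nbhsCP[s s0 hs] : \forall z \near w, f z + (-1) * g z = 0.
  apply: analytic_isolated_zeros h _ => e e0.
  have m0 : 0 < Num.min e r / 2 by rewrite divr_gt0 // lt_min e0.
  exists (w + (Num.min e r / 2)%:C); have hc : cabs (w + (Num.min e r / 2)%:C - w) = Num.min e r / 2.
    by rewrite addrAC subrr add0r cabsR gtr0_norm.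
  have zw : w + (Num.min e r / 2)%:C != w by rewrite -subr_eq0 -cabs_gt0 hc.
  have [h1 h2] : Num.min e r <= e /\ Num.min e r <= r by rewrite !ge_min !lexx orbT.
  split; [exact: zw|by rewrite hc; lra|].
  by rewrite fg // ?hc; [ring|lra].
by have := hs w; rewrite subrr cabs0 mulN1r => /(_ s0) ->.
Qed.

Lemma regularizeE f g w :
  analytic_at g w -> (\forall z \near w^', f z = g z) -> regularize f w = g w.
Proof.
move=> hg fg; rewrite /regularize; case: xgetP => [v _ [k hk [fk ->]]|].
  apply: punctured_eq_center => //; move/dnbhsCP: fg => [r r0 hr].
  move/dnbhsCP: fk => [s s0 hs]; apply/dnbhsCP; exists (Num.min r s).
    by rewrite lt_min r0.
  by move=> z zw; rewrite lt_min => /andP[/(hr _ zw) <- /(hs _ zw) ->].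
by move=> /(_ (g w)) h; exfalso; apply: h; exists g.
Qed.

Lemma regularize_id f w : analytic_at f w -> regularize f w = f w.
Proof. by move=> h; apply: regularizeE => //; apply/dnbhsCP; exists 1. Qed.

Lemma regularize_analytic f w :
  removable f w -> analytic_at (regularize f) w.
Proof.
move=> [g hg fg0]; have hg' := hg; have /dnbhsCP[r r0 fg] := fg0.
have /nbhsCP[s s0 hs] := analytic_near hg.
apply: eq_analytic hg; apply/nbhsCP; exists (Num.min r s).
  by rewrite lt_min r0.
move=> z; rewrite lt_min => /andP[zr /hs gz].
have [->|zw] := eqVneq z w; first by rewrite (regularizeE hg').
apply/esym; apply: (regularizeE gz); apply/dnbhsCP.
exists (Num.min (r - cabs (z - w)) (cabs (z - w))).
  by rewrite lt_min subr_gt0 zr cabs_gt0 subr_eq0.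
move=> y yz; rewrite lt_min => /andP[h1 h2]; apply: fg.
  by apply: contraTneq h2 => ->; rewrite cabsB ltxx.
by apply: le_lt_trans (cabs_tri _ z _) _; lra.
Qed.

(** Near a point where it is not constant, an analytic function is
    [f w + (z - w)^m g z] with [g w != 0]; moving along an [m]-th root of
    [f w / g w] increases the modulus. *)
Lemma local_maximum_modulus f w : analytic_at f w ->
  (\forall z \near w, cabs (f z) <= cabs (f w)) ->
  \forall z \near w, f z = f w.
Proof.
move=> hf /nbhsCP[r r0 hr].
have [f0|f0] := eqVneq (f w) 0.
  apply/nbhsCP; exists r => // z /hr; rewrite f0 cabs0 => h.
  by apply/eqP; rewrite -cabs_eq0 eq_le h cabs_ge0.
have hf' : analytic_at (fun z => f z + -1 * f w) w.
  exact: (analyticD hf (analyticM (analytic_cst w (-1)) (analytic_cst w (f w)))).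
case: (analytic_order hf') => [/nbhsCP[s s0 hs]|].
  apply/nbhsCP; exists s => // z /hs/eqP; rewrite mulN1r subr_eq0.
  by move/eqP.
move=> [m [g [hg g0 /nbhsCP[s s0 hs]]]]; exfalso.
have m0 : (0 < m)%N.
  case: m hs => // /(_ w); rewrite subrr cabs0 => /(_ s0).
  by rewrite expr0 mul1r mulN1r subrr => /esym/eqP; rewrite (negbTE g0).
(* [f z / f w] is about [1 + (z - w) ^+ m / c], which is [1 + t ^+ m] at
   [z = w + t y]. *)
pose c := f w / g w; have cz : c != 0 by rewrite mulf_neq0 ?invr_eq0.
pose y := m.-root c; have ym : y ^+ m = c by rewrite rootCK.
have y0 : 0 < cabs y by rewrite cabs_gt0; apply: contraNneq cz => y0; rewrite -ym y0 expr0n gtn_eqF.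
have e0 : 0 < cabs (f w) / (2 * cabs c).
  by rewrite divr_gt0 ?mulr_gt0 // cabs_gt0.
have /nbhsCP[p p0 hp] := analytic_continuous hg e0.
pose q := Num.min (Num.min r s) p.
have q0 : 0 < q by rewrite !lt_min r0 s0.
pose t := q / (2 * cabs y); have t0 : 0 < t by rewrite divr_gt0 ?mulr_gt0.
pose z := w + t%:C * y.
have zw : cabs (z - w) = q / 2.
  rewrite /z addrAC subrr add0r cabsM cabsR gtr0_norm // /t.
  by field; rewrite gt_eqF.
have [qr qs qp] : [/\ q <= r, q <= s & q <= p].
  by split; rewrite !ge_min lexx ?orbT.
have := hr z; rewrite zw => /(_ ltac:(lra)).
have := hs z; rewrite zw => /(_ ltac:(lra)).
have := hp z; rewrite zw => /(_ ltac:(lra)).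
rewrite mulN1r => h1 /eqP; rewrite subr_eq => /eqP fz.
have tm0 : 0 < t ^+ m by rewrite exprn_gt0.
have fzE : f z = f w * (1 + t ^+ m)%:C + (t ^+ m)%:C * c * (g z - g w).
  have zE : (z - w) ^+ m = (t ^+ m)%:C * c.
    by rewrite /z addrAC subrr add0r exprMn ym -rmorphXn.
  have -> : (1 + t ^+ m)%:C = 1 + (t ^+ m)%:C by rewrite rmorphD rmorph1.
  rewrite fz zE; move: (g z) (t ^+ m)%:C => gz T.
  by rewrite /c; field.
have b1 : cabs ((t ^+ m)%:C * c * (g z - g w)) < t ^+ m * cabs (f w).
  have cc : 0 < cabs c by rewrite cabs_gt0.
  have fc : 0 < cabs (f w) by rewrite cabs_gt0.
  rewrite -mulrA cabsM cabsR gtr0_norm // ltr_pM2l // [cabs (c * _)]cabsM mulrC.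
  rewrite -ltr_pdivlMr //; apply: lt_trans h1 _.
  rewrite ltr_pM2l // ltf_pV2 ?posrE ?mulr_gt0 //; lra.
have b2 : cabs (f w * (1 + t ^+ m)%:C) = cabs (f w) * (1 + t ^+ m).
  by rewrite cabsM cabsR ger0_norm // addr_ge0 // ltW.
have := cabs_lb (f w * (1 + t ^+ m)%:C) (- ((t ^+ m)%:C * c * (g z - g w))).
rewrite opprK -fzE cabsN b2; lra.
Qed.

(** Such a set lies in the continuous image of a square of the real plane. *)
Lemma closed_bounded_compact (K : set C) M :
  closed K -> (forall w, K w -> cabs w <= M) -> compact K.
Proof.
move=> cK hK; pose rect := `[- M, M] `*` `[- M, M] : set (R * R).
have : compact ((fun p : R * R => p.1 +i* p.2 : C) @` rect).
  apply: continuous_compact; last by apply: compact_setX; exact: segment_compact.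
  apply: continuous_subspaceT => p; apply/cvgCP => e e0.
  have e2 : 0 < e / 2 by rewrite divr_gt0.
  exists (ball p.1 (e / 2), ball p.2 (e / 2)).
    by split; exact: nbhsx_ballx.
  move=> q [h1 h2]; rewrite /ball /= in h1 h2.
  apply: le_lt_trans (cabs_le_ReIm _) _; rewrite /= (splitr e).
  by apply: ltrD; rewrite distrC.
move/(subclosed_compact cK); apply=> w Kw; exists (complex.Re w, complex.Im w).
  have := hK w Kw; have := Re_le_cabs w; have := Im_le_cabs w.
  rewrite /rect /= !in_itv /= !ler_norml => /andP[h1 h2] /andP[h3 h4] h5.
  by split; apply/andP; split; lra.
by case: (w).
Qed.

(** Among the points where [|f|] is maximal on [K], the one of largest real part
    lies on the boundary: elsewhere [f] would be locally constant there. *)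
Lemma maximum_modulus (K : set C) f M :
  compact K -> (forall w, K w -> analytic_at f w) ->
  (forall w, K w -> ~ nbhs w K -> cabs (f w) <= M) ->
  forall w, K w -> cabs (f w) <= M.
Proof.
move=> cK hf hM w0 Kw0.
have cf : {in K, continuous (fun z : C => cabs (f z))}.
  move=> w /set_mem Kw; apply/(@cvgrPdist_lt _ _ _ (nbhs w)) => e e0.
  have /nbhsCP[r r0 hr] := analytic_continuous (hf w Kw) e0.
  apply/nbhsCP; exists r => // z /hr; apply: le_lt_trans.
  rewrite ler_norml; apply/andP; split.
    by rewrite lerNl opprB cabs_lb.
  by rewrite cabsB cabs_lb.
have cf' : {within K, continuous (fun z : C => cabs (f z))}.
  exact: continuous_in_subspaceT.
have [|w1 /set_mem Kw1 max1] := compact_EVT_max _ cK cf'; first by exists w0.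
have clK := compact_closed (@norm_hausdorff _ _) cK.
pose K1 := K `&` [set w | cabs (f w) = cabs (f w1)].
have cK1 : compact K1.
  apply: (subclosed_compact _ cK); last by move=> ? [].
  rewrite -openC openE => w; rewrite /K1 setCI => -[nK|/= fw].
    have : nbhs w (~` K) by move: nK; rewrite -openC openE in clK; exact: clK.
    by apply: filterS => z nKz; left.
  have [Kw|nK] := pselect (K w); last first.
    have : nbhs w (~` K) by move: nK; rewrite -openC openE in clK; exact: clK.
    by apply: filterS => z nKz; left.
  have lt1 : cabs (f w) < cabs (f w1).
    by rewrite lt_neqAle (max1 w (mem_set Kw)) andbT; apply/eqP.
  have e0 : 0 < cabs (f w1) - cabs (f w) by rewrite subr_gt0.
  have /nbhsCP[r r0 hr] := analytic_continuous (hf w Kw) e0.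
  apply/nbhsCP; exists r => // z /hr h1; right=> /= h2.
  by have := cabs_lb (f z) (f w); lra.
have cRe : {within K1, continuous (@complex.Re R : C -> R)}.
  by apply: continuous_subspaceT; exact: continuous_Re.
have [|w2 /set_mem[Kw2 /= fw2] max2] := compact_EVT_max _ cK1 cRe; first by exists w1.
have hw2 : cabs (f w2) <= M.
  apply: hM => // nK2.
  have /nbhsCP[r r0 hr] := nK2.
  have lm : \forall z \near w2, cabs (f z) <= cabs (f w2).
    by apply/nbhsCP; exists r => // z /hr Kz; rewrite fw2; apply: max1; exact: mem_set.
  have /nbhsCP[s s0 hs] := local_maximum_modulus (hf w2 Kw2) lm.
  pose q := Num.min r s; have q0 : 0 < q by rewrite lt_min r0.
  have [qr qs] : q <= r /\ q <= s by rewrite !ge_min !lexx orbT.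
  pose z := w2 + (q / 2)%:C.
  have zw : cabs (z - w2) = q / 2.
    by rewrite /z addrAC subrr add0r cabsR gtr0_norm // divr_gt0.
  have K1z : K1 z.
    split; first by apply: hr; rewrite zw; lra.
    by rewrite /= hs ?zw //; lra.
  have := max2 z (mem_set K1z); rewrite /z; case: (w2) => u v /=; lra.
by rewrite (le_trans (max1 _ (mem_set Kw0))) // -fw2.
Qed.

(** The radii may be such that [r1 < 0]: the annulus is then a full disc. *)
Lemma annulus_bound f c r1 r2 M :
  (forall w, r1 <= cabs (w - c) -> cabs (w - c) <= r2 -> removable f w) ->
  (forall w, cabs (w - c) = r1 \/ cabs (w - c) = r2 ->
     analytic_at f w /\ cabs (f w) <= M) ->
  forall w, r1 <= cabs (w - c) -> cabs (w - c) <= r2 ->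
    cabs (regularize f w) <= M.
Proof.
move=> hf hM w w1 w2.
have cont : continuous (fun z : C => cabs (z - c)).
  move=> y; apply/(@cvgrPdist_lt _ _ _ (nbhs y)) => e e0; apply/nbhsCP; exists e => // z.
  apply: le_lt_trans; have := cabs_lb (y - c) (z - c); have := cabs_lb (z - c) (y - c).
  have -> : y - c - (z - c) = y - z by ring.
  have -> : z - c - (y - c) = z - y by ring.
  by rewrite (cabsB y z) => h1 h2; rewrite ler_norml; apply/andP; split; lra.
pose K : set C := [set z | r1 <= cabs (z - c) /\ cabs (z - c) <= r2].
have cK : compact K.
  apply: (@closed_bounded_compact _ (cabs c + r2)) => [|z [_ h]]; last first.
    by have := cabsD (z - c) c; rewrite subrK; lra.
  have -> : K = (fun z : C => cabs (z - c)) @^-1` [set x | r1 <= x] `&`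
                (fun z : C => cabs (z - c)) @^-1` [set x | x <= r2] by [].
  apply: closedI; apply: closed_comp => [? _|]; try exact: cont.
    exact: closed_ge.
  exact: closed_le.
apply: (@maximum_modulus K) => //; first by move=> z [z1 z2]; apply: regularize_analytic; exact: hf.
move=> z [z1 z2] nz.
have [h|h] := pselect (cabs (z - c) = r1 \/ cabs (z - c) = r2).
  by have [az bz] := hM z h; rewrite regularize_id.
exfalso; apply: nz; apply/nbhsCP.
move/not_orP: h => [/eqP n1 /eqP n2].
have {}z1 : r1 < cabs (z - c) by rewrite lt_neqAle eq_sym n1.
have {}z2 : cabs (z - c) < r2 by rewrite lt_neqAle n2.
exists (Num.min (cabs (z - c) - r1) (r2 - cabs (z - c))).
  by rewrite lt_min !subr_gt0 z1.
move=> y; rewrite lt_min => /andP[h1 h2]; rewrite /K /=.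
have := cabs_tri y z c; have := cabs_tri z y c; rewrite (cabsB z y).
by move=> h3 h4; split; lra.
Qed.

Lemma disc_bound f c r M :
  (forall w, cabs (w - c) <= r -> removable f w) ->
  (forall w, cabs (w - c) = r -> analytic_at f w /\ cabs (f w) <= M) ->
  forall w, cabs (w - c) <= r -> cabs (regularize f w) <= M.
Proof.
move=> hf hM w wr; apply: (@annulus_bound f c (-1) r) => //.
- by move=> z _; exact: hf.
- move=> z [h|]; last exact: hM.
  by have := cabs_ge0 (z - c); rewrite h; lra.
- by apply: le_trans (cabs_ge0 _); lra.
Qed.

(** The quotient [(f w - f 0) / w] is analytic in the disc, and its modulus is at
    most [M / r] on the boundary circle. *)
Lemma schwarz f r M :
  0 < r -> analytic_at f 0 ->
  (forall w, cabs w <= r -> removable f w) ->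
  (forall w, cabs w = r -> analytic_at f w /\ cabs (f w - f 0) <= M) ->
  forall w, cabs w <= r -> analytic_at f w ->
    cabs (f w - f 0) <= M / r * cabs w.
Proof.
move=> r0 f0 hf hM w wr fw.
pose q z := (f z + (- f 0)) * (z - 0)^-1.
have qan z : z != 0 -> analytic_at f z -> analytic_at q z.
  move=> z0 fz; exact: (analyticM (analyticD fz (analytic_cst z (- f 0))) (analytic_inv z0)).
have [->|w0] := eqVneq w 0; first by rewrite subrr cabs0 mulr0.
have : cabs (regularize q w) <= M / r.
  apply: (@disc_bound q 0 r) => [z|z|]; rewrite ?subr0 // => hz.
    have [->|z0] := eqVneq z 0.
      have [g hg /nbhsCP[s s0 hs]] := analytic_quotient f0; exists g => //.
      apply/dnbhsCP; exists s => // y y0 /hs; rewrite /q => ->.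
      by rewrite addrAC subrr add0r mulrC mulKf // subr0.
    apply: removableM; last exact: (analytic_removable (analytic_inv z0)).
    apply: removableD; [exact: hf|exact: (analytic_removable (analytic_cst z _))].
  have [fz bz] := hM z hz; have z0 : z != 0 by rewrite -cabs_gt0 hz.
  split; first exact: qan.
  by rewrite cabsM cabsV subr0 hz ler_wpM2r // invr_ge0 ltW.
rewrite regularize_id; last exact: qan.
by rewrite cabsM cabsV subr0 ler_pdivrMr // cabs_gt0.
Qed.

End MaximumModulus.

(** * Laurent expansions *)

Section Laurent.
Variable R : realType.
Local Notation C := R[i].
Implicit Types (f g h : C -> C) (w c z : C) (r s M : R).

Lemma expansion_zero g w (a : nat -> C) r M :
  expansion g w a r M -> (\forall z \near w^', g z = 0) -> forall n, a n = 0.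
Proof.
move=> hg g0 n; elim: n g a M hg g0 => [|n IH] g a M hg g0.
  rewrite (expansion_coef0 hg).
  exact: (punctured_eq_center (expansion_analytic hg) (analytic_cst w 0)).
have [k [hk gk]] := expansion_quotient hg; apply: IH hk _.
have gw : g w = 0.
  exact: (punctured_eq_center (expansion_analytic hg) (analytic_cst w 0)).
have [r0 _ _] := hg; move/dnbhsCP: g0 => [s s0 hs]; apply/dnbhsCP.
exists (Num.min r s) => [|z zw]; first by rewrite lt_min r0.
rewrite lt_min => /andP[/ltW/gk + /(hs _ zw)] => -> /eqP.
by rewrite gw add0r mulf_eq0 subr_eq0 (negbTE zw) /= => /eqP.
Qed.

Lemma power_series_expansion (a : nat -> C) r M w :
  0 < r -> power_bounded a r M -> exists f, expansion f w a r M.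
Proof.
move=> r0 hM.
have h z : exists l : C, cabs (z - w) <= r ->
    ctends (series (fun n => a n * (z - w) ^+ n)) l.
  have [hz|hz] := leP (cabs (z - w)) r; last by exists 0.
  by have [l hl _] := power_bounded_cvg_at hM hz; exists l.
by have [f hf] := choice h; exists f; split.
Qed.

(** The part of a Laurent expansion in negative powers is an entire function of
    the inverse variable.  If the whole expansion vanishes, this function is
    bounded by a multiple of the inverse modulus, hence zero. *)
Lemma laurent_expansion_eq0 w (d : int -> C) (rho : R) : 0 < rho ->
  (forall u : C, u != 0 -> cabs u < rho -> exists s : C,
    ctends (series (fun n : nat => d n%:Z * u ^ n%:Z)) s /\
    ctends (series (fun n : nat => d (- n.+1%:Z) * u ^ (- n.+1%:Z))) (- s)) ->
  forall n, d n = 0.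
Proof.
move=> rho0 hd.
pose a n := d n%:Z; pose b n := d (- n.+1%:Z).
pose r := rho / 2; have r0 : 0 < r by rewrite divr_gt0.
have rr : r < rho by rewrite /r; lra.
have toN (u : C) (n : nat) : u ^ n%:Z = u ^+ n by [].
have [M hM] : exists M, power_bounded a r M.
  pose q := 3 / 4 * rho; have qC : cabs q%:C = q by rewrite cabsR gtr0_norm // /q; lra.
  have [||s [hs _]] := hd q%:C; [by rewrite -cabs_gt0 qC /q; lra|by rewrite qC /q; lra|].
  by apply: (power_bounded_cvg _ _ hs); [exact: ltW|rewrite /q /r; lra].
have [S hS] := power_series_expansion 0 r0 hM.
have inv (v : C) : v != 0 -> rho^-1 < cabs v -> v^-1 != 0 /\ cabs v^-1 < rho.
  move=> v0 vr; split; first by rewrite invr_eq0.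
  by rewrite cabsV invf_plt ?posrE // (le_lt_trans _ vr) ?invr_ge0 ?ltW.
have vpow (v : C) (n : nat) : v^-1 ^ (- n.+1%:Z) = v * v ^+ n.
  by rewrite -exprz_inv invrK -exprS.
have hT (v : C) : rho^-1 < cabs v -> exists s : C,
    [/\ ctends (series (fun n => a n * (v^-1) ^+ n)) s &
        ctends (series (fun n => b n * v ^+ n)) (- s / v)].
  move=> vr; have v0 : v != 0.
    by rewrite -cabs_gt0; apply: lt_trans vr; rewrite invr_gt0.
  have [v1 v2] := inv v v0 vr; have [s [h1 h2]] := hd v^-1 v1 v2; exists s; split=> //.
  rewrite mulrC; apply: eq_ctends (ctendsZ v^-1 h2) => n.
  rewrite /series /= mulr_sumr; apply: eq_bigr => i _.
  by rewrite vpow mulrCA mulKf.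
have hN L : rho^-1 < L -> exists N, power_bounded b L N.
  move=> hL; have L0 : 0 < L by apply: lt_trans hL; rewrite invr_gt0.
  have LC : cabs (L + 1)%:C = L + 1 by rewrite cabsR gtr0_norm // addr_gt0.
  have [|s [_ h2]] := hT (L + 1)%:C; first by rewrite LC ltr_wpDr.
  by apply: (power_bounded_cvg _ _ h2); [exact: ltW|rewrite ltrDl].
have hTT v : exists l : C, ctends (series (fun n => b n * v ^+ n)) l.
  have [|N hN'] := hN (cabs v + rho^-1 + 1).
    by rewrite -addrA ltr_wpDl ?cabs_ge0 // ltrDl.
  have [|l hl _] := power_bounded_cvg_at (z := v) hN'; last by exists l.
  by rewrite -addrA lerDl addr_ge0 // invr_ge0 ltW.
have [T hT'] := choice hTT.
have Texp L : rho^-1 < L -> exists N, expansion T 0 b L N.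
  move=> hL; have [N hN'] := hN L hL; exists N; split=> //.
    by apply: lt_trans hL; rewrite invr_gt0.
  by move=> z _; have := hT' z; rewrite subr0.
have Tan v : analytic_at T v.
  have [|N hN'] := Texp (cabs v + rho^-1 + 1).
    by rewrite -addrA ltr_wpDl ?cabs_ge0 // ltrDl.
  apply: (analytic_recenter hN'); rewrite subr0 -addrA ltrDl.
  by rewrite addr_gt0 // invr_gt0.
have Tsmall v : r^-1 <= cabs v -> cabs (T v) <= M / cabs v.
  move=> hv; have vr : rho^-1 < cabs v by apply: lt_le_trans hv; rewrite ltf_pV2.
  have v0 : 0 < cabs v by apply: lt_trans vr; rewrite invr_gt0.
  have [s [h1 h2]] := hT v vr; rewrite (ctends_uniq (hT' v) h2) cabsM cabsN cabsV.
  rewrite ler_wpM2r ?invr_ge0 ?cabs_ge0 //.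
  have vr' : cabs v^-1 <= r by rewrite cabsV invf_ple ?posrE.
  have [l hl lM] := power_bounded_cvg_at hM vr'.
  by rewrite (ctends_uniq h1 hl).
have M0 : 0 <= M by apply: le_trans (hM 0%N); rewrite big_geq.
have T0 v : T v = 0.
  apply/eqP; rewrite -cabs_eq0 eq_le cabs_ge0 andbT; apply/ler_addgt0Pr => e e0.
  rewrite add0r.
  pose L := cabs v + r^-1 + M / e.
  have ri : 0 < r^-1 by rewrite invr_gt0.
  have Me : 0 <= M / e by rewrite divr_ge0 // ltW.
  have L0 : 0 < L by have := cabs_ge0 v; rewrite /L; lra.
  have : cabs (regularize T v) <= M / L.
    apply: (@disc_bound _ T 0 L) => [z _|z|]; rewrite ?subr0.
    - exact: analytic_removable.
    - move=> zL; split; first exact: Tan.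
      by rewrite -zL; apply: Tsmall; rewrite zL /L; have := cabs_ge0 v; lra.
    - by rewrite /L; lra.
  rewrite regularize_id; last exact: Tan.
  move=> /le_trans; apply; rewrite ler_pdivrMr // -ler_pdivrMl // mulrC.
  by rewrite /L; have := cabs_ge0 v; lra.
have b0 n : b n = 0.
  have [|N hN'] := Texp (rho^-1 + 1); first by rewrite ltrDl.
  by apply: (expansion_zero hN'); apply/dnbhsCP; exists 1.
have a0 n : a n = 0.
  apply: (expansion_zero hS); apply/dnbhsCP; exists r => // z z0; rewrite subr0 => zr.
  have [s [h1 h2]] := hd z z0 (lt_trans zr rr).
  have [_ _ /(_ z)] := hS; rewrite subr0 => /(_ (ltW zr)) h3.
  rewrite (ctends_uniq h3 h1); apply/eqP; rewrite -oppr_eq0; apply/eqP.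
  apply: ctends_uniq h2 _; apply: eq_ctends (ctends_cst _) => m.
  by rewrite /series /= big1 // => i _; have := b0 i; rewrite /b => ->; rewrite mul0r.
case=> n; first exact: a0.
by rewrite NegzE; exact: b0.
Qed.

Lemma laurent_expansion_uniq f w (c1 c2 : int -> C) :
  laurent_expansion f w c1 -> laurent_expansion f w c2 -> c1 = c2.
Proof.
move=> [r1 r10 h1] [r2 r20 h2]; apply/funext => n; apply/eqP; rewrite -subr_eq0.
have [e1 p1] := gt0_complexE r10; have [e2 p2] := gt0_complexE r20.
pose r := Num.min (complex.Re r1) (complex.Re r2).
have r0 : 0 < r by rewrite lt_min p1.
have [rr1 rr2] : r <= complex.Re r1 /\ r <= complex.Re r2 by rewrite !ge_min !lexx orbT.
apply/eqP; apply: (laurent_expansion_eq0 (d := fun n => c1 n - c2 n) 0 r0) => u u0 ur.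
have h (r' : C) : r' = (complex.Re r')%:C -> r <= complex.Re r' ->
    0 < `|w + u - w| < r'.
  move=> -> h; rewrite addrAC subrr add0r normr_gt0 u0 /= normC_lt; exact: lt_le_trans ur h.
have [s1 [t1 [hs1 ht1 f1]]] := h1 _ (h _ e1 rr1).
have [s2 [t2 [hs2 ht2 f2]]] := h2 _ (h _ e2 rr2).
have wu : w + u - w = u by rewrite addrAC subrr add0r.
rewrite wu in hs1 hs2 ht1 ht2.
exists (s1 - s2); split.
  move/ctends_cvg: hs1 => hs1; move/ctends_cvg: hs2 => hs2.
  apply: eq_ctends (ctendsB hs1 hs2) => m.
  by rewrite /series /= -sumrB; apply: eq_bigr => i _; rewrite mulrBl.
have -> : - (s1 - s2) = t1 - t2.
  have : s1 + t1 = s2 + t2 by rewrite -f1 -f2.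
  by move=> E; have -> : t1 = s2 + t2 - s1; [rewrite -E|]; ring.
move/ctends_cvg: ht1 => ht1; move/ctends_cvg: ht2 => ht2.
apply: eq_ctends (ctendsB ht1 ht2) => m.
by rewrite /series /= -sumrB; apply: eq_bigr => i _; rewrite mulrBl.
Qed.

(** Factoring out [z - w] repeatedly peels off one coefficient at a time. *)
Lemma expansion_taylor k g w (a : nat -> C) r M : expansion g w a r M ->
  exists2 h, analytic_at h w & forall z, cabs (z - w) <= r ->
    g z = \sum_(0 <= i < k) a i * (z - w) ^+ i + (z - w) ^+ k * h z.
Proof.
elim: k => [|k IH] in g a M * => hg.
  exists g; first exact: expansion_analytic hg.
  by move=> z _; rewrite big_geq // expr0 mul1r add0r.
have [k1 [hk gk]] := expansion_quotient hg.
have [h hh hE] := IH _ _ _ hk; exists h => // z hz.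
rewrite (gk z hz) (hE z hz) big_nat_recl // expr0 mulr1 (expansion_coef0 hg).
rewrite mulrDr mulr_sumr addrA; congr (_ + _ + _); last by rewrite exprS mulrA.
by apply: eq_bigr => i _; rewrite exprS mulrCA.
Qed.

(** Dividing the Taylor expansion of [(z - w)^k f z] by [(z - w)^k] gives a Laurent
    expansion of [f]; by uniqueness it is the one that [laurent_coef] selects. *)
Lemma laurent_principal_part f w k :
  removable (fun z => (z - w) ^+ k * f z) w ->
  removable (fun z => f z -
    \sum_(1 <= j < k.+1) laurent_coef f w (- j%:Z) * (z - w) ^ (- j%:Z)) w.
Proof.
move=> [g hg /dnbhsCP[s s0 fg]]; have /analyticP[a [r [M ha]]] := hg.
pose c (n : int) : C := if (0 <= n + k%:Z) then a (absz (n + k%:Z)) else 0.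
have cN (n : nat) : c n%:Z = a (n + k)%N by rewrite /c.
have cP (j : nat) : (j < k)%N -> c (- j.+1%:Z) = a (k - j.+1)%N.
  move=> jk; rewrite /c (_ : _ + _ = (k - j.+1)%N%:Z) //.
  by rewrite -subzn // addrC.
have c0 (j : nat) : (k <= j)%N -> c (- j.+1%:Z) = 0.
  by move=> kj; rewrite /c; case: ifP => // h; exfalso; lia.
pose q := Num.min r s; have [r0 hM hr] := ha.
have q0 : 0 < q by rewrite lt_min r0.
have fE z : z != w -> f z = ((z - w) ^+ k)^-1 * ((z - w) ^+ k * f z).
  by move=> zw; rewrite mulKf // expf_neq0 // subr_eq0.
have hc : laurent_expansion f w c.
  exists q%:C; first by rewrite ltcR.
  move=> z /andP[]; rewrite normr_gt0 subr_eq0 normC_lt lt_min => zw /andP[zr zs].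
  set u := z - w; have u0 : u != 0 by rewrite subr_eq0.
  have [h hh hE] := expansion_taylor k ha.
  pose t := \sum_(0 <= j < k) c (- j.+1%:Z) * u ^ (- j.+1%:Z).
  have tE : t = (u ^+ k)^-1 * \sum_(0 <= i < k) a i * u ^+ i.
    rewrite [in RHS]big_nat_rev /= mulr_sumr /t big_nat_cond [RHS]big_nat_cond.
    apply: eq_bigr => j /andP[/andP[_ jk] _]; rewrite cP // add0n mulrCA; congr (_ * _).
    rewrite -exprnN; apply: (mulfI (expf_neq0 k u0)); rewrite mulVKf ?expf_neq0 //.
    have -> : u ^+ k = u ^+ (k - j.+1) * u ^+ j.+1 by rewrite -exprD subnK.
    by rewrite mulfK ?expf_neq0.
  have hz : h z = (u ^+ k)^-1 * (g z - \sum_(0 <= i < k) a i * u ^+ i).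
    by rewrite (hE z (ltW zr)) addrAC subrr add0r mulKf // expf_neq0.
  exists (h z), t; split.
  - apply/ctends_cvg; rewrite hz.
    have h1 := (ctends_shift _ _ k).2 (hr z (ltW zr)).
    have h2 := ctendsB h1 (ctends_cst (\sum_(0 <= i < k) a i * u ^+ i)).
    apply: eq_ctends (ctendsZ (u ^+ k)^-1 h2) => n.
    rewrite /series /= (big_cat_nat (leq0n _) (leq_addl n k)) //= addrAC subrr add0r.
    rewrite (_ : \sum_(k <= i < _) _ = \sum_(0 + k <= i < n + k) a i * u ^+ i) //.
    rewrite big_addn addnK mulr_sumr; apply: eq_bigr => i _.
    rewrite cN exprD -[u ^ i]/(u ^+ i).
    by move: (u ^+ k) (expf_neq0 k u0) => K K0; field.
  - apply/ctends_cvg; apply/(ctends_shift _ _ k); apply: eq_ctends (ctends_cst _) => n.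
    rewrite /series /= [RHS](big_cat_nat (leq0n _) (leq_addl n k)) //=.
    rewrite [X in _ = _ + X]big_nat_cond [X in _ = _ + X]big1 ?addr0 //.
    by move=> i /andP[/andP[ki _] _]; rewrite c0 // mul0r.
  - by rewrite hz tE -mulrDr subrK (fE z zw) (fg z zw zs).
have lc : laurent_coef f w = c.
  rewrite /laurent_coef; case: xgetP => [c' _ hc'|/(_ c)//].
  exact: laurent_expansion_uniq hc' hc.
have [h hh hE] := expansion_taylor k ha; exists h => //.
apply/dnbhsCP; exists q => // z zw; rewrite lt_min => /andP[zr zs].
have zw0 : z - w != 0 by rewrite subr_eq0.
rewrite (fE z zw) (fg z zw zs) (hE z (ltW zr)) mulrDr mulKf ?expf_neq0 //.
apply/eqP; rewrite addrAC -subr_eq0 addrK subr_eq0; apply/eqP.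
rewrite big_add1 /= lc [in LHS]big_nat_rev /= mulr_sumr [LHS]big_nat_cond [RHS]big_nat_cond.
apply: eq_bigr => j /andP[/andP[_ jk] _]; rewrite cP // add0n mulrCA; congr (_ * _).
rewrite -exprnN; apply: (mulfI (expf_neq0 k zw0)); rewrite mulVKf ?expf_neq0 //.
have -> : (z - w) ^+ k = (z - w) ^+ (k - j.+1) * (z - w) ^+ j.+1 by rewrite -exprD subnK.
by rewrite mulfK ?expf_neq0.
Qed.

End Laurent.

(** * Meromorphic functions *)

Section Meromorphic.
Variable R : realType.
Local Notation C := R[i].
Implicit Types (f g h : C -> C) (w c z : C) (r s M : R).

(** Being meromorphic at [w], in a form that is stable under sums and products;
    functions that vanish around [w] are included. *)
Definition at_worst_pole f w :=
  exists m : nat, removable (fun z => (z - w) ^+ m * f z) w.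

Lemma analytic_pow w m : analytic_at (fun z : C => (z - w) ^+ m) w.
Proof.
elim: m => [|m IH].
  by apply: eq_analytic (analytic_cst w 1); apply/nbhsCP; exists 1.
apply: eq_analytic (analyticM (analytic_sub w w) IH).
by apply/nbhsCP; exists 1 => // z _; rewrite exprS.
Qed.

Lemma analytic_at_worst_pole f w : analytic_at f w -> at_worst_pole f w.
Proof.
move=> hf; exists 0%N; apply: eq_removable (analytic_removable hf).
by apply/dnbhsCP; exists 1 => // z _ _; rewrite expr0 mul1r.
Qed.

Lemma is_poleE f w : is_pole f w -> exists m g, [/\ (0 < m)%N, analytic_at g w,
  g w != 0 & \forall z \near w^', f z = (z - w) ^- m * g z].
Proof.
move=> [m m0 [g [hg g0 /dnbhsCP[r r0 fg]]]]; exists m, g; split=> //.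
by apply/dnbhsCP; exists r => // z zw /(fg _ zw) ->; rewrite -exprnN.
Qed.

Lemma pole_at_worst_pole f w : is_pole f w -> at_worst_pole f w.
Proof.
move=> /is_poleE[m [g [m0 hg g0 /dnbhsCP[r r0 fg]]]]; exists m, g => //.
apply/dnbhsCP; exists r => // z zw /(fg _ zw) ->.
by rewrite mulVKf // expf_neq0 // subr_eq0.
Qed.

Lemma at_worst_poleM f g w :
  at_worst_pole f w -> analytic_at g w -> at_worst_pole (fun z => f z * g z) w.
Proof.
move=> [m hf] hg; exists m; apply: eq_removable (removableM hf (analytic_removable hg)).
by apply/dnbhsCP; exists 1 => // z _ _; rewrite mulrA.
Qed.

Lemma at_worst_poleB f g w :
  at_worst_pole f w -> analytic_at g w -> at_worst_pole (fun z => f z - g z) w.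
Proof.
move=> [m hf] hg; exists m.
have h := analyticM (analytic_cst w (-1)) (analyticM (analytic_pow w m) hg).
apply: eq_removable (removableD hf (analytic_removable h)).
by apply/dnbhsCP; exists 1 => // z _ _; ring.
Qed.

(** Multiplied by a power of [z - w], the function becomes analytic, so its zeros
    are isolated or fill a neighbourhood. *)
Lemma zero_dichotomy f w : at_worst_pole f w ->
  exists2 r : R, 0 < r &
    (forall z, z != w -> cabs (z - w) < r -> f z = 0) \/
    (forall z, z != w -> cabs (z - w) < r -> f z != 0).
Proof.
move=> [m [g hg /dnbhsCP[r r0 fg]]].
have [/nbhsCP[s s0 hs]|[n [k [hk k0 /nbhsCP[s s0 hs]]]]] := analytic_order hg.
  exists (Num.min r s); first by rewrite lt_min r0.
  left=> z zw; rewrite lt_min => /andP[/(fg _ zw) fz /hs gz]; move/eqP: fz.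
  by rewrite gz mulf_eq0 expf_eq0 subr_eq0 (negbTE zw) andbF /= => /eqP.
have /nbhsCP[p p0 hp] := analytic_neq0 hk k0.
exists (Num.min (Num.min r s) p); first by rewrite !lt_min r0 s0.
right=> z zw; rewrite !lt_min -andbA => /and3P[/(fg _ zw) fz /hs gz /hp kz].
apply/eqP => f0; move/eqP: fz; rewrite f0 mulr0 gz eq_sym mulf_eq0 expf_eq0.
rewrite subr_eq0 (negbTE zw) andbF /= => /eqP kz0; move: kz.
by rewrite kz0 cabs0; have := cabs_ge0 (k w); lra.
Qed.

(** By the dichotomy, the parameters around whose point [f] vanishes identically
    form a set that is both open and closed in [[0, 1]]. *)
Lemma identity_segment f p q :
  (forall t : R, 0 <= t -> t <= 1 -> at_worst_pole f (p + t%:C * (q - p))) ->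
  (\forall z \near p^', f z = 0) -> \forall z \near q^', f z = 0.
Proof.
move=> hf hp.
pose y (t : R) := p + t%:C * (q - p).
pose Z (t : R) := \forall z \near (y t)^', f z = 0.
have yB (s t : R) : cabs (y s - y t) = `|s - t| * cabs (q - p).
  by rewrite -cabsR -cabsM; congr cabs; rewrite /y rmorphB /=; ring.
(* [Z] is locally constant along the segment. *)
have key t : 0 <= t -> t <= 1 -> exists2 d : R, 0 < d &
    (forall s : R, `|s - t| < d -> Z s) \/ (forall s : R, `|s - t| < d -> ~ Z s).
  move=> t0 t1; have [r r0 hr] := zero_dichotomy (hf t t0 t1).
  have c0 : 0 < cabs (q - p) + 1 by rewrite ltr_wpDl ?cabs_ge0.
  exists (r / (cabs (q - p) + 1)); first by rewrite divr_gt0.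
  have close (s : R) : `|s - t| < r / (cabs (q - p) + 1) -> cabs (y s - y t) < r.
    rewrite ltr_pdivlMr // yB; apply: le_lt_trans.
    by rewrite ler_wpM2l // lerDl.
  case: hr => hr; [left|right] => s /close sr.
    pose d := if y s == y t then r else cabs (y s - y t).
    apply/dnbhsCP; exists (Num.min (r - cabs (y s - y t)) d).
      rewrite lt_min subr_gt0 sr /d /=; case: eqP => // /eqP.
      by rewrite cabs_gt0 subr_eq0.
    move=> z zs; rewrite lt_min => /andP[h1 h2]; apply: hr; last first.
      by apply: le_lt_trans (cabs_tri _ (y s) _) _; lra.
    apply: contraTneq h2 => zt; rewrite /d; case: eqP => [yst|_].
      by move: zs; rewrite zt yst eqxx.
    by rewrite zt cabsB ltxx.
  move=> /dnbhsCP[e e0 he].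
  pose x := Num.min e (r - cabs (y s - y t)).
  have x0 : 0 < x by rewrite lt_min e0 subr_gt0.
  have [xe xr] : x <= e /\ x <= r - cabs (y s - y t) by rewrite !ge_min !lexx orbT.
  have pick : exists2 x1 : R, 0 < x1 < x & y s + x1%:C != y t.
    have [h|h] := eqVneq (y s + (x / 2)%:C) (y t); last by exists (x / 2) => //; lra.
    exists (x / 3); first lra.
    rewrite -h; apply/eqP => /addrI/complexI; lra.
  have [x1 /andP[x10 x1x] hx1] := pick.
  have zs : cabs (y s + x1%:C - y s) = x1.
    by rewrite addrAC subrr add0r cabsR gtr0_norm.
  have := hr _ hx1; rewrite he ?zs ?eqxx; last lra.
    move=> h; suff : false by []. apply: h.
    by apply: le_lt_trans (cabs_tri _ (y s) _) _; rewrite zs; lra.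
  by rewrite -subr_eq0 -cabs_gt0 zs.
pose S : set R := [set t | [/\ 0 <= t, t <= 1 & forall s, 0 <= s -> s <= t -> Z s]].
have Z0 : Z 0 by rewrite /Z /y mul0r addr0.
have S0 : S 0.
  split; [exact: lexx|exact: ler01|move=> s s0 s1].
  by have -> : s = 0 by apply/eqP; rewrite eq_le s0 s1.
have hsS : has_sup S by split; [exists 0|exists 1 => t []].
have sup0 : 0 <= sup S by exact: sup_upper_bound hsS _ S0.
have sup1 : sup S <= 1 by apply: sup_le_ub => [|t []//]; exists 0.
have [d d0 hd] := key _ sup0 sup1.
have [s [s0 s1 hs]] := sup_adherent d0 hsS; rewrite ltrBlDr => sd.
have Ss : S s by split; [exact: s0|exact: s1|exact: hs].
have ssup : s <= sup S by exact: sup_upper_bound hsS _ Ss.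
have close : `|s - sup S| < d by rewrite ler0_norm ?subr_le0 //; lra.
case: hd => hd; last by exfalso; apply: (hd s close); exact: hs.
pose t1 := Num.min 1 (sup S + d / 2).
have [t11 t12] : t1 <= 1 /\ t1 <= sup S + d / 2 by rewrite !ge_min !lexx orbT.
have St1 : S t1.
  split; [by rewrite le_min ler01; lra|exact: t11|move=> u u0 ut].
   have [us|su] := leP u s; first exact: hs.
  by apply: hd; rewrite ltr_norml; apply/andP; split; lra.
have t1sup : t1 <= sup S by exact: sup_upper_bound hsS _ St1.
have t1E : t1 = 1.
  apply/eqP; rewrite eq_le t11 leNgt; apply/negP; rewrite gt_min ltxx /= => h.
  have := t1sup; rewrite /t1 (min_r (ltW h)); lra.
have [_ _ /(_ 1)] := St1; rewrite t1E => /(_ ler01 (lexx _)).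
by rewrite /Z /y mul1r addrC subrK.
Qed.

Lemma pole_unbounded f w M : is_pole f w -> \forall z \near w^', M < cabs (f z).
Proof.
move=> /is_poleE[m [g [m0 hg g0 /dnbhsCP[r r0 fg]]]].
have /nbhsCP[s s0 hs] := analytic_neq0 hg g0.
have gw : 0 < cabs (g w) by rewrite cabs_gt0.
have M1 : 0 < `|M| + 1 by rewrite ltr_wpDl.
pose q := Num.min 1 (cabs (g w) / (2 * (`|M| + 1))).
have q0 : 0 < q by rewrite lt_min ltr01 divr_gt0 // mulr_gt0.
have [q1 q2] : q <= 1 /\ q <= cabs (g w) / (2 * (`|M| + 1)) by rewrite !ge_min !lexx orbT.
apply/dnbhsCP; exists (Num.min (Num.min r s) q); first by rewrite !lt_min r0 s0 ltr01 divr_gt0 ?mulr_gt0.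
move=> z zw; rewrite !lt_min -andbA => /and4P[/(fg _ zw) -> /hs gz z1 zq].
have zw0 : 0 < cabs (z - w) by rewrite cabs_gt0 subr_eq0.
rewrite cabsM cabsV cabsX mulrC ltr_pdivlMr ?exprn_gt0 //.
apply: lt_trans gz; apply: (@le_lt_trans _ _ (`|M| * cabs (z - w))).
  apply: (@le_trans _ _ (`|M| * cabs (z - w) ^+ m)).
    by rewrite ler_wpM2r ?exprn_ge0 ?cabs_ge0 // ler_norm.
  rewrite ler_wpM2l // -(prednK m0) exprS ler_piMr ?cabs_ge0 //.
  by rewrite exprn_ile1 ?cabs_ge0 // ltW.
have := zq; rewrite invfM mulrA ltr_pdivlMr //.
by rewrite mulrDr mulr1 mulrC; lra.
Qed.

(** If [f] had a pole of order [m > k], then [f g] would have one of order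
    [m - k], but [h] is bounded near [w]. *)
Lemma quotient_pole_order f g h w (k : nat) :
  analytic_at f w \/ is_pole f w -> has_order g w k%:Z -> analytic_at h w ->
  (\forall z \near w^', f z * g z = h z) ->
  removable (fun z => (z - w) ^+ k * f z) w.
Proof.
move=> [hf _ _ _|]; first exact: (analytic_removable (analyticM (analytic_pow w k) hf)).
move=> /is_poleE[m [u [m0 hu u0 /dnbhsCP[r r0 fu]]]].
move=> [v [hv v0 /dnbhsCP[s s0 gv]]] hh /dnbhsCP[p p0 fgh].
have [mk|km] := leqP m k.
  exists (fun z => (z - w) ^+ (k - m) * u z); first exact: (analyticM (analytic_pow w _) hu).
  apply/dnbhsCP; exists r => // z zw /(fu _ zw) ->.
  rewrite -{1}(subnK mk) exprD -mulrA mulVKf // expf_neq0 // subr_eq0 //.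
exfalso.
have [M M0 /nbhsCP[d d0 hd]] := analytic_bounded hh.
have uv0 : u w * v w != 0 by rewrite mulf_neq0.
have pol : is_pole (fun z => f z * g z) w.
  exists (m - k)%N; first by rewrite subn_gt0.
  exists (fun z => u z * v z); split; [exact: analyticM hu hv|exact: uv0|].
  apply/dnbhsCP; exists (Num.min r s); first by rewrite lt_min r0.
  move=> z zw; rewrite lt_min => /andP[/(fu _ zw) -> /(gv _ zw) ->].
  have zw0 : z - w != 0 by rewrite subr_eq0.
  rewrite mulrACA; congr (_ * _); rewrite -exprnN -[_ ^ k%:Z]/((z - w) ^+ k).
  have -> : (z - w) ^+ m = (z - w) ^+ (m - k) * (z - w) ^+ k by rewrite -exprD subnK // ltnW.
  by rewrite invfM -mulrA mulVf ?mulr1 // expf_neq0.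
have /dnbhsCP[e e0 he] := pole_unbounded M pol.
pose q := Num.min (Num.min d e) p; have q0 : 0 < q by rewrite !lt_min d0 e0.
have [qd qe qp] : [/\ q <= d, q <= e & q <= p] by split; rewrite !ge_min lexx ?orbT.
pose z := w + (q / 2)%:C.
have zq : cabs (z - w) = q / 2 by rewrite /z addrAC subrr add0r cabsR gtr0_norm // divr_gt0.
have zw : z != w by rewrite -subr_eq0 -cabs_gt0 zq divr_gt0.
have h1 : cabs (h z) <= M by apply: hd; rewrite zq; lra.
have h2 : M < cabs (f z * g z) by apply: he => //; rewrite zq; lra.
by move: h2; rewrite (fgh z zw) ?zq; lra.
Qed.

End Meromorphic.

(** * The power series of the complex exponential *)

Section ComplexExponential.
Variable R : realType.
Local Notation C := R[i].
Implicit Types (u v w z : C) (x y : R).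

Lemma cexp_real x : cexp x%:C = (expR x)%:C.
Proof. by rewrite /cexp /= cos0 sin0 mulr1. Qed.

Lemma cexpD u v : cexp (u + v) = cexp u * cexp v.
Proof.
case: u v => a b [c d]; rewrite /cexp /= expRD cosD sinD.
by apply/eqP; rewrite eq_complex /=; apply/andP; split; apply/eqP; ring.
Qed.

Lemma cabs_cexp w : cabs (cexp w) = expR (complex.Re w).
Proof.
rewrite /cexp cabsM cabsR ger0_norm ?expR_ge0 //.
have -> : cabs (cos (complex.Im w) +i* sin (complex.Im w)) = 1.
  by rewrite /ComplexField.Normc.normc cos2Dsin2 sqrtr1.
by rewrite mulr1.
Qed.

Definition cexp_coeff w (n : nat) : C := w ^+ n / n`!%:R.

Lemma cabs_natr n : cabs (n%:R : C) = n%:R.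
Proof. by rewrite -(rmorph_nat (real_complex R)) cabsR ger0_norm. Qed.

Lemma cabs_cexp_coeff w n : cabs (cexp_coeff w n) = exp_coeff (cabs w) n.
Proof. by rewrite cabsM cabsX cabsV cabs_natr. Qed.

Lemma exp_coeff_sum_le x n : 0 <= x -> \sum_(0 <= i < n) exp_coeff x i <= expR x.
Proof.
move=> x0.
have nd : nondecreasing_seq (series (exp_coeff x)).
  by apply: (@nondecreasing_series _ _ xpredT 0) => i _ _; exact: exp_coeff_ge0.
exact: (nondecreasing_cvgn_le nd (is_cvg_series_exp_coeff x) n).
Qed.

Lemma cexp_coeff_bound w n :
  \sum_(0 <= i < n) cabs (cexp_coeff w i) <= expR (cabs w).
Proof. by under eq_bigr do rewrite cabs_cexp_coeff; rewrite exp_coeff_sum_le ?cabs_ge0. Qed.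

Lemma cexp_series_real x : ctends (series (cexp_coeff x%:C)) (expR x)%:C.
Proof.
have Eseries n : series (cexp_coeff x%:C) n = (series (exp_coeff x) n)%:C.
  rewrite /series /= rmorph_sum /=; apply: eq_bigr => i _.
  by rewrite /cexp_coeff /exp_coeff /= rmorphM rmorphXn fmorphV rmorph_nat.
rewrite -complexr0; apply: ctends_ReIm; under eq_fun do rewrite Eseries /=.
  exact: is_cvg_series_exp_coeff.
exact: cvg_cst.
Qed.

(** The even terms are those of the cosine, the odd ones those of the sine. *)
Lemma cexp_series_imaginary y :
  ctends (series (cexp_coeff (0 +i* y))) (cos y +i* sin y).
Proof.
have E i : cexp_coeff (0 +i* y) i = cos_coeff y i +i* sin_coeff y i.
  have fE : (i`!%:R : C)^-1 = (i`!%:R^-1 : R)%:C by rewrite fmorphV rmorph_nat.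
  have sq k : (0 +i* y) ^+ k.*2 = ((-1) ^+ k * y ^+ k.*2)%:C.
    rewrite -mul2n exprM [(0 +i* y) ^+ 2](_ : _ = (- (y ^+ 2))%:C).
      by rewrite -rmorphXn /= exprM -exprMn mulN1r.
    by rewrite expr2; apply/eqP; rewrite eq_complex /=; apply/andP; split; apply/eqP; ring.
  rewrite /cexp_coeff fE /cos_coeff /sin_coeff /=.
  have -> : (0 +i* y) ^+ i = (0 +i* y) ^+ odd i * ((-1) ^+ i./2 * y ^+ i./2.*2)%:C.
    by rewrite -sq -exprD odd_double_half.
  have iE : y ^+ i = y ^+ odd i * y ^+ i./2.*2 by rewrite -exprD odd_double_half.
  have oE : (odd i)%:R * (-1) ^+ i.-1./2 = (odd i)%:R * (-1) ^+ i./2 :> R.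
    have [io|] := boolP (odd i); last by rewrite !mul0r.
    by rewrite -{1}(odd_double_half i) io add1n /= doubleK.
  rewrite oE iE -exprnP.
  move: (y ^+ i./2.*2) ((-1) ^+ i./2) (i`!%:R^-1) => p q e.
  by case: (odd i); rewrite ?expr0 ?expr1 /=; apply/eqP; rewrite eq_complex /=;
    apply/andP; split; apply/eqP; ring.
have Re_sum n : complex.Re (series (cexp_coeff (0 +i* y)) n) = series (cos_coeff y) n.
  rewrite /series /=; under eq_bigr do rewrite E.
  by elim/big_ind2 : _ => // ? z1 ? z2 <- <-; case: z1 z2 => ? ? [].
have Im_sum n : complex.Im (series (cexp_coeff (0 +i* y)) n) = series (sin_coeff y) n.
  rewrite /series /=; under eq_bigr do rewrite E.
  by elim/big_ind2 : _ => // ? z1 ? z2 <- <-; case: z1 z2 => ? ? [].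
apply: ctends_ReIm.
  by under eq_fun do rewrite Re_sum; rewrite unlock; exact: is_cvg_series_cos_coeff.
by under eq_fun do rewrite Im_sum; rewrite unlock; exact: is_cvg_series_sin_coeff.
Qed.

(** The Cauchy product of the series of [exp x] and [exp (i y)]. *)
Lemma cexp_series w : ctends (series (cexp_coeff w)) (cexp w).
Proof.
case: w => x y.
have -> : x +i* y = x%:C + (0 +i* y).
  by apply/eqP; rewrite eq_complex /= addr0 add0r !eqxx.
set u := x%:C; set v := 0 +i* y.
have [h _] := cauchy_product (cexp_coeff_bound u) (cexp_coeff_bound v)
  (cexp_series_real x) (cexp_series_imaginary y).
have -> : cexp (u + v) = (expR x)%:C * (cos y +i* sin y).
  by rewrite /cexp /= addr0 add0r.
apply: eq_ctends h => n; rewrite /series /=; apply: eq_bigr => k _.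
rewrite /cexp_coeff addrC exprDn mulr_suml big_mkord; apply: eq_bigr => i _.
have ik : (i <= k)%N by rewrite -ltnS.
have f0 m : (m`!%:R : C) != 0 by rewrite pnatr_eq0 -lt0n fact_gt0.
have -> : (k`!%:R : C) = 'C(k, i)%:R * (i`!%:R * (k - i)`!%:R) by rewrite -!natrM bin_fact.
rewrite -[_ *+ 'C(k, i)]mulr_natr.
have b0 : ('C(k, i)%:R : C) != 0 by rewrite pnatr_eq0 -lt0n bin_gt0.
move: (u ^+ i) (v ^+ (k - i)) (i`!%:R : C) (f0 i) ((k - i)`!%:R : C) (f0 (k - i)%N)
  ('C(k, i)%:R : C) b0 => p q a a0 b b0 c c0.
by field; rewrite a0 b0 c0.
Qed.

End ComplexExponential.

(** * Analyticity of Laplace transforms *)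

Section ComplexExpectation.
Context d (T : measurableType d) (R : realType) (P : probability T R).
Local Notation C := R[i].
Implicit Types (Z : T -> C) (h : T -> R).

Definition cmeasurable Z :=
  measurable_fun setT (fun t => complex.Re (Z t)) /\
  measurable_fun setT (fun t => complex.Im (Z t)).

Lemma Re_mul (u v : C) : complex.Re (u * v) =
  complex.Re u * complex.Re v - complex.Im u * complex.Im v.
Proof. by case: u v => a b []. Qed.

Lemma Im_mul (u v : C) : complex.Im (u * v) =
  complex.Re u * complex.Im v + complex.Im u * complex.Re v.
Proof. by case: u v => a b []. Qed.

Lemma Re_add (u v : C) : complex.Re (u + v) = complex.Re u + complex.Re v.
Proof. by case: u v => a b []. Qed.

Lemma Im_add (u v : C) : complex.Im (u + v) = complex.Im u + complex.Im v.
Proof. by case: u v => a b []. Qed.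

Lemma cmeasurableM Z1 Z2 : cmeasurable Z1 -> cmeasurable Z2 ->
  cmeasurable (fun t => Z1 t * Z2 t).
Proof.
move=> [r1 i1] [r2 i2]; split.
  under eq_fun do rewrite Re_mul.
  by apply: measurable_funB; apply: measurable_funM.
under eq_fun do rewrite Im_mul.
by apply: measurable_funD; apply: measurable_funM.
Qed.

Lemma cmeasurableD Z1 Z2 : cmeasurable Z1 -> cmeasurable Z2 ->
  cmeasurable (fun t => Z1 t + Z2 t).
Proof.
move=> [r1 i1] [r2 i2]; split.
  by under eq_fun do rewrite Re_add; apply: measurable_funD.
by under eq_fun do rewrite Im_add; apply: measurable_funD.
Qed.

Lemma cmeasurable_cst (c : C) : cmeasurable (fun=> c).
Proof. by split; exact: measurable_cst. Qed.

Lemma cmeasurable_real h : measurable_fun setT h -> cmeasurable (fun t => (h t)%:C).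
Proof. by move=> mh; split => //; exact: measurable_cst. Qed.

Lemma cmeasurable_cexp Z : cmeasurable Z -> cmeasurable (fun t => cexp (Z t)).
Proof.
move=> [r i]; apply: cmeasurableM.
  by apply: cmeasurable_real; exact: measurableT_comp.
split; apply: measurableT_comp => //.
  exact: (continuous_measurable_fun (@continuous_cos R)).
exact: (continuous_measurable_fun (@continuous_sin R)).
Qed.

Lemma cmeasurable_sum (S : nat -> T -> C) n : (forall i, cmeasurable (S i)) ->
  cmeasurable (fun t => \sum_(0 <= i < n) S i t).
Proof.
move=> hS; elim: n => [|n IH].
  under eq_fun do rewrite big_geq //; exact: cmeasurable_cst.
under eq_fun do rewrite big_nat_recr //=; exact: cmeasurableD.
Qed.

Lemma cintegrable_le Z h : cmeasurable Z -> P.-integrable setT (EFin \o h) ->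
  (forall t, cabs (Z t) <= h t) -> cintegrable P Z.
Proof.
move=> [r i] hh hZ; split; apply: (le_integrable _ _ _ hh) => //.
- exact/measurable_EFinP.
- move=> t _ /=; rewrite lee_fin (le_trans (Re_le_cabs _)) //.
  by rewrite (le_trans (hZ t)) // ler_norm.
- exact/measurable_EFinP.
- move=> t _ /=; rewrite lee_fin (le_trans (Im_le_cabs _)) //.
  by rewrite (le_trans (hZ t)) // ler_norm.
Qed.

Lemma cexpectationE Z : cexpectation P Z =
  (\int[P]_t complex.Re (Z t)) +i* (\int[P]_t complex.Im (Z t)).
Proof. by rewrite /cexpectation !unlock. Qed.

Lemma Rintegral_prob_cst (r : R) : \int[P]_t r = r.
Proof. by have := expectation_cst P r; rewrite /Rintegral unlock => ->. Qed.

Lemma cexpectationD Z1 Z2 : cintegrable P Z1 -> cintegrable P Z2 ->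
  cexpectation P (fun t => Z1 t + Z2 t) = cexpectation P Z1 + cexpectation P Z2.
Proof.
move=> [r1 i1] [r2 i2]; rewrite !cexpectationE.
under eq_Rintegral do rewrite Re_add.
under [X in _ +i* X]eq_Rintegral do rewrite Im_add.
by rewrite !RintegralD.
Qed.

Lemma cexpectationZ (c : C) Z : cintegrable P Z ->
  cexpectation P (fun t => c * Z t) = c * cexpectation P Z.
Proof.
move=> [r i]; rewrite !cexpectationE.
have mul a f : P.-integrable setT (EFin \o f) ->
    P.-integrable setT (EFin \o (fun t => a * f t)).
  move=> hf; rewrite (_ : _ \o _ = (fun t => a%:E * (EFin \o f) t)%E); last exact/funext.
  exact: integrableZl.
under eq_Rintegral do rewrite Re_mul.
under [X in _ +i* X]eq_Rintegral do rewrite Im_mul.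
rewrite RintegralB ?RintegralD ?RintegralZl //; try exact: mul.
by case: c.
Qed.

Lemma cintegrableZ (c : C) Z : cintegrable P Z -> cintegrable P (fun t => c * Z t).
Proof.
move=> [r i].
have mul a f : P.-integrable setT (EFin \o f) ->
    P.-integrable setT (EFin \o (fun t => a * f t)).
  move=> hf; rewrite (_ : _ \o _ = (fun t => a%:E * (EFin \o f) t)%E); last exact/funext.
  exact: integrableZl.
split; under eq_fun do rewrite /= ?Re_mul ?Im_mul.
  exact: (integrableB measurableT (mul _ _ r) (mul _ _ i)).
exact: (integrableD measurableT (mul _ _ i) (mul _ _ r)).
Qed.

Lemma cexpectation_sum (a : nat -> C) (S : nat -> T -> C) n :
  (forall i, cintegrable P (S i)) ->
  cexpectation P (fun t => \sum_(0 <= i < n) a i * S i t) =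
  \sum_(0 <= i < n) a i * cexpectation P (S i).
Proof.
move=> hS; have iS i := cintegrableZ (a i) (hS i).
have sumS m : cintegrable P (fun t => \sum_(0 <= i < m) a i * S i t).
  elim: m => [|m [IHr IHi]].
    under eq_fun do rewrite big_geq //.
    by split; exact: finite_measure_integrable_cst.
  have [rm im] := iS m; split.
    under eq_fun do rewrite /= big_nat_recr //= Re_add.
    exact: (integrableD measurableT IHr rm).
  under eq_fun do rewrite /= big_nat_recr //= Im_add.
  exact: (integrableD measurableT IHi im).
elim: n => [|n IH].
  rewrite big_geq // cexpectationE; under eq_Rintegral do rewrite big_geq //=.
  under [X in _ +i* X]eq_Rintegral do rewrite big_geq //=.
  by rewrite Rintegral_prob_cst.
rewrite big_nat_recr //= -IH -cexpectationZ // -cexpectationD //; congr cexpectation.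
by apply/funext => t; rewrite big_nat_recr.
Qed.

Lemma ctends_Re (u : nat -> C) l : ctends u l ->
  (fun n => complex.Re (u n)) @ \oo --> complex.Re l.
Proof.
move=> h; apply/cvgrPdist_lt => e /h[N hN]; exists N => // n /= Nn.
have := hN n Nn; rewrite cabsB; apply: le_lt_trans.
by apply: le_trans (Re_le_cabs _); case: (u n) (l) => ? ? [].
Qed.

Lemma ctends_Im (u : nat -> C) l : ctends u l ->
  (fun n => complex.Im (u n)) @ \oo --> complex.Im l.
Proof.
move=> h; apply/cvgrPdist_lt => e /h[N hN]; exists N => // n /= Nn.
have := hN n Nn; rewrite cabsB; apply: le_lt_trans.
by apply: le_trans (Im_le_cabs _); case: (u n) (l) => ? ? [].
Qed.

Lemma Rintegral_dominated (f : nat -> T -> R) (g h : T -> R) :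
  (forall n, measurable_fun setT (f n)) -> measurable_fun setT g ->
  (forall t, f ^~ t @ \oo --> g t) -> P.-integrable setT (EFin \o h) ->
  (forall n t, `|f n t| <= h t) ->
  (fun n => \int[P]_t f n t) @ \oo --> \int[P]_t g t.
Proof.
move=> mf mg fg ih fh.
have [|||||ig _ cv] := @dominated_convergence _ T R P setT measurableT
  (fun n => EFin \o f n) (EFin \o g) (EFin \o h).
- by move=> n; exact/measurable_EFinP.
- exact/measurable_EFinP.
- by apply: aeW => t _ /=; apply: cvg_EFin; [exact: nearW|exact: fg].
- exact: ih.
- by apply: aeW => t n _ /=; rewrite lee_fin.
rewrite /Rintegral; apply: fine_cvg; rewrite fineK; first exact: cv.
exact: integrable_fin_num.
Qed.

Lemma cexpectation_dominated (S : nat -> T -> C) Z h :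
  (forall n, cmeasurable (S n)) -> cmeasurable Z ->
  (forall t, ctends (S ^~ t) (Z t)) -> P.-integrable setT (EFin \o h) ->
  (forall n t, cabs (S n t) <= h t) ->
  ctends (fun n => cexpectation P (S n)) (cexpectation P Z).
Proof.
move=> mS [mr mi] SZ ih Sh; rewrite cexpectationE.
under eq_fun do rewrite cexpectationE.
apply: ctends_ReIm => /=.
  apply: (@Rintegral_dominated _ _ h) => //; first by move=> n; case: (mS n).
    by move=> t; exact: ctends_Re.
  by move=> n t; apply: le_trans (Sh n t); exact: Re_le_cabs.
apply: (@Rintegral_dominated _ _ h) => //; first by move=> n; case: (mS n).
  by move=> t; exact: ctends_Im.
by move=> n t; apply: le_trans (Sh n t); exact: Im_le_cabs.
Qed.

Section Laplace.
Variable W : T -> R.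
Hypothesis mW : measurable_fun setT W.
Hypothesis W0 : forall t, 0 <= W t.

Lemma cmeasurable_laplace (th : C) : cmeasurable (fun t => cexp (- th * (W t)%:C)).
Proof.
apply: cmeasurable_cexp; apply: cmeasurableM; first exact: cmeasurable_cst.
exact: cmeasurable_real.
Qed.

Lemma Re_mul_real (th : C) x : complex.Re (- th * x%:C) = - complex.Re th * x.
Proof. by case: th => a b; rewrite Re_mul /= mulr0 subr0. Qed.

(** The integrand has modulus at most 1; the constant is 2 because real and
    imaginary parts are integrated separately. *)
Lemma laplace_bound (th : C) : 0 <= complex.Re th -> cabs (laplace P W th) <= 2.
Proof.
move=> th0; have [mr mi] := cmeasurable_laplace th.
have le1 t : cabs (cexp (- th * (W t)%:C)) <= 1.
  by rewrite cabs_cexp Re_mul_real -expR0 ler_expR mulNr oppr_le0 mulr_ge0.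
have i1 : P.-integrable setT (EFin \o (fun=> 1 : R)).
  exact: finite_measure_integrable_cst.
have [ir ii] := cintegrable_le (cmeasurable_laplace th) i1 le1.
have bound (f : T -> R) : P.-integrable setT (EFin \o f) ->
    (forall t, `|f t| <= 1) -> `|\int[P]_t f t| <= 1.
  move=> fi f1; apply: le_trans (le_normr_Rintegral _ fi) _ => //.
  apply: (@le_trans _ _ (\int[P]_t 1)).
    by apply: le_Rintegral => //; exact: integrable_norm.
  by rewrite Rintegral_prob_cst.
rewrite /laplace cexpectationE; apply: le_trans (cabs_le_ReIm _) _ => /=.
rewrite -[2]/(1 + 1); apply: lerD.
  exact: bound ir (fun t => le_trans (Re_le_cabs _) (le1 t)).
exact: bound ii (fun t => le_trans (Im_le_cabs _) (le1 t)).
Qed.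

Lemma laplace_at0 : laplace P W 0 = 1.
Proof.
rewrite /laplace cexpectationE.
have E t : cexp (- 0 * (W t)%:C) = 1.
  by rewrite oppr0 mul0r -[0]/(0%:C) cexp_real expR0.
under eq_Rintegral do rewrite E /=.
under [X in _ +i* X]eq_Rintegral do rewrite E /=.
by rewrite !Rintegral_prob_cst.
Qed.

(** Expanding the exponential under the expectation; the partial sums are
    dominated by [expR (c * W)] as long as [|z - th| <= Re th + c]. *)
Lemma laplace_analytic c (th : C) : P.-integrable setT (fun t => (expR (c * W t))%:E) ->
  - c < complex.Re th -> analytic_at (laplace P W) th.
Proof.
move=> ic cth; pose rho := complex.Re th + c; have rho0 : 0 < rho by rewrite /rho; lra.
pose S n t := cexp (- th * (W t)%:C) * cexp_coeff (- (W t)%:C) n.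
have SE n t (u : C) : u ^+ n * S n t = cexp (- th * (W t)%:C) * cexp_coeff (- u * (W t)%:C) n.
  rewrite /S mulrCA; congr (_ * _).
  by rewrite /cexp_coeff mulrA -exprMn mulrN mulNr.
have mS n : cmeasurable (S n).
  apply: cmeasurableM; first exact: cmeasurable_laplace.
  under eq_fun do rewrite /cexp_coeff -rmorphN -rmorphXn /=.
  apply: cmeasurableM; last exact: cmeasurable_cst.
  apply: cmeasurable_real; apply: measurable_funX.
  exact: measurableT_comp.
have sumbound t n (u : C) : cabs u <= rho ->
    \sum_(0 <= i < n) cabs (u ^+ i * S i t) <= expR (c * W t).
  move=> ur; under eq_bigr do rewrite SE cabsM.
  rewrite -mulr_sumr cabs_cexp Re_mul_real.
  have -> : c * W t = - complex.Re th * W t + rho * W t by rewrite /rho; ring.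
  rewrite expRD ler_wpM2l ?expR_ge0 //; apply: le_trans (cexp_coeff_bound _ _) _.
  by rewrite ler_expR cabsM cabsN cabsR ger0_norm // ler_wpM2r.
have iS n : cintegrable P (S n).
  apply: (@cintegrable_le _ (fun t => (rho ^+ n)^-1 * expR (c * W t))) => //.
    rewrite (_ : _ \o _ = (fun t => ((rho ^+ n)^-1)%:E * (expR (c * W t))%:E)%E); last exact/funext.
    exact: integrableZl.
  move=> t; rewrite ler_pdivlMl ?exprn_gt0 //.
  have rC : cabs rho%:C = rho by rewrite cabsR gtr0_norm.
  apply: le_trans (sumbound t n.+1 rho%:C _); last by rewrite rC.
  rewrite big_nat_recr //= ler_wpDl ?sumr_ge0 // => [i _|]; first exact: cabs_ge0.
  by rewrite cabsM cabsX rC.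
exists (fun n => cexpectation P (S n)), rho%:C; split; first by rewrite ltcR.
move=> z; rewrite normC_lt => /ltW zr; set u := z - th in zr *.
apply/ctends_cvg.
apply: (@eq_ctends _ (fun n => cexpectation P
   (fun t => \sum_(0 <= i < n) u ^+ i * S i t))) => [n|].
  rewrite cexpectation_sum // /series /=; apply: eq_bigr => i _.
  by rewrite mulrC.
apply: (@cexpectation_dominated _ _ (fun t => expR (c * W t))) => //.
- move=> n; apply: cmeasurable_sum => i; exact: cmeasurableM (cmeasurable_cst _) (mS i).
- exact: cmeasurable_laplace.
- move=> t; have -> : - z * (W t)%:C = - th * (W t)%:C + - u * (W t)%:C by rewrite /u; ring.
  rewrite cexpD; apply: eq_ctends (ctendsZ _ (cexp_series _)) => n.
  by rewrite /series /= mulr_sumr; apply: eq_bigr => i _; rewrite SE.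
- by move=> n t; apply: le_trans (cabs_sum _ _ _) _; exact: sumbound.
Qed.

End Laplace.

End ComplexExpectation.

(** * The stationary equation in exponential form *)

Section ProductProbability.
Context d1 d2 (T1 : measurableType d1) (T2 : measurableType d2) (R : realType).
Variables (P1 : probability T1 R) (P2 : probability T2 R).

Let prod := (P1 \x P2)%E.

HB.instance Definition _ := Measure.on prod.

Let prod_setT : prod setT = 1%E.
Proof.
rewrite -setXTT; transitivity (P1 setT * P2 setT)%E; first exact: product_measure1E.
by rewrite (probability_setT P1) (probability_setT P2) mule1.
Qed.

HB.instance Definition _ := Measure_isProbability.Build _ _ _ prod prod_setT.

(** The product measure as a probability, under which the two coordinates are
    independent and of which Laplace transforms can be taken. *)
Definition product_probability : probability (T1 * T2)%type R := prod.

Local Open Scope ereal_scope.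

Lemma integral_product (f : T1 -> R) (g : T2 -> R) :
  measurable_fun setT f -> measurable_fun setT g ->
  (forall t, (0 <= f t)%R) -> (forall t, (0 <= g t)%R) ->
  \int[P1 \x P2]_z (f z.1 * g z.2)%:E =
    \int[P1]_t (f t)%:E * \int[P2]_t (g t)%:E.
Proof.
move=> mf mg f0 g0.
have mfg : measurable_fun setT (fun z : T1 * T2 => (f z.1 * g z.2)%:E).
  apply/measurable_EFinP; apply: measurable_funM; exact: measurableT_comp.
rewrite fubini_tonelli1 // => [|z]; last by rewrite lee_fin mulr_ge0.
rewrite /fubini_F /=.
under eq_integral do under eq_integral do rewrite EFinM.
under eq_integral => t _.
  rewrite ge0_integralZl //; [|exact/measurable_EFinP|by move=> s _; rewrite lee_fin|by rewrite lee_fin].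
  over.
rewrite ge0_integralZr //; [exact/measurable_EFinP|by move=> t _; rewrite lee_fin|].
by apply: integral_ge0 => t _; rewrite lee_fin.
Qed.

End ProductProbability.

Section Independence.
Context d (T : measurableType d) (R : realType) (P : probability T R).
Local Open Scope ereal_scope.

(** Independence on rectangles identifies the joint law of [X] and [Y] with the
    product of their laws, by uniqueness of product measures. *)
Lemma integral_independent (X Y : {RV P >-> R}) (f g : R -> R) :
  independent P X Y -> measurable_fun setT f -> measurable_fun setT g ->
  (forall x, (0 <= f x)%R) -> (forall x, (0 <= g x)%R) ->
  \int[P]_t (f (X t) * g (Y t))%:E =
    \int[P]_t (f (X t))%:E * \int[P]_t (g (Y t))%:E.
Proof.
move=> ind mf mg f0 g0.
pose XY t := (X t, Y t).
have mXY : measurable_fun setT XY by exact/measurable_fun_pair.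
pose h (z : R * R) := (f z.1 * g z.2)%:E.
have mh : measurable_fun setT h.
  apply/measurable_EFinP; apply: measurable_funM; exact: measurableT_comp.
transitivity (\int[pushforward P XY]_z h z).
  rewrite (ge0_integral_pushforward mXY) ?preimage_setT //.
  by move=> z _; rewrite lee_fin mulr_ge0.
transitivity (\int[distribution P X \x distribution P Y]_z h z).
  pose XYmf : {mfun T >-> (R * R)%type} := HB.pack XY (isMeasurableFun.Build _ _ _ _ _ mXY).
  apply: eq_measure_integral => A mA _.
  apply/esym; apply: (@product_measure_unique _ _ _ _ _ (distribution P X) (distribution P Y)
    (distribution P XYmf)) => // B D mB mD.
rewrite (integral_product (distribution P X) (distribution P Y)) //.
congr (_ * _).
  - apply: (ge0_integral_distribution X (f := fun x => (f x)%:E)).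
    exact/measurable_EFinP.
  by move=> x; rewrite lee_fin.
- apply: (ge0_integral_distribution Y (f := fun x => (g x)%:E)).
    exact/measurable_EFinP.
  by move=> x; rewrite lee_fin.
Qed.

End Independence.

Section Workload.
Context d d' (T : measurableType d) (T' : measurableType d') (R : realType).
Variables (P : probability T R) (P' : probability T' R).
Variables (X Y : {RV P >-> R}) (V : {RV P' >-> R}).
Hypothesis X_ge0 : forall t, 0 <= X t.
Hypothesis Y_ge0 : forall t, 0 <= Y t.
Hypothesis indepXY : independent P X Y.
Hypothesis V_ge0 : forall t, 0 <= V t.
Hypothesis V_stationary : stationary_workload P' P V (fun t => Y t - X t).

Lemma laplace_real d0 (T0 : measurableType d0) (P0 : probability T0 R) (Z : T0 -> R) (x : R) :
  laplace P0 Z x%:C = (\int[P0]_t expR (- x * Z t))%:C.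
Proof.
rewrite /laplace cexpectationE.
have E t : cexp (- x%:C * (Z t)%:C) = (expR (- x * Z t))%:C.
  by rewrite -rmorphN -rmorphM cexp_real.
under eq_Rintegral do rewrite E /=.
under [X in _ +i* X]eq_Rintegral do rewrite E /=.
by rewrite Rintegral_prob_cst.
Qed.

(** The negative part of [V + U]: the time during which the server is idle before
    the next arrival. *)
Definition idle (t : T' * T) : R := Num.max (- (V t.1 + (Y t.2 - X t.2))) 0.

Lemma measurable_V1 : measurable_fun setT (fun t : T' * T => V t.1).
Proof. exact: measurableT_comp. Qed.

Lemma measurable_U2 : measurable_fun setT (fun t : T' * T => Y t.2 - X t.2).
Proof.
by apply: measurable_funB; apply: (measurableT_comp (f := _ : T -> R)).
Qed.

Lemma measurable_VU : measurable_fun setT (fun t : T' * T => V t.1 + (Y t.2 - X t.2)).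
Proof. exact: measurable_funD measurable_V1 measurable_U2. Qed.

Lemma measurable_idle : measurable_fun setT idle.
Proof.
apply: measurable_maxr; last exact: measurable_cst.
exact: measurableT_comp measurable_VU.
Qed.

Lemma idle_ge0 t : 0 <= idle t.
Proof. by rewrite /idle le_max lexx orbT. Qed.

Lemma measurable_expRM d0 (T0 : measurableType d0) (c : R) (h : T0 -> R) :
  measurable_fun setT h -> measurable_fun setT (fun t => expR (c * h t)).
Proof.
by move=> mh; apply: measurableT_comp => //; exact: measurable_funM.
Qed.

Lemma exp_positive_negative_parts (x s : R) :
  expR (- x * s) + 1 = expR (- x * Num.max s 0) + expR (x * Num.max (- s) 0).
Proof.
have [s0|s0] := leP 0 s.
  by rewrite (max_idPr _) ?oppr_le0 // mulr0 expR0.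
by rewrite (max_idPl _) ?oppr_ge0 ?ltW // mulr0 expR0 mulrN mulNr addrC.
Qed.

Local Open Scope ereal_scope.

(** [exp (- x s) + 1 = exp (- x s^+) + exp (x s^-)] at [s = V + U], integrated:
    the law of [(V + U)^+] is that of [V], and the product law factorizes. *)
Lemma workload_equation_ereal (x : R) :
  let v := \int[P']_t (expR (- x * V t))%:E in
  v * (\int[P]_t (expR (- x * Y t))%:E * \int[P]_t (expR (x * X t))%:E) + 1 =
  v + \int[P' \x P]_t (expR (x * idle t))%:E.
Proof.
move=> v.
have pos (c : R) : (0 <= c)%R -> 0 <= c%:E by rewrite lee_fin.
have vE : v = \int[P' \x P]_t (expR (- x * Num.max (V t.1 + (Y t.2 - X t.2))%R 0))%:E.
  pose f (s : R) := (expR (- x * s))%:E.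
  have mf : measurable_fun setT f.
    by apply/measurable_EFinP; apply: measurable_expRM; exact: measurable_id.
  have f0 s : 0 <= f s by rewrite lee_fin expR_ge0.
  have mM : measurable_fun setT (fun t : T' * T => Num.max (V t.1 + (Y t.2 - X t.2))%R 0%R).
    by apply: measurable_maxr; [exact: measurable_VU|exact: measurable_cst].
  have mV : measurable_fun setT (V : T' -> R) by [].
  transitivity (\int[pushforward P' V]_s f s).
    by rewrite (ge0_integral_pushforward mV) ?preimage_setT.
  transitivity (\int[pushforward (P' \x P) (fun t : T' * T => Num.max (V t.1 + (Y t.2 - X t.2))%R 0%R)]_s f s).
    by apply: eq_measure_integral => A mA _; exact: V_stationary.
  by rewrite (ge0_integral_pushforward mM) ?preimage_setT.
have prodE : \int[P' \x P]_t (expR (- x * (V t.1 + (Y t.2 - X t.2))))%:E =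
    v * (\int[P]_t (expR (- x * Y t))%:E * \int[P]_t (expR (x * X t))%:E).
  have mYX : measurable_fun setT (fun t => (expR (- x * Y t) * expR (x * X t))%R).
    by apply: measurable_funM; exact: measurable_expRM.
  rewrite [X in v * X]muleC.
  rewrite -(@integral_independent _ _ _ _ X Y (fun s => expR (x * s)) (fun s => expR (- x * s))) //;
    try (by move=> s; exact: expR_ge0); try (by apply: measurable_expRM; exact: measurable_id).
  rewrite -(@integral_product _ _ _ _ _ _ _ (fun t => expR (- x * V t))
    (fun t => (expR (x * X t) * expR (- x * Y t))%R)).
  - apply: eq_integral => t _; rewrite -!expRD; congr ((expR _)%:E).
    ring.
  - exact: measurable_expRM.
  - by apply: measurable_funM; exact: measurable_expRM.
  - by move=> t; exact: expR_ge0.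
  - by move=> t; rewrite mulr_ge0 ?expR_ge0.
rewrite -prodE.
have oneE : \int[P' \x P]_t 1 = 1.
  transitivity (1 * (P' \x P) setT); first exact: integral_cst.
  by rewrite mul1e; exact: (probability_setT (product_probability P' P)).
have eM (c : R) (h : T' * T -> R) : measurable_fun setT h ->
    measurable_fun setT (fun t => (expR (c * h t))%:E).
  by move=> mh; apply/measurable_EFinP; exact: measurable_expRM.
have e0 (c : R) (h : T' * T -> R) t : [set: T' * T] t -> 0 <= (expR (c * h t))%:E.
  by rewrite lee_fin expR_ge0.
have m1 := eM (- x)%R _ measurable_VU.
have m2 := eM (- x)%R _ (measurable_maxr measurable_VU (@measurable_cst _ _ _ _ setT (0%R : R))).
have m3 := eM x _ measurable_idle.
rewrite -[X in _ + X = _]oneE.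
rewrite -(ge0_integralD _ measurableT (e0 _ _) m1 _ (@measurable_cst _ _ _ _ setT (1 : \bar R))) //.
rewrite vE -(ge0_integralD _ measurableT (e0 _ _) m2 (e0 _ _) m3).
apply: eq_integral => t _; rewrite -!EFinD /idle; congr EFin.
exact: exp_positive_negative_parts.
Qed.

End Workload.

(** * The functional equation of the workload *)

Section FunctionalEquation.
Context d d' (T : measurableType d) (T' : measurableType d') (R : realType).
Variables (P : probability T R) (P' : probability T' R).
Variables (X Y : {RV P >-> R}) (V : {RV P' >-> R}).
Hypothesis X_ge0 : forall t, 0 <= X t.
Hypothesis Y_ge0 : forall t, 0 <= Y t.
Hypothesis indepXY : independent P X Y.
Hypothesis V_ge0 : forall t, 0 <= V t.
Hypothesis V_stationary : stationary_workload P' P V (fun t => Y t - X t).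

Let Q := product_probability P' P.
Let W := idle X Y V.

Lemma integrable_expRN d0 (T0 : measurableType d0) (P0 : probability T0 R)
    (Z : {RV P0 >-> R}) (x : R) : (forall t, 0 <= Z t) -> 0 <= x ->
  P0.-integrable setT (fun t => (expR (- x * Z t))%:E).
Proof.
move=> Z0 x0; have i1 := finite_measure_integrable_cst P0 (1 : R) (@measurableT _ T0).
apply: (le_integrable measurableT _ _ i1) => [|t _ /=].
  by apply/measurable_EFinP; apply: measurable_expRM.
rewrite lee_fin normr1 ger0_norm ?expR_ge0 // -expR0 ler_expR.
by rewrite mulNr oppr_le0 mulr_ge0.
Qed.

(** The left side of the integrated equation is finite as soon as [exp (x X)] is
    integrable, which makes [exp (x W)] integrable. *)
Lemma workload_equation (x : R) : 0 < x ->
  P.-integrable setT (fun t => (expR (x * X t))%:E) ->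
  Q.-integrable setT (fun t => (expR (x * W t))%:E) /\
  laplace P' V x%:C * (laplace P Y x%:C * laplace P X (- x%:C) - 1) =
    laplace Q W (- x%:C) - 1.
Proof.
move=> x0 iX; have iV := integrable_expRN V_ge0 (ltW x0).
have iY := integrable_expRN Y_ge0 (ltW x0).
have eq := workload_equation_ereal indepXY V_stationary x.
have fV := integrable_fin_num measurableT iV.
have fY := integrable_fin_num measurableT iY.
have fX := integrable_fin_num measurableT iX.
rewrite -/W in eq; cbv zeta in eq.
have wQ : (\int[P' \x P]_t (expR (x * W t))%:E = \int[Q]_t (expR (x * W t))%:E)%E by [].
rewrite wQ -(fineK fV) -(fineK fY) -(fineK fX) in eq.
have fW : (\int[Q]_t (expR (x * W t))%:E)%E \is a fin_num.
  by move: eq; case: (\int[Q]_t _)%E.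
have iW : Q.-integrable setT (fun t => (expR (x * W t))%:E).
  apply/integrableP; split.
    apply/measurable_EFinP; apply: measurable_expRM; exact: measurable_idle.
  under eq_integral do rewrite gee0_abs ?lee_fin ?expR_ge0 //.
  by rewrite ltey_eq fW.
split=> //; rewrite -(fineK fW) in eq.
rewrite -rmorphN !laplace_real opprK /Rintegral.
move: eq; rewrite -!EFinM -!EFinD => -[eq].
move: (fine _) (fine _) (fine _) (fine _) eq => w a y v eq.
have -> : w = v * (y * a) + 1 - v by rewrite eq addrC addKr.
by rewrite rmorphB rmorphD !rmorphM /= rmorph1; ring.
Qed.

Variables (eps0 : R) (eps0_gt0 : 0 < eps0).
Hypothesis A_strip : laplace_analytic_on P X
    [set theta | - eps0 < complex.Re theta < eps0].
Hypothesis B_entire : laplace_analytic_on P Y setT.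
Variables (psi : R[i] -> R[i]) (psi_mero : meromorphic psi).
Hypothesis psi_laplace : forall theta : R[i],
    0 <= complex.Re theta -> psi theta = laplace P' V theta.

Let F (th : R[i]) := laplace P Y th * laplace P X (- th) - 1.
Let G (th : R[i]) := laplace Q W (- th) - 1.

Lemma integrable_expRX (x : R) : 0 < x -> x < eps0 ->
  P.-integrable setT (fun t => (expR (x * X t))%:E).
Proof.
move=> x0 xe; have [|[iR _] _] := A_strip (theta := - x%:C).
  by rewrite /=; apply/andP; split; lra.
move: iR; apply: eq_integrable => // t _; rewrite /comp.
have -> : - - x%:C * (X t)%:C = (x * X t)%:C by rewrite opprK rmorphM.
by rewrite cexp_real.
Qed.

Lemma analytic_opp f w :
  analytic_at f (- w) -> analytic_at (fun z : R[i] => f (- z)) w.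
Proof.
move=> [a [rho [rho0 h]]]; exists (fun n => a n * (-1) ^+ n), rho; split=> // z hz.
have := h (- z); rewrite -opprD normrN => /(_ hz).
rewrite (_ : (fun n => a n * (- (z - w)) ^+ n) = (fun n => a n * (-1) ^+ n * (z - w) ^+ n)) //.
by apply/funext => n; rewrite -mulrA -exprMn mulN1r.
Qed.

Lemma F_analytic w : complex.Re w < eps0 -> analytic_at F w.
Proof.
move=> we; pose c := Num.max (complex.Re w) 0.
have [c1 c2] : complex.Re w <= c /\ 0 <= c by rewrite !le_max !lexx orbT.
have c3 : c < eps0 by rewrite gt_max we.
have iX : P.-integrable setT (fun t => (expR ((c + eps0) / 2 * X t))%:E).
  by apply: integrable_expRX; lra.
have hX : analytic_at (laplace P X) (- w).
  apply: (laplace_analytic _ X_ge0 iX); first exact: measurable_funPT.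
  have -> : complex.Re (- w) = - complex.Re w by case: (w).
  lra.
have [_ hY] := B_entire (theta := w) I.
exact: (analyticD (analyticM hY (analytic_opp hX)) (analytic_cst w (-1))).
Qed.

Lemma G_analytic w : complex.Re w < eps0 -> analytic_at G w.
Proof.
move=> we; pose c := Num.max (complex.Re w) 0.
have [c1 c2] : complex.Re w <= c /\ 0 <= c by rewrite !le_max !lexx orbT.
have c3 : c < eps0 by rewrite gt_max we.
have iX : P.-integrable setT (fun t => (expR ((c + eps0) / 2 * X t))%:E).
  by apply: integrable_expRX; lra.
have [|iW _] := workload_equation _ iX; first lra.
have hW : analytic_at (laplace Q W) (- w).
  apply: (laplace_analytic (measurable_idle X Y V) (idle_ge0 X Y V) iW).
  have -> : complex.Re (- w) = - complex.Re w by case: (w).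
  lra.
exact: (analyticD (analytic_opp hW) (analytic_cst w (-1))).
Qed.

Lemma G_bounded w : complex.Re w <= 0 -> cabs (G w) <= 3.
Proof.
move=> w0; apply: le_trans (cabs_sub _ _) _; rewrite cabs1.
have -> : 3 = 2 + 1 :> R by lra.
rewrite lerD2r; apply: laplace_bound => //; [exact: measurable_idle|exact: idle_ge0|].
have -> : complex.Re (- w) = - complex.Re w by case: (w).
by rewrite oppr_ge0.
Qed.

Lemma psi_bounded w : 0 <= complex.Re w -> cabs (psi w) <= 2.
Proof. by move=> w0; rewrite psi_laplace //; exact: laplace_bound. Qed.

Lemma psi_at0 : psi 0 = 1.
Proof. by rewrite psi_laplace //; exact: laplace_at0. Qed.

(** A pole would make [psi] large immediately to the right of it, where the
    modulus is at most 2. *)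
Lemma psi_analytic_right w : 0 <= complex.Re w -> analytic_at psi w.
Proof.
move=> w0; case: (psi_mero w) => // pol.
have /dnbhsCP[r r0 hr] := pole_unbounded 2 pol; exfalso.
pose z := w + (r / 2)%:C.
have zw : cabs (z - w) = r / 2.
  by rewrite /z addrAC subrr add0r cabsR gtr0_norm // divr_gt0.
have zw0 : z != w by rewrite -subr_eq0 -cabs_gt0 zw divr_gt0.
have := hr z zw0; rewrite zw => /(_ ltac:(lra)); rewrite ltNge psi_bounded //.
by rewrite /z Re_add /=; lra.
Qed.

(** The equation holds at the real points of the strip, hence, by the identity
    theorem, in the half-plane to the left of it. *)
Lemma functional_equation w : complex.Re w < eps0 ->
  \forall z \near w^', psi z * F z = G z.
Proof.
move=> we; pose p := (eps0 / 2)%:C : R[i].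
pose D z := psi z * F z - G z.
have D0 : \forall z \near w^', D z = 0.
  apply: (@identity_segment _ _ p) => [t t0 t1|].
    set y := p + _; have ye : complex.Re y < eps0.
      have -> : complex.Re y = eps0 / 2 + t * (complex.Re w - eps0 / 2).
        by rewrite /y Re_add Re_mul /p; case: (w) => a b /=; rewrite mul0r subr0.
      have h1 : 0 <= t * (eps0 - complex.Re w) by rewrite mulr_ge0 // subr_ge0 ltW.
      have h2 : 0 <= (1 - t) * eps0 by rewrite mulr_ge0 ?subr_ge0 // ltW.
      have [->|t1'] := eqVneq t 1; first by lra.
      have h3 : 0 < (1 - t) * eps0.
        by rewrite mulr_gt0 // subr_gt0 lt_neqAle t1'.
      lra.
    apply: at_worst_poleB (G_analytic ye); apply: at_worst_poleM (F_analytic ye).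
    by case: (psi_mero y) => [/analytic_at_worst_pole|/pole_at_worst_pole].
  have pRe : complex.Re p = eps0 / 2 by [].
  have pR : 0 <= complex.Re p by rewrite pRe divr_ge0 // ltW.
  have pe : complex.Re p < eps0 by rewrite pRe; move: eps0_gt0; lra.
  have aD : analytic_at D p.
    apply: eq_analytic (analyticD (analyticM (psi_analytic_right pR) (F_analytic pe))
      (analyticM (analytic_cst p (-1)) (G_analytic pe))).
    by apply/nbhsCP; exists 1 => // z _; rewrite /D mulN1r.
  have /nbhsCP[r r0 hr] : \forall z \near p, D z = 0.
    apply: analytic_isolated_zeros aD _ => e e0.
    pose q := Num.min e (eps0 / 2) / 2.
    have [q1 q2] : Num.min e (eps0 / 2) <= e /\ Num.min e (eps0 / 2) <= eps0 / 2.
      by rewrite !ge_min !lexx orbT.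
    have q0 : 0 < q by rewrite divr_gt0 // lt_min e0 divr_gt0.
    exists (p + q%:C).
    have pq : cabs (p + q%:C - p) = q by rewrite addrAC subrr add0r cabsR gtr0_norm.
    split; [by rewrite -subr_eq0 -cabs_gt0 pq|by rewrite pq /q; lra|].
    have x0 : 0 < eps0 / 2 + q by rewrite /q in q0 *; lra.
    have x1 : eps0 / 2 + q < eps0 by rewrite /q in q0 *; lra.
    have pqE : p + q%:C = (eps0 / 2 + q)%:C by rewrite rmorphD.
    have [_ h] := workload_equation x0 (integrable_expRX x0 x1).
    rewrite /D /F /G pqE psi_laplace ?h ?subrr //.
    exact: ltW.
  by apply/dnbhsCP; exists r => // z _; exact: hr.
move/dnbhsCP: D0 => [r r0 hr]; apply/dnbhsCP; exists r => // z zw /(hr _ zw)/eqP.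
by rewrite subr_eq0 => /eqP.
Qed.

(** Where [F] does not vanish, [psi = G / F] stays bounded. *)
Lemma pole_zero w : complex.Re w < eps0 -> is_pole psi w -> F w = 0.
Proof.
move=> we pol; apply/eqP; apply/negPn/negP => F0.
have /nbhsCP[r r0 hr] := analytic_neq0 (F_analytic we) F0.
have [M M0 /nbhsCP[s s0 hs]] := analytic_bounded (G_analytic we).
have /dnbhsCP[e e0 he] := functional_equation we.
have c0 : 0 < cabs (F w) / 2 by rewrite divr_gt0 // cabs_gt0.
have /dnbhsCP[d1 d10 hd] := pole_unbounded (M / (cabs (F w) / 2)) pol.
pose q := Num.min (Num.min r s) (Num.min e d1).
have q0 : 0 < q by rewrite !lt_min r0 s0 e0.
have [qr qs qe qd] : [/\ q <= r, q <= s, q <= e & q <= d1].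
  by split; rewrite !ge_min lexx ?orbT.
pose z := w + (q / 2)%:C.
have zq : cabs (z - w) = q / 2.
  by rewrite /z addrAC subrr add0r cabsR gtr0_norm // divr_gt0.
have zw : z != w by rewrite -subr_eq0 -cabs_gt0 zq divr_gt0.
have := hr z; have := hs z; have := he z zw; have := hd z zw; rewrite zq.
move=> /(_ ltac:(lra)) h1 /(_ ltac:(lra)) h2 /(_ ltac:(lra)) h3 /(_ ltac:(lra)) h4.
move: h3; rewrite -h2 cabsM leNgt => /negP; apply.
move: h1; rewrite ltr_pdivrMr // => /lt_trans; apply.
by rewrite ltr_pM2l // (le_lt_trans _ (hd z zw _)) ?zq //; [rewrite divr_ge0 // ltW|lra].
Qed.

Lemma functional_equation_at w : complex.Re w < eps0 -> analytic_at psi w ->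
  psi w * F w = G w.
Proof.
move=> we hpsi; apply: (@punctured_eq_center _ (fun z => psi z * F z)).
- exact: analyticM hpsi (F_analytic we).
- exact: G_analytic.
- exact: functional_equation.
Qed.

Lemma psi_pole_order w (k : nat) : complex.Re w < eps0 -> has_order F w k%:Z ->
  removable (fun z => (z - w) ^+ k * psi z) w.
Proof.
move=> we hF; apply: quotient_pole_order (psi_mero w) hF (G_analytic we) _.
exact: functional_equation.
Qed.

End FunctionalEquation.

(** * Sums, products and residues *)

Section SumsAndResidues.
Variable R : realType.
Local Notation C := R[i].
Implicit Types (f g : C -> C) (w : C).

Lemma analytic_sum (I : eqType) (s : seq I) (f : I -> C -> C) w :
  (forall i, i \in s -> analytic_at (f i) w) ->
  analytic_at (fun z => \sum_(i <- s) f i z) w.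
Proof.
elim: s => [_|i s IH h].
  apply: eq_analytic (analytic_cst w 0).
  by apply/nbhsCP; exists 1 => // z _; rewrite big_nil.
have hs : forall j, j \in s -> analytic_at (f j) w.
  by move=> j js; apply: h; rewrite inE js orbT.
apply: eq_analytic (analyticD (h i (mem_head _ _)) (IH hs)).
by apply/nbhsCP; exists 1 => // z _; rewrite big_cons.
Qed.

Lemma analytic_prod (I : eqType) (s : seq I) (f : I -> C -> C) w :
  (forall i, i \in s -> analytic_at (f i) w) ->
  analytic_at (fun z => \prod_(i <- s) f i z) w.
Proof.
elim: s => [_|i s IH h].
  apply: eq_analytic (analytic_cst w 1).
  by apply/nbhsCP; exists 1 => // z _; rewrite big_nil.
have hs : forall j, j \in s -> analytic_at (f j) w.
  by move=> j js; apply: h; rewrite inE js orbT.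
apply: eq_analytic (analyticM (h i (mem_head _ _)) (IH hs)).
by apply/nbhsCP; exists 1 => // z _; rewrite big_cons.
Qed.

Lemma analytic_laurent_coef f w j : analytic_at f w ->
  laurent_coef f w (- j.+1%:Z) = 0.
Proof.
move=> /analyticP[a [r [M ha]]]; have [r0 _ hr] := ha.
pose c (n : int) : C := if n is Posz m then a m else 0.
have hc : laurent_expansion f w c.
  exists r%:C; first by rewrite ltcR.
  move=> z /andP[_]; rewrite normC_lt => /ltW zr; exists (f z), 0; split.
  - by apply/ctends_cvg; exact: hr.
  - apply/ctends_cvg; apply: eq_ctends (ctends_cst _) => n.
    by rewrite /series /= big1 // => i _; rewrite mul0r.
  - by rewrite addr0.
rewrite /laurent_coef; case: xgetP => [c' _ hc'|/(_ c)//].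
by rewrite (laurent_expansion_uniq hc' hc).
Qed.

Lemma laurent_residue f w : removable (fun z => (z - w) * f z) w ->
  regularize (fun z => (z - w) * f z) w = laurent_coef f w (- 1%:Z).
Proof.
move=> h; have h1 : removable (fun z => (z - w) ^+ 1 * f z) w.
  by apply: eq_removable h; apply/dnbhsCP; exists 1 => // z _ _; rewrite expr1.
have [g hg /dnbhsCP[r r0 fg]] := laurent_principal_part h1.
have := analyticD (analytic_cst w (laurent_coef f w (- 1%:Z))) (analyticM (analytic_sub w w) hg).
move=> /regularizeE -> //; first by rewrite subrr mul0r addr0.
apply/dnbhsCP; exists r => // z zw zr; rewrite -(fg z zw zr) big_nat1.
have zw0 : z - w != 0 by rewrite subr_eq0.
rewrite -exprnN expr1.
by field.
Qed.

(** By partial fractions [1 / (p q) = (1 / p + 1 / q) / (p + q)], the sum is twice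
    the arithmetic mean of the numbers [1 / i], up to a factor tending to 1. *)
Lemma harmonic_convolution_cvg0 :
  (fun n => \sum_(0 <= i < n.+1) ((i.+1%:R)^-1 * ((n - i).+1%:R)^-1) : R) @ \oo --> (0 : R).
Proof.
have E n : \sum_(0 <= i < n.+1) ((i.+1%:R)^-1 * ((n - i).+1%:R)^-1) =
    2 * (n.+2%:R)^-1 * \sum_(0 <= i < n.+1) (i.+1%:R)^-1 :> R.
  have rev : \sum_(0 <= i < n.+1) ((n - i).+1%:R)^-1 = \sum_(0 <= i < n.+1) (i.+1%:R)^-1 :> R.
    rewrite [RHS]big_nat_rev /= [LHS]big_nat_cond [RHS]big_nat_cond; apply: eq_bigr => i.
    by rewrite andbT ltnS => /andP[_ il]; rewrite add0n subSS.
  rewrite -mulrA mulr_natl mulr2n -{2}rev -mulrDr -big_split /= mulr_sumr.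
  rewrite [LHS]big_nat_cond [RHS]big_nat_cond; apply: eq_bigr => i.
  rewrite andbT ltnS => /andP[_ il].
  have -> : n.+2%:R = i.+1%:R + (n - i).+1%:R :> R by rewrite -natrD; congr (_%:R); lia.
  have h1 : i.+1%:R != 0 :> R by rewrite pnatr_eq0.
  have h2 : (n - i).+1%:R != 0 :> R by rewrite pnatr_eq0.
  have h3 : i.+1%:R + (n - i).+1%:R != 0 :> R by rewrite -natrD pnatr_eq0.
  move: (i.+1%:R : R) ((n - i).+1%:R : R) h1 h2 h3 => a b h1 h2 h3.
  by field; rewrite h1 h2 h3.
under eq_fun do rewrite E.
have h0 : (fun n => (n.+1%:R)^-1 : R) @ \oo --> (0 : R) by exact: cvg_harmonic.
have hc := cesaro h0.
have h2 : (fun n => 2 * arithmetic_mean (fun n => (n.+1%:R)^-1 : R) n) @ \oo --> (0 : R).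
  by rewrite -(mulr0 2); apply: cvgM => //; exact: cvg_cst.
apply: squeeze_cvgr (cvg_cst 0) h2; apply: nearW => n.
have s0 : 0 <= \sum_(0 <= i < n.+1) (i.+1%:R)^-1 :> R.
  by apply: sumr_ge0 => i _; rewrite invr_ge0.
rewrite mulr_ge0 ?mulr_ge0 ?invr_ge0 //= -mulrA ler_wpM2l // /arithmetic_mean /series /=.
by rewrite ler_wpM2r // lef_pV2 ?posrE // ler_nat.
Qed.

End SumsAndResidues.

(** * Partial fractions of a function bounded on circles *)

Section Bilateral.
Variables (V : nmodType) (B : int -> V).

Lemma bilateral_sumE N : \sum_(0 <= i < N.*2.+1) B (i%:Z - N%:Z) =
  B 0 + \sum_(0 <= p < N) (B p.+1%:Z + B (- p.+1%:Z)).
Proof.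
elim: N => [|N IH]; first by rewrite big_nat1 big_geq // [RHS]addr0 subrr.
have -> : \sum_(0 <= p < N.+1) (B p.+1%:Z + B (- p.+1%:Z)) =
    \sum_(0 <= p < N) (B p.+1%:Z + B (- p.+1%:Z)) + (B N.+1%:Z + B (- N.+1%:Z)).
  by rewrite big_nat_recr.
rewrite addrA -IH doubleS big_nat_recl // big_nat_recr //=.
have -> : N.*2.+2%:Z - N.+1%:Z = N.+1%:Z by rewrite -addnn; lia.
have -> : 0 - N.+1%:Z = - N.+1%:Z by rewrite sub0r.
rewrite (eq_bigr (fun i : nat => B (i%:Z - N%:Z))); last first.
  by move=> i _; congr B; lia.
by rewrite addrCA; congr (_ + _); rewrite addrC.
Qed.

End Bilateral.

(** A function with poles among the [z n], of which all but finitely many are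
    simple and separated, that is bounded on circles whose radii grow to infinity
    by bounded steps. *)
Section MittagLeffler.
Variable R : realType.
Local Notation C := R[i].
Variables (psi : C -> C) (z : int -> C) (k : int -> nat).
Hypothesis z_inj : injective z.
Hypothesis z_neq0 : forall n, z n != 0.
Hypothesis z_sym : forall n, cabs (z (- n)) = cabs (z n).
Hypothesis psi_analytic : forall w, (forall n, w != z n) -> analytic_at psi w.
Hypothesis psi_order : forall n, removable (fun w => (w - z n) ^+ k n * psi w) (z n).
Variables (g : R) (p1 : nat).
Hypothesis g_gt0 : 0 < g.
Hypothesis z_gap : forall p q : nat, (p < q)%N -> (p1 <= q)%N ->
  cabs (z p%:Z) + g <= cabs (z q%:Z).
Hypothesis z_conj_gap : forall p : nat, (p1 <= p)%N -> g <= cabs (z p%:Z - z (- p%:Z)).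
Hypothesis k_simple : forall n : int, (p1 <= absz n)%N -> k n = 1%N.
Variables (r : nat -> R) (eta C0 : R).
Hypothesis r_step : forall n, r n.+1 - r n < eta.
Hypothesis r_infty : r @ \oo --> +oo.
Hypothesis C0_ge0 : 0 <= C0.
Hypothesis psi_circle : forall n w, cabs w = r n -> analytic_at psi w /\ cabs (psi w) <= C0.

Lemma cabs_z n : cabs (z n) = cabs (z (absz n)%:Z).
Proof. by case: n => // n; rewrite NegzE z_sym abszN. Qed.

Lemma z_gap_mul p j : (p1 <= p)%N -> cabs (z p%:Z) + j%:R * g <= cabs (z (p + j)%N%:Z).
Proof.
move=> hp; elim: j => [|j IH]; first by rewrite mul0r addr0 addn0.
have h : (p + j < p + j.+1)%N by rewrite addnS.
have := z_gap h (leq_trans hp (leq_addr _ _)).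
by apply: le_trans; rewrite -natr1 mulrDl mul1r addrA lerD2r.
Qed.

Lemma z_mono_lt (p q : nat) : (p <= q)%N -> (p1 <= q)%N -> cabs (z p%:Z) <= cabs (z q%:Z).
Proof.
rewrite leq_eqVlt => /predU1P[->//|pq] hq.
by have := z_gap pq hq; move: g_gt0; lra.
Qed.

Lemma z_large (L : R) : exists2 p : nat, (p1 <= p)%N & forall q, (p <= q)%N -> L < cabs (z q%:Z).
Proof.
exists (p1 + (Num.truncn (`|L| / g)).+1)%N; first exact: leq_addr.
move=> q hq; have pq : (p1 + (Num.truncn (`|L| / g)).+1 <= q)%N by [].
apply: (@lt_le_trans _ _ (cabs (z (p1 + (Num.truncn (`|L| / g)).+1)%N%:Z))); last first.
  by apply: z_mono_lt => //; apply: leq_trans hq; exact: leq_addr.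
apply: lt_le_trans (z_gap_mul _ (leqnn _)).
have h : `|L| / g < (Num.truncn (`|L| / g)).+1%:R by exact: truncnS_gt.
move: h; rewrite ltr_pdivrMr // => h; have := cabs_ge0 (z p1).
have := ler_norm L; lra.
Qed.

Lemma z_separated (n m : int) : n != m -> (p1 <= absz n)%N -> g <= cabs (z n - z m).
Proof.
move=> nm hn; have [h|h|h] := ltngtP (absz m) (absz n).
- have := z_gap h hn; rewrite -!cabs_z => h1.
  by have := cabs_lb (z n) (z m); lra.
- have := z_gap h (leq_trans hn (ltnW h)); rewrite -!cabs_z => h1.
  by have := cabs_lb (z m) (z n); rewrite cabsB; lra.
- have mn : m = - n by move: nm h; case: n m {hn} => n [] m /=; lia.
  rewrite mn; case: n hn {nm h mn} => n hn; first exact: z_conj_gap.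
  by rewrite NegzE opprK cabsB; apply: z_conj_gap; rewrite NegzE abszN in hn.
Qed.

Lemma pos_neq_opp (p q : nat) : (0 < p)%N -> p%:Z <> - q%:Z.
Proof. by lia. Qed.

(** On an annulus between two consecutive circles there is a bounded number of
    poles.  Multiplying by as many factors [(w - z) / (w - c)], with [c] just
    outside the annulus, makes the function analytic while its size on both
    circles changes by a bounded factor only. *)
Lemma bounded_away (d : R) : 0 < d -> exists C1 rho : R,
  forall w, rho <= cabs w -> (forall n, d <= cabs (w - z n)) -> cabs (psi w) <= C1.
Proof.
move=> d0.
have eta0 : 0 < eta.
  rewrite ltNge; apply/negP => eta0.
  have dec n : r n <= r 0%N.
    by elim: n => // n; apply: le_trans; have := r_step n; lra.
  move/cvgryPgt: r_infty => /(_ (r 0%N))[N _ /(_ N (leqnn N))] /=.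
  by rewrite ltNge dec.
have [K Keta] : exists K : nat, eta < K%:R * g.
  by exists (Num.truncn (eta / g)).+1; rewrite -ltr_pdivrMr //; exact: truncnS_gt.
pose rho := r 0%N + cabs (z p1%:Z) + 1 + eta + `|r 0%N|.
(* Beyond [rho] the annuli only meet the simple, separated poles; each contains
   the poles of at most [K] indices up to sign. *)
exists (C0 * (3 ^+ (2 * K)) * (1 + 2 * eta / d) ^+ (2 * K)), rho => w hw dw.
have rp0 := ler_norm (r 0%N).
have rp1 := ler_norm (- r 0%N); rewrite normrN in rp1.
have zp0 := cabs_ge0 (z p1%:Z).
have [m [rm rm1]] : exists m, r m <= cabs w /\ cabs w < r m.+1.
  have ex : exists m, cabs w < r m.
    move/cvgryPgt: r_infty => /(_ (cabs w))[N _ /(_ N (leqnn N))] /= h.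
    by exists N.
  case: (ex_minnP ex) => -[|m] hm hmin.
    by move: hm; rewrite /rho in hw; lra.
  by exists m; split=> //; rewrite leNgt; apply/negP => /hmin; rewrite ltnn.
have rstep := r_step m.
have rmp : cabs (z p1%:Z) < r m by rewrite /rho in hw; lra.
have exa : exists a, r m <= cabs (z a%:Z).
  by have [p _ hp] := z_large (r m); exists p; apply/ltW/hp.
case: (ex_minnP exa) => a ra amin.
have ap1 : (p1 < a)%N.
  by rewrite ltnNge; apply/negP => h; have := z_mono_lt h (leqnn _); lra.
have ap1' : (0 < a)%N by exact: leq_trans ap1.
pose s : seq int := [seq p%:Z | p <- iota a K] ++ [seq - p%:Z | p <- iota a K].
have us : uniq s.
  rewrite cat_uniq !map_inj_uniq ?iota_uniq /=; [|by move=> x y /oppr_inj[]|by move=> x y []].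
  rewrite andbT; apply/hasPn => x /mapP[p hp ->]; apply/mapP => -[q hq].
  move=> /esym; apply: pos_neq_opp; move: hq; rewrite mem_iota => /andP[h1 _].
  exact: leq_trans ap1' h1.
have sE n : (n \in s) = (a <= absz n < a + K)%N.
  rewrite mem_cat; apply/orP/idP => [[] /mapP[p]|].
  - by rewrite mem_iota => hp ->.
  - by rewrite mem_iota => hp ->; rewrite abszN.
  - case: n => n hn; [left|right]; apply/mapP; first by exists n; rewrite ?mem_iota.
    by exists n.+1; rewrite ?mem_iota ?NegzE.
have szs : size s = (2 * K)%N by rewrite size_cat !size_map size_iota addnn mul2n.
have sz n : n \in s -> r m <= cabs (z n).
  rewrite sE cabs_z => /andP[h _]; apply: le_trans ra _; apply: z_mono_lt => //.
  exact: leq_trans (ltnW ap1) h.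
have annulus n : r m <= cabs (z n) -> cabs (z n) <= r m.+1 -> n \in s.
  rewrite sE cabs_z => h1 h2; rewrite (amin _ h1) /= ltnNge; apply/negP => h3.
  have h4 := z_gap_mul K (ltnW ap1).
  have h5 := z_mono_lt h3 (leq_trans (ltnW ap1) (leq_trans (leq_addr _ _) h3)).
  lra.
(* [c n] is [z n] pushed outwards by [2 eta], hence at distance more than [eta]
   from the annulus. *)
pose c n := z n + (2 * eta / cabs (z n))%:C * z n.
have zn0 n : 0 < cabs (z n) by rewrite cabs_gt0.
have cz n : cabs (c n - z n) = 2 * eta.
  rewrite /c addrAC subrr add0r cabsM cabsR ger0_norm; last first.
    by rewrite divr_ge0 ?cabs_ge0 // mulr_ge0 // ltW.
  by rewrite divfK // gt_eqF.
have cabsc n : cabs (c n) = cabs (z n) + 2 * eta.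
  have -> : c n = (1 + 2 * eta / cabs (z n))%:C * z n.
    by rewrite rmorphD rmorph1 mulrDl mul1r.
  rewrite cabsM cabsR ger0_norm; last first.
    by rewrite addr_ge0 // divr_ge0 ?cabs_ge0 // mulr_ge0 // ltW.
  by rewrite mulrDl mul1r divfK // gt_eqF.
have wc n v : n \in s -> cabs v <= r m.+1 -> eta < cabs (v - c n).
  move=> /sz hn hv; have := cabs_lb (c n) v; rewrite cabsB cabsc; lra.
pose phi n v := (v - z n) * (v - c n)^-1.
have vc n v : n \in s -> cabs v <= r m.+1 -> v != c n.
  by move=> hn hv; rewrite -subr_eq0 -cabs_gt0; apply: lt_trans (wc _ _ hn hv).
have phi_an n v : n \in s -> cabs v <= r m.+1 -> analytic_at (phi n) v.
  by move=> hn hv; exact: (analyticM (analytic_sub v (z n)) (analytic_inv (vc _ _ hn hv))).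
have phi3 n v : n \in s -> cabs v <= r m.+1 -> cabs (phi n v) <= 3.
  move=> hn hv; have h := wc _ _ hn hv; have h0 : 0 < cabs (v - c n) by lra.
  rewrite cabsM cabsV ler_pdivrMr //.
  by have := cabs_tri v (c n) (z n); rewrite cz; lra.
pose f v := psi v * \prod_(n <- s) phi n v.
have f_rem v : r m <= cabs v -> cabs v <= r m.+1 -> removable f v.
  move=> v1 v2.
  have [[n vn]|nz] := pselect (exists n, v = z n); last first.
    apply: analytic_removable; apply: analyticM.
      by apply: psi_analytic => n; apply/eqP => vn; apply: nz; exists n.
    by apply: analytic_prod => n hn; exact: phi_an.
  have ns : n \in s by apply: annulus; rewrite -vn.
  have h1 : analytic_at (fun v => (v - c n)^-1 * \prod_(j <- rem n s) phi j v) v.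
    apply: (analyticM (analytic_inv (vc _ _ ns v2))).
    by apply: analytic_prod => j /mem_rem hj; exact: phi_an.
  have kn : k n = 1%N.
    by apply: k_simple; move: ns; rewrite sE => /andP[h _]; exact: leq_trans (ltnW ap1) h.
  have h2 := psi_order n; rewrite kn -vn in h2.
  apply: eq_removable (removableM h2 (analytic_removable h1)).
  apply/dnbhsCP; exists 1 => // y _ _.
  rewrite /f (big_rem n ns) /= -[phi n y]/((y - z n) * (y - c n)^-1) -vn expr1.
  by move: (\prod_(j <- rem n s) phi j y) => p; ring.
have fC v : cabs v <= r m.+1 -> cabs (psi v) <= C0 -> cabs (f v) <= C0 * 3 ^+ (2 * K).
  move=> hv hp; rewrite cabsM -szs; apply: ler_pM => //; try exact: cabs_ge0.
  have : forall j, j \in s -> cabs (phi j v) <= 3 by move=> j hj; exact: phi3.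
  elim: (s) => [|j s' IH] hs /=; first by rewrite big_nil cabs1 expr0.
  rewrite big_cons cabsM exprS; apply: ler_pM; rewrite ?cabs_ge0 //.
    by apply: hs; rewrite mem_head.
  by apply: IH => i hi; apply: hs; rewrite inE hi orbT.
have w2 : cabs w <= r m.+1 by exact: ltW.
have psi_w : analytic_at psi w.
  apply: psi_analytic => n; apply: contraTneq (dw n) => ->.
  by rewrite subrr cabs0 -ltNge.
have f_w : analytic_at f w.
  apply: analyticM psi_w _.
  by apply: analytic_prod => n hn; exact: phi_an.
have : cabs (regularize f w) <= C0 * 3 ^+ (2 * K).
  apply: (@annulus_bound _ f 0 (r m) (r m.+1)); rewrite ?subr0 //.
    by move=> v; rewrite subr0; exact: f_rem.
  move=> v; rewrite subr0 => hv.
  have v2 : cabs v <= r m.+1 by case: hv => ->; lra.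
  have [pv bv] : analytic_at psi v /\ cabs (psi v) <= C0 by case: hv => /psi_circle.
  split; last exact: fC.
  apply: analyticM pv _.
  by apply: analytic_prod => n hn; exact: phi_an.
rewrite (regularize_id f_w) => fw.
(* Dividing by the factors again costs a bounded amount at distance [d] from
   the poles. *)
have phi_inv n : n \in s -> 1 <= (1 + 2 * eta / d) * cabs (phi n w).
  move=> hn; have h0 : 0 < cabs (w - c n) by apply: lt_trans (wc _ _ hn w2).
  rewrite cabsM cabsV mulrA ler_pdivlMr // mul1r.
  have h1 := cabs_tri w (z n) (c n); rewrite (cabsB (z n)) cz in h1.
  apply: le_trans h1 _; have := dw n; move: (cabs (w - z n)) => x dx.
  have -> : (1 + 2 * eta / d) * x = x + 2 * eta * (x / d) by field; rewrite gt_eqF.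
  rewrite lerD2l -[leLHS]mulr1 ler_wpM2l ?mulr_ge0 ?(ltW eta0) //.
  by rewrite ler_pdivlMr // mul1r.
have prod_inv : 1 <= (1 + 2 * eta / d) ^+ (2 * K) * cabs (\prod_(n <- s) phi n w).
  rewrite -szs; elim: (s) phi_inv => [|j s' IH] hs /=.
    by rewrite big_nil cabs1 expr0 mulr1.
  rewrite big_cons cabsM exprS mulrACA -[leLHS]mulr1; apply: ler_pM => //.
    by apply: hs; rewrite mem_head.
  by apply: IH => i hi; apply: hs; rewrite inE hi orbT.
have q0 : 0 <= (1 + 2 * eta / d) ^+ (2 * K).
  by rewrite exprn_ge0 // addr_ge0 // divr_ge0 ?mulr_ge0 // ltW.
apply: (@le_trans _ _ (cabs (psi w) * ((1 + 2 * eta / d) ^+ (2 * K) * cabs (\prod_(n <- s) phi n w)))).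
  by rewrite ler_peMr ?cabs_ge0.
rewrite mulrCA [leRHS]mulrC ler_wpM2l //.
by move: fw; rewrite /f cabsM.
Qed.

Lemma psi_analytic_near_pole n w : (p1 <= absz n)%N -> w != z n ->
  cabs (w - z n) < g -> analytic_at psi w.
Proof.
move=> hn wn wg; apply: psi_analytic => m; apply/eqP => wm.
have nm : n != m by apply: contraNneq wn => ->; rewrite wm.
by have := z_separated nm hn; rewrite -wm cabsB; lra.
Qed.

(** A residue at a simple pole is the value at the centre of a function that is
    bounded on a circle of fixed radius about the pole. *)
Lemma residues_bounded : exists (A : R) (p2 : nat), 0 <= A /\
  forall n, (p2 <= absz n)%N -> cabs (laurent_coef psi (z n) (- 1%:Z)) <= A.
Proof.
pose d := g / 3; have d0 : 0 < d by rewrite divr_gt0.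
have dg : d * 3 = g by rewrite /d divfK.
have [C1 [rho hC]] := bounded_away d0.
have [p2 p12 hp2] := z_large (rho + d).
exists (d * `|C1|), p2; split=> [|n hn]; first by rewrite mulr_ge0 // ltW.
have n1 : (p1 <= absz n)%N by exact: leq_trans hn.
have zn : rho + d < cabs (z n) by rewrite cabs_z; exact: hp2.
have hrem : removable (fun w => (w - z n) * psi w) (z n).
  have h := psi_order n; rewrite (k_simple n1) in h; apply: eq_removable h.
  by apply/dnbhsCP; exists 1 => // w _ _; rewrite expr1.
rewrite -(laurent_residue hrem); apply: (@disc_bound _ _ (z n) d); last first.
- by rewrite subrr cabs0 ltW.
- move=> w wd; have wg : cabs (w - z n) < g by lra.
  have wz : w != z n by rewrite -subr_eq0 -cabs_gt0 wd.
  have pw := psi_analytic_near_pole n1 wz wg.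
  split; first exact: (analyticM (analytic_sub w (z n)) pw).
  rewrite cabsM wd ler_wpM2l ?(ltW d0) //; apply: le_trans (ler_norm _).
  apply: hC => [|m].
    by have := cabs_tri (z n) w 0; rewrite !subr0 (cabsB (z n) w) wd; lra.
  have [<-|nm] := eqVneq n m; first by rewrite wd.
  have := z_separated nm n1; have := cabs_tri (z n) w (z m); rewrite (cabsB (z n) w) wd; lra.
- move=> w wd; have [->//|wz] := eqVneq w (z n).
  apply: analytic_removable; apply: (analyticM (analytic_sub w (z n))).
  by apply: psi_analytic_near_pole n1 wz _; lra.
Qed.

(** The principal part at [z n], normalized to vanish at the origin. *)
Definition polar_term n (w : C) : C :=
  \sum_(1 <= j < (k n).+1) laurent_coef psi (z n) (- j%:Z) *
    ((w - z n) ^ (- j%:Z) - (- z n) ^ (- j%:Z)).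

Lemma polar_term0 n : polar_term n 0 = 0.
Proof. by rewrite /polar_term big1 // => j _; rewrite sub0r subrr mulr0. Qed.

Lemma polar_term_simple n w : k n = 1%N -> w != z n ->
  polar_term n w = laurent_coef psi (z n) (- 1%:Z) * (w / (z n * (w - z n))).
Proof.
move=> kn wz; rewrite /polar_term kn big_nat1 -!exprnN !expr1; congr (_ * _).
by field; rewrite z_neq0 subr_eq0 wz.
Qed.

Lemma analytic_polar_term n w : w != z n -> analytic_at (polar_term n) w.
Proof.
move=> wz; apply: analytic_sum => j _.
have inv m : analytic_at (fun v : C => (v - z n) ^ (- m%:Z)) w.
  elim: m => [|m IH].
    apply: eq_analytic (analytic_cst w 1).
    by apply/nbhsCP; exists 1 => // v _; rewrite oppr0 expr0z.
  apply: eq_analytic (analyticM (analytic_inv wz) IH).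
  by apply/nbhsCP; exists 1 => // v _; rewrite -!exprnN exprS invfM.
have hc := analytic_cst w (- (- z n) ^ (- j%:Z)).
exact: (analyticM (analytic_cst w _) (analyticD (inv j) hc)).
Qed.

(** Some [z n] may be a regular point of [psi]: the principal part is then zero. *)
Lemma analytic_polar_term_regular n w :
  analytic_at psi w -> analytic_at (polar_term n) w.
Proof.
move=> hw; have [wz|] := eqVneq w (z n); last exact: analytic_polar_term.
apply: eq_analytic (analytic_cst w 0); apply/nbhsCP; exists 1 => // v _.
rewrite /polar_term big_nat_cond big1 // => -[|j] /andP[/andP[// _ _] _].
by rewrite -wz analytic_laurent_coef // mul0r.
Qed.

Lemma polar_term_bounded n : exists D : R, forall w,
  g / 2 <= cabs (w - z n) -> cabs (polar_term n w) <= D.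
Proof.
exists (\sum_(1 <= j < (k n).+1) cabs (laurent_coef psi (z n) (- j%:Z)) *
  ((g / 2) ^- j + cabs ((- z n) ^ (- j%:Z)))) => w hw.
apply: le_trans (cabs_sum _ _ _) _; apply: ler_sum => j _.
rewrite cabsM ler_wpM2l ?cabs_ge0 //; apply: le_trans (cabs_sub _ _) _.
have g2 : 0 < g / 2 by rewrite divr_gt0.
rewrite lerD2r -exprnN cabsV cabsX lef_pV2 ?posrE ?exprn_gt0 //.
  by apply: lerXn2r; rewrite ?nnegrE ?(ltW g2) // cabs_ge0.
exact: lt_le_trans hw.
Qed.

Lemma removable_psi_polar n : removable (fun w => psi w - polar_term n w) (z n).
Proof.
pose c := \sum_(1 <= j < (k n).+1) laurent_coef psi (z n) (- j%:Z) * (- z n) ^ (- j%:Z).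
have h := removableD (laurent_principal_part (psi_order n)) (analytic_removable (analytic_cst (z n) c)).
apply: eq_removable h; apply/dnbhsCP; exists 1 => // w _ _.
rewrite /polar_term -addrA; congr (_ + _); rewrite /c addrC -sumrB -sumrN.
by apply: eq_bigr => j _; rewrite mulrBr opprB.
Qed.

(** The circles of radius [R_ N] separate the poles of index up to [N] in absolute
    value from the others, at distance [g / 2] from all of them. *)
Let R_ N := cabs (z N%:Z) + g / 2.

Lemma circle_away N n w : (p1 <= N)%N -> cabs w = R_ N -> g / 2 <= cabs (w - z n).
Proof.
move=> hN hw; have [nN|Nn] := leqP (absz n) N.
  have := z_mono_lt nN hN; rewrite -cabs_z; have := cabs_lb w (z n).
  by rewrite hw /R_; lra.
have := z_gap Nn (leq_trans hN (ltnW Nn)); rewrite -cabs_z.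
by have := cabs_lb (z n) w; rewrite hw /R_ cabsB; lra.
Qed.

(** Subtracting from [psi] the polar terms up to the index [N] leaves a function
    [E] whose singularities in the disc of radius [R_ N] are removable.  On the
    boundary, the polar term of index [i] has size [O (R_ N / (i (N - i + 1)))] because the residues are
    bounded and the moduli of the poles grow linearly; hence [E = o (R_ N)] there,
    and Schwarz's lemma makes [E th - E 0] tend to 0, with [E 0 = psi 0]. *)
Theorem mittag_leffler th : analytic_at psi th -> psi 0 = 1 -> analytic_at psi 0 ->
  ctends (fun N => \sum_(0 <= i < N.*2.+1) polar_term (i%:Z - N%:Z) th) (psi th - 1).
Proof.
move=> psi_th psi0 psi_an0.
have g2 : 0 < g / 2 by rewrite divr_gt0.
have [C1 [rho hC]] := bounded_away g2.
have [A [p2 [A0 hA]]] := residues_bounded.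
have [p3' p13 hp3] := z_large (Num.max (Num.max rho (cabs th)) 0).
pose m := maxn p2 p3'.
have m31 : (p1 <= m)%N by rewrite leq_max p13 orbT.
have zp3 q : (m <= q)%N -> [/\ rho < cabs (z q%:Z), cabs th < cabs (z q%:Z) & 0 < cabs (z q%:Z)].
  move=> hq; have : (p3' <= q)%N by apply: leq_trans hq; rewrite leq_max leqnn orbT.
  by move=> /hp3; rewrite !gt_max -andbA => /and3P.
have resA n : (m <= absz n)%N -> cabs (laurent_coef psi (z n) (- 1%:Z)) <= A.
  by move=> hn; apply: hA; apply: leq_trans hn; rewrite leq_max leqnn.
have [D hD] := choice polar_term_bounded.
(* The poles up to the index [m], possibly multiple, contribute a bounded
   amount. *)
pose Dsum := D 0 + \sum_(0 <= p < m) (D p.+1%:Z + D (- p.+1%:Z)).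
pose h := Num.min (g / 2) (cabs (z m.+1%:Z)).
have [_ _ zm0] := zp3 _ (leqnSn m).
have h0 : 0 < h by rewrite lt_min g2.
have [hg hz] : h <= g / 2 /\ h <= cabs (z m.+1%:Z) by rewrite !ge_min !lexx orbT.
pose H L : R := \sum_(0 <= i < L.+1) ((i.+1%:R)^-1 * ((L - i).+1%:R)^-1).
have lowz i : h * i.+1%:R <= cabs (z (i + m).+1%:Z).
  have := z_gap_mul i (leqW m31); rewrite addSn addnC; apply: le_trans.
  rewrite -natr1 mulrDr mulr1 addrC lerD // mulrC ler_wpM2l //.
  by apply: le_trans hg _; lra.
have lowR L i : (i <= L)%N ->
    h * (L - i).+1%:R <= R_ (L + m).+1 - cabs (z (i + m).+1%:Z).
  move=> iL; have hm : (p1 <= (i + m).+1)%N by rewrite (leq_trans m31) // leqW // leq_addl.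
  have := z_gap_mul (L - i) hm; rewrite addSn.
  have -> : (i + m + (L - i) = L + m)%N by rewrite addnAC subnKC.
  have : h * (L - i)%:R <= (L - i)%:R * g.
    by rewrite mulrC ler_wpM2l //; apply: le_trans hg _; lra.
  by rewrite /R_ -natr1 mulrDr mulr1; lra.
have R0 L : 0 < R_ (L + m).+1.
  have [_ _] := zp3 (L + m).+1 (leqW (leq_addl _ _)); rewrite /R_; lra.
pose bnd L := Dsum + 2 * (A * R_ (L + m).+1 / h ^+ 2 * H L).
have polar_bound L w : cabs w = R_ (L + m).+1 ->
    cabs (\sum_(0 <= i < (L + m).+1.*2.+1) polar_term (i%:Z - (L + m).+1%:Z) w) <= bnd L.
  move=> hw; apply: le_trans (cabs_sum _ _ _) _.
  rewrite (bilateral_sumE (fun n => cabs (polar_term n w))).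
  have hN : (p1 <= (L + m).+1)%N by rewrite (leq_trans m31) // leqW // leq_addl.
  have away n := circle_away n hN hw.
  have hm : (m <= (L + m).+1)%N by rewrite leqW // leq_addl.
  rewrite (big_cat_nat (leq0n _) hm) /= addrA.
  apply: lerD.
    apply: lerD; first exact: hD.
    by apply: ler_sum => p _; apply: lerD; exact: hD.
  rewrite -{1}(add0n m) big_addn -addSn addnK.
  have simple n i : (i <= L)%N -> absz n = (i + m).+1 -> cabs (polar_term n w) <=
      A * R_ (L + m).+1 / h ^+ 2 * ((i.+1%:R)^-1 * ((L - i).+1%:R)^-1).
    move=> iL hn; have hn1 : (p1 <= absz n)%N by rewrite hn (leq_trans m31) // leqW // leq_addl.
    have wz : w != z n.
      by rewrite -subr_eq0 -cabs_gt0; apply: lt_le_trans (away n).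
    have zn : cabs (z n) = cabs (z (i + m).+1%:Z) by rewrite cabs_z hn.
    rewrite polar_term_simple //; last exact: k_simple.
    rewrite cabsM cabsM cabsV cabsM hw.
    have b1 := lowz i; have b2 := lowR _ _ iL; rewrite -zn in b1 b2.
    have b3 : h * (L - i).+1%:R <= cabs (w - z n).
      by apply: le_trans b2 _; rewrite -hw; exact: cabs_lb.
    have c1 : 0 < h * i.+1%:R by rewrite mulr_gt0.
    have c2 : 0 < h * (L - i).+1%:R by rewrite mulr_gt0.
    have -> : A * R_ (L + m).+1 / h ^+ 2 * ((i.+1%:R)^-1 * ((L - i).+1%:R)^-1) =
        A * (R_ (L + m).+1 * ((h * i.+1%:R) * (h * (L - i).+1%:R))^-1).
      rewrite !invfM; move: (i.+1%:R^-1 : R) ((L - i).+1%:R^-1 : R) => x y.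
      by field; rewrite gt_eqF.
    apply: ler_pM; [exact: cabs_ge0| |by rewrite resA // hn leqW // leq_addl|].
      by apply: divr_ge0; [exact: ltW|apply: mulr_ge0; exact: cabs_ge0].
    rewrite ler_wpM2l ?(ltW (R0 L)) // lef_pV2 ?posrE ?mulr_gt0 //.
      by apply: ler_pM; rewrite // ltW.
    - by rewrite (lt_le_trans c1).
    - by rewrite (lt_le_trans c2).
  rewrite mulrA mulr_sumr big_nat_cond [leRHS]big_nat_cond; apply: ler_sum => i.
  rewrite andbT ltnS => /andP[_ iL].
  have h1 := simple (i + m).+1%:Z i iL (erefl _).
  have h2 := simple (- (i + m).+1%:Z) i iL (abszN _).
  apply: le_trans (lerD h1 h2) _; rewrite addSn.
  by move: (A * R_ (L + m).+1 / h ^+ 2) => u; rewrite le_eqVlt; apply/orP; left; apply/eqP; ring.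
apply/(ctends_shift _ _ m.+1).
pose M L := cabs (psi 0) + `|C1| + bnd L.
have key L : cabs (\sum_(0 <= i < (L + m.+1).*2.+1) polar_term (i%:Z - (L + m.+1)%:Z) th -
    (psi th - 1)) <= M L / R_ (L + m).+1 * cabs th.
  rewrite addnS.
  pose E w := psi w + -1 * \sum_(0 <= i < (L + m).+1.*2.+1) polar_term (i%:Z - (L + m).+1%:Z) w.
  have hN : (p1 <= (L + m).+1)%N by rewrite (leq_trans m31) // leqW // leq_addl.
  have hmN : (m <= (L + m).+1)%N by rewrite leqW // leq_addl.
  have E0 : E 0 = 1.
    have S0 : \sum_(0 <= i < (L + m).+1.*2.+1) polar_term (i%:Z - (L + m).+1%:Z) 0 = 0.
      by apply: big1 => i _; rewrite polar_term0.
    by rewrite /E psi0 S0 mulr0 addr0.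
  have Ean w : analytic_at psi w -> analytic_at E w.
    move=> pw; apply: (analyticD (pw) (analyticM (analytic_cst w (-1)) _)).
    by apply: analytic_sum => i _; exact: analytic_polar_term_regular _ pw.
  have circ w : cabs w = R_ (L + m).+1 -> analytic_at E w /\ cabs (E w - E 0) <= M L.
    move=> hw; have away n := circle_away n hN hw.
    have pw : analytic_at psi w.
      apply: psi_analytic => n; rewrite -subr_eq0 -cabs_gt0; exact: lt_le_trans (away n).
    split; first exact: Ean.
    have hp : cabs (psi w) <= C1.
      apply: hC => [|n]; last exact: away.
      by rewrite hw /R_; have [] := zp3 _ hmN; lra.
    rewrite E0 -psi0; apply: le_trans (cabs_sub _ _) _; rewrite addrC /M -addrA lerD2l.
    apply: le_trans (cabsD _ _) _; apply: lerD.
      by apply: le_trans hp _; exact: ler_norm.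
    by rewrite mulN1r cabsN; exact: polar_bound.
  have Erem w : cabs w <= R_ (L + m).+1 -> removable E w.
    move=> hw; have [[n wn]|nz] := pselect (exists n, w = z n); last first.
      apply: analytic_removable; apply: Ean; apply: psi_analytic => n.
      by apply/eqP => wn; apply: nz; exists n.
    have nN : (absz n <= (L + m).+1)%N.
      rewrite leqNgt; apply/negP => Nn; have := z_gap Nn (leq_trans hN (ltnW Nn)).
      by rewrite -cabs_z -wn; move: hw; rewrite /R_; lra.
    have [i0 i0N i0E] : exists2 i0, (i0 < (L + m).+1.*2.+1)%N & i0%:Z - (L + m).+1%:Z = n.
      exists (absz (n + (L + m).+1%:Z)); first by rewrite -addnn; lia.
      by lia.
    have hs : i0 \in index_iota 0 (L + m).+1.*2.+1 by rewrite mem_index_iota.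
    pose rest w := \sum_(i <- rem i0 (index_iota 0 (L + m).+1.*2.+1)) polar_term (i%:Z - (L + m).+1%:Z) w.
    have rest_an : analytic_at rest w.
      apply: analytic_sum => i hi; apply: analytic_polar_term; rewrite wn.
      apply: contraTneq hi => /z_inj; rewrite -i0E => /addIr[->].
      by rewrite mem_rem_uniqF // iota_uniq.
    rewrite wn in rest_an *.
    apply: eq_removable (removableD (removable_psi_polar n)
      (analytic_removable (analyticM (analytic_cst (z n) (-1)) rest_an))).
    apply/dnbhsCP; exists 1 => // v _ _; rewrite /E (big_rem i0 hs) /= i0E /rest.
    by move: (\sum_(i <- _) _) => x; ring.
  have thR : cabs th <= R_ (L + m).+1.
    by rewrite /R_; have [_] := zp3 _ hmN; lra.
  have := schwarz (R0 L) (Ean 0 psi_an0) Erem circ thR (Ean th psi_th).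
  rewrite E0 /E mulN1r -cabsN; congr (cabs _ <= _); ring.
apply: ctends_squeeze key _.
pose c0 := cabs (psi 0) + `|C1| + Dsum.
have MR L : `|M L / R_ (L + m).+1| <= `|c0| / h * (L.+1%:R)^-1 + 2 * A / h ^+ 2 * H L.
  have H0 : 0 <= H L by apply: sumr_ge0 => i _; rewrite mulr_ge0 ?invr_ge0.
  have -> : M L / R_ (L + m).+1 = c0 / R_ (L + m).+1 + 2 * A / h ^+ 2 * H L.
    rewrite /M /bnd /c0; move: (R_ _) (R0 L) (H L) => x x0 y.
    by field; rewrite !gt_eqF.
  apply: le_trans (ler_normD _ _) _; apply: lerD; last first.
    by rewrite ger0_norm // mulr_ge0 // divr_ge0 ?exprn_ge0 ?(ltW h0) // mulr_ge0.
  rewrite normrM normfV (gtr0_norm (R0 L)) -mulrA ler_wpM2l // -invfM.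
  rewrite lef_pV2 ?posrE ?mulr_gt0 ?R0 //.
  have := lowR L 0%N (leq0n _); rewrite subn0 add0n.
  by have [_ _] := zp3 m.+1 (leqnSn m); lra.
have cH : (fun L => `|c0| / h * (L.+1%:R)^-1 + 2 * A / h ^+ 2 * H L) @ \oo --> (0 : R).
  rewrite -[X in _ --> X](_ : `|c0| / h * 0 + 2 * A / h ^+ 2 * 0 = 0 :> R); last first.
    by rewrite !mulr0 addr0.
  apply: cvgD; apply: cvgM; try exact: cvg_cst; first exact: cvg_harmonic.
  exact: harmonic_convolution_cvg0.
have cM : (fun L => M L / R_ (L + m).+1) @ \oo --> (0 : R).
  apply: norm_cvg0; apply: squeeze_cvgr (cvg_cst 0) cH.
  by apply: nearW => L; rewrite normr_ge0 MR.
rewrite -(mul0r (cabs th)); apply: cvgM cM (cvg_cst _).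
Qed.

End MittagLeffler.

(** * Moduli and multiplicities of the zeros *)

(** The zeros are listed twice: by [zeta] with multiplicity and known asymptotics,
    by [z] without repetition and with monotone moduli. *)
Section ZeroAsymptotics.
Variable R : realType.
Local Notation C := R[i].
Variables (zeta z : int -> C) (k : int -> nat) (a beta : R).
Hypothesis a_gt0 : 0 < a.
Hypothesis zeta_conj : forall n, zeta (- n) = (zeta n)^*.
Hypothesis zeta_Re : (fun n : nat => complex.Re (zeta n%:Z)) =o_\oo
    (fun n : nat => Num.sqrt n%:R).
Hypothesis zeta_Im : (fun n : nat => complex.Im (zeta n%:Z) - a * n%:R) @ \oo --> beta.
Hypothesis z_inj : injective z.
Hypothesis z_conj : forall n, z (- n) = (z n)^*.
Hypothesis z_mono : exists N : int, forall m n : int, N <= m -> m <= n -> `|z m| <= `|z n|.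
Hypothesis k_card : forall n, ([set i : int | zeta i = z n] #= `I_(k n))%card.
Hypothesis k_gt0 : forall n, (0 < k n)%N.

Let nu (b : nat) := cabs (zeta b%:Z).
Let mu (p : nat) := cabs (z p%:Z).

(** Since [Re zeta_n = o(sqrt n)], [|zeta_n| - Im zeta_n] is at most
    [(Re zeta_n)^2 / Im zeta_n = o(1)]: the moduli are asymptotically in
    arithmetic progression, like the imaginary parts. *)
Lemma zeta_modulus : exists m0 : nat, forall b, (m0 <= b)%N ->
  `|nu b - (a * b%:R + beta)| <= a / 8 /\ a <= complex.Im (zeta b%:Z).
Proof.
have a16 : 0 < a / 16 by rewrite divr_gt0.
have a8 : 0 < a / 8 by rewrite divr_gt0.
move/eqoP : zeta_Re => /(_ _ a8)[N1 _ h1].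
move/cvgrPdist_lt : zeta_Im => /(_ _ a16)[N2 _ h2].
pose N3 := (Num.truncn ((2 * `|beta| + 2 * a) / a)).+2.
exists (maxn (maxn N1 N2) N3) => b; rewrite !geq_max -andbA => /and3P[/h1/= r1 /h2/= r2 b3].
have bn : 2 * `|beta| + 2 * a <= a * b%:R.
  rewrite [leRHS]mulrC -ler_pdivrMr //; apply: le_trans (ltW (truncnS_gt _)) _.
  by rewrite ler_nat; apply: leq_trans b3.
have nb := ler_norm beta; have nb' := ler_norm (- beta); rewrite normrN in nb'.
set y := complex.Im (zeta b) in r2 *; set x := complex.Re (zeta b) in r1.
have b0 : (0 : R) <= b%:R by [].
rewrite [`|Num.sqrt _|]ger0_norm ?sqrtr_ge0 // in r1.
have x2 : x ^+ 2 <= a ^+ 2 / 64 * b%:R.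
  have : `|x| ^+ 2 <= (a / 8 * Num.sqrt b%:R) ^+ 2.
    by apply: lerXn2r; rewrite ?nnegrE ?normr_ge0 ?mulr_ge0 ?sqrtr_ge0 // ltW.
  rewrite real_normK ?num_real // exprMn sqr_sqrtr // expr_div_n.
  by have -> : 8 ^+ 2 = 64 :> R by rewrite expr2; lra.
move: r2; rewrite ltr_norml => /andP[r2 r3].
have y2 : a * b%:R / 2 <= y by lra.
have y0 : 0 < y by lra.
split; last by lra.
have low : y <= nu b by apply: le_trans (Im_le_cabs (zeta b)); exact: ler_norm.
have up : nu b <= y + x ^+ 2 / y.
  have e0 : 0 <= x ^+ 2 / y by rewrite divr_ge0 ?sqr_ge0 // ltW.
  rewrite -(@ler_pXn2r _ 2) ?nnegrE ?cabs_ge0 ?addr_ge0 ?(ltW y0) //.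
  have -> : nu b ^+ 2 = x ^+ 2 + y ^+ 2.
    rewrite /nu /x /y /ComplexField.Normc.normc; case: (zeta b) => u v /=.
    by rewrite sqr_sqrtr // addr_ge0 ?sqr_ge0.
  rewrite sqrrD addrC -addrA lerD2l.
  have -> : y * (x ^+ 2 / y) = x ^+ 2 by rewrite mulrCA divff ?mulr1 // gt_eqF.
  by rewrite mulr2n -addrA lerDl addr_ge0 ?sqr_ge0.
have e1 : x ^+ 2 / y <= a / 16.
  rewrite ler_pdivrMr //; apply: le_trans x2 _.
  have : 0 <= a * (y - a * b%:R / 2) by rewrite mulr_ge0 ?subr_ge0 // ltW.
  by have := mulr_ge0 (sqr_ge0 a) b0; rewrite expr2; lra.
by rewrite ler_norml; apply/andP; split; lra.
Qed.

Lemma nu_gap : exists m0 : nat, forall b c, (m0 <= b)%N -> (b < c)%N ->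
  nu b + a / 2 <= nu c.
Proof.
have [m0 hm] := zeta_modulus; exists m0 => b c mb bc.
have [+ _] := hm b mb; have [+ _] := hm c (leq_trans mb (ltnW bc)).
rewrite !ler_norml => /andP[h1 h2] /andP[h3 h4].
have h5 : a * b%:R + a <= a * c%:R.
  by rewrite -[X in _ + X]mulr1 -mulrDr natr1 ler_wpM2l ?(ltW a_gt0) // ler_nat.
by move: a_gt0; lra.
Qed.

Lemma injective_escapes (f : nat -> int) (M : nat) : injective f ->
  exists p0, forall p, (p0 <= p)%N -> (M <= absz (f p))%N.
Proof.
move=> finj; elim: M => [|M [p0 hp]]; first by exists 0%N.
have avoid (c : int) : exists q, forall p, (q <= p)%N -> f p <> c.
  have [[p1 <-]|no] := pselect (exists p, f p = c).
    by exists p1.+1 => p hp1 /finj pE; rewrite pE ltnn in hp1.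
  by exists 0%N => p _ fp; apply: no; exists p.
have [q1 h1] := avoid M%:Z; have [q2 h2] := avoid (- M%:Z).
exists (maxn p0 (maxn q1 q2)) => p; rewrite !geq_max => /and3P[/hp h3 /h1 h4 /h2 h5].
rewrite ltn_neqAle h3 andbT; apply/eqP => h6.
by move: h4 h5; rewrite h6; case: (f p) => n; rewrite ?NegzE ?abszN.
Qed.

Lemma zero_listed n : exists i, zeta i = z n.
Proof.
apply: contrapT => no.
have E : [set i : int | zeta i = z n] = set0.
  by apply/seteqP; split=> i //= hi; apply: no; exists i.
have := k_card n; rewrite E card_eq_sym card_eq0 => /eqP h.
by have : `I_(k n) 0%N := k_gt0 n; rewrite h.
Qed.

(** For large indices the moduli of the [zeta b], [b >= 0], are strictly increasing
    in [b] and exceed those of the finitely many others.  The modulus of a large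
    zero therefore determines its index in [zeta] up to sign, and the sign as
    well, since [z p] differs from its conjugate [z (- p)]: the zero is simple,
    and the monotone enumeration [z] inherits the gaps of [zeta]. *)
Lemma zero_enumeration_gaps : exists p1 : nat, [/\
  forall p q : nat, (p < q)%N -> (p1 <= q)%N -> cabs (z p%:Z) + a / 2 <= cabs (z q%:Z),
  forall p : nat, (p1 <= p)%N -> a / 2 <= cabs (z p%:Z - z (- p%:Z)) &
  forall n : int, (p1 <= absz n)%N -> k n = 1%N].
Proof.
have [j hj] := choice zero_listed.
have j_inj : injective (fun p : nat => j p%:Z).
  by move=> p q jpq; apply/eqP; rewrite -eqz_nat; apply/eqP/z_inj; rewrite -!hj jpq.
have [m0 hm0] := zeta_modulus; have [m1 hm1] := nu_gap.
(* [L] bounds the moduli of small index, [M] is an index from which the moduli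
   exceed [L]. *)
pose m := maxn m0 m1.
pose L := \sum_(0 <= b < m) nu b.
pose M := (m + (Num.truncn (L / (a / 2))).+1)%N.
have a2 : 0 < a / 2 by rewrite divr_gt0.
have nu_sum c b : (c <= b)%N -> (m <= c)%N -> nu c + (b - c)%:R * (a / 2) <= nu b.
  move=> cb mc; rewrite -{2}(subnKC cb); elim: (b - c)%N => [|i IH].
    by rewrite mul0r addr0 addn0.
  have : nu (c + i)%N + a / 2 <= nu (c + i.+1)%N.
    apply: hm1; last by rewrite addnS.
    by apply: leq_trans (leq_addr _ _); apply: leq_trans mc; rewrite leq_max leqnn orbT.
  by rewrite -[i.+1%:R]natr1 mulrDl mul1r; lra.
have nu_inj b c : (m <= b)%N -> (m <= c)%N -> nu b = nu c -> b = c.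
  have lt_nu b' c' : (m <= b')%N -> (b' < c')%N -> nu b' < nu c'.
    move=> mb' bc'; have := hm1 b' c' (leq_trans (leq_maxr _ _) mb') bc'; lra.
  by move=> mb mc E; case: (ltngtP b c) => // /lt_nu => [/(_ mb)|/(_ mc)]; rewrite E ltxx.
have nu_big b : (M <= b)%N -> L < nu b.
  move=> Mb; have mb : (m <= b)%N by apply: leq_trans Mb; exact: leq_addr.
  have := nu_sum _ _ mb (leqnn _).
  have h1 : L < (Num.truncn (L / (a / 2))).+1%:R * (a / 2).
    by rewrite -ltr_pdivrMr // truncnS_gt.
  have h2 : (Num.truncn (L / (a / 2))).+1%:R * (a / 2) <= (b - m)%:R * (a / 2).
    by rewrite ler_wpM2r ?(ltW a2) // ler_nat leq_subRL // -/M.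
  by have := cabs_ge0 (zeta m); rewrite -/(nu m); lra.
have nu_small b : (b < m)%N -> nu b <= L.
  move=> bm; rewrite /L (bigD1_seq b) ?mem_index_iota ?iota_uniq //= lerDl.
  by apply: sumr_ge0 => i _; exact: cabs_ge0.
have nuE (i : int) : cabs (zeta i) = nu (absz i).
  by case: i => // i; rewrite NegzE zeta_conj cabs_conj abszN.
have [pe he] := injective_escapes M j_inj.
have [N hN] := z_mono.
pose p0 := (maxn pe (absz N)).+1.
have p0e p : (p0 <= p)%N -> (M <= absz (j p%:Z))%N.
  by move=> hp; apply: he; apply: leq_trans (ltnW hp); rewrite leq_max leqnn.
have p0N p : (p0 <= p)%N -> N <= p%:Z.
  move=> hp; have : (absz N <= p)%N by apply: leq_trans (ltnW hp); rewrite leq_max leqnn orbT.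
  by case: (N).
have p0p p : (p0 <= p)%N -> (0 < p)%N by exact: leq_trans.
have same_modulus i p : (p0 <= p)%N -> nu (absz i) = nu (absz (j p%:Z)) ->
    i = j p%:Z \/ i = - j p%:Z.
  move=> hp E; have Mj := p0e _ hp.
  have mj : (m <= absz (j p%:Z))%N by apply: leq_trans Mj; exact: leq_addr.
  have mi : (m <= absz i)%N.
    rewrite leqNgt; apply/negP => /nu_small; rewrite E.
    by have := nu_big _ Mj; lra.
  have aE : absz i = absz (j p%:Z) by exact: nu_inj.
  by move: aE; move: (j p%:Z) => jp; clear; lia.
have not_conj p q : (p0 <= p)%N -> z p%:Z <> z (- q%:Z).
  move=> /p0p p_gt0 /z_inj; move: p_gt0; clear; lia.
have mu_gap0 p q : (p0 <= p)%N -> (p < q)%N -> mu p + a / 2 <= mu q.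
  move=> hp pq; have hq : (p0 <= q)%N by exact: leq_trans (ltnW pq).
  have mono : mu p <= mu q.
    have := hN p%:Z q%:Z (p0N _ hp); rewrite lez_nat => /(_ (ltnW pq)).
    by rewrite !normC_cabs lecR.
  have muE r : mu r = nu (absz (j r%:Z)) by rewrite /mu -hj nuE.
  have mr r : (p0 <= r)%N -> (m1 <= absz (j r%:Z))%N.
    move=> hr; apply: leq_trans (p0e _ hr); apply: leq_trans (leq_addr _ _).
    by rewrite leq_max leqnn orbT.
  have [h|h|h] := ltngtP (absz (j p%:Z)) (absz (j q%:Z)).
  - by rewrite !muE; apply: hm1 => //; exact: mr.
  - have := hm1 _ _ (mr _ hq) h; rewrite -!muE; lra.
  - exfalso; have [E|E] := same_modulus (j p%:Z) q hq (congr1 nu h).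
      by have := j_inj _ _ E => pE; move: pq; rewrite pE ltnn.
    by apply: (not_conj p q hp); rewrite -hj E zeta_conj hj z_conj.
have mu_sum p : (p0 <= p)%N -> mu p0 + (p - p0)%:R * (a / 2) <= mu p.
  move=> hp; rewrite -{2}(subnKC hp); elim: (p - p0)%N => [|i IH].
    by rewrite mul0r addr0 addn0.
  have h1 : mu (p0 + i)%N + a / 2 <= mu (p0 + i.+1)%N.
    by apply: mu_gap0; [exact: leq_addr|rewrite addnS].
  by rewrite -[i.+1%:R]natr1 mulrDl mul1r; lra.
pose L1 := \sum_(0 <= p < p0) mu p.
pose p1 := (p0 + (Num.truncn (L1 / (a / 2))).+2)%N.
have p01 : (p0 <= p1)%N by exact: leq_addr.
exists p1; split.
- move=> p q pq hq; have [hp|hp] := leqP p0 p; first exact: mu_gap0.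
  have pL : mu p <= L1.
    rewrite /L1 (bigD1_seq p) ?mem_index_iota ?iota_uniq //= lerDl.
    by apply: sumr_ge0 => i _; exact: cabs_ge0.
  have := mu_sum q (leq_trans p01 hq).
  have h1 : L1 + a / 2 < (Num.truncn (L1 / (a / 2))).+2%:R * (a / 2).
    set t := Num.truncn _; rewrite -[t.+2%:R]natr1 mulrDl mul1r ltrD2r -ltr_pdivrMr //.
    exact: truncnS_gt.
  have h2 : (Num.truncn (L1 / (a / 2))).+2%:R * (a / 2) <= (q - p0)%:R * (a / 2).
    by rewrite ler_wpM2r ?(ltW a2) // ler_nat leq_subRL ?(leq_trans p01 hq).
  by have := cabs_ge0 (z p0); rewrite -/(mu p0) -/(mu p) -/(mu q); lra.
- move=> p hp; have hp0 := leq_trans p01 hp.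
  rewrite z_conj; have -> : z p%:Z - (z p%:Z)^* = 0 +i* (2 * complex.Im (z p%:Z)).
    by case: (z p%:Z) => u v; apply/eqP; rewrite eq_complex /=; apply/andP; split; apply/eqP; ring.
  have h1 : a <= `|complex.Im (z p%:Z)|.
    have hb : (m0 <= absz (j p%:Z))%N.
      apply: leq_trans (p0e _ hp0); apply: leq_trans (leq_addr _ _).
      by rewrite leq_max leqnn.
    have [_ h] := hm0 _ hb; rewrite -hj.
    case: (j p%:Z) h {hb} => b /= h; first by apply: le_trans h (ler_norm _).
    rewrite NegzE zeta_conj; have -> : complex.Im (zeta b.+1%:Z)^* = - complex.Im (zeta b.+1%:Z).
      by case: (zeta _).
    by rewrite normrN; apply: le_trans h (ler_norm _).
  apply: le_trans (Im_le_cabs _); rewrite /= normrM ger0_norm //.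
  by move: a_gt0; lra.
- have single p : (p1 <= p)%N -> forall i, zeta i = z p%:Z -> i = j p%:Z.
    move=> hp i hi; have hp0 := leq_trans p01 hp.
    have E : nu (absz i) = nu (absz (j p%:Z)) by rewrite -!nuE hi hj.
    have [//|iE] := same_modulus i p hp0 E.
    exfalso; apply: (not_conj p p hp0).
    by rewrite -hi iE zeta_conj hj z_conj.
  have k1 n i0 : (forall i, zeta i = z n <-> i = i0) -> k n = 1%N.
    move=> h; have E : [set i : int | zeta i = z n] = [set i0].
      by apply/seteqP; split=> i /= /h.
    have := k_card n; rewrite E => h1; apply/esym/card_eq_II.
    by apply: card_eq_trans h1; rewrite card_eq_sym; exact: card_set1.
  have kpos p : (p1 <= p)%N -> k p%:Z = 1%N.
    by move=> hp; apply: (k1 _ (j p%:Z)) => i; split=> [/(single p hp)//|->].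
  case=> p; first exact: kpos.
  rewrite NegzE abszN => hp; apply: (k1 _ (- j p.+1%:Z)) => i; split=> [iE|->].
    rewrite -(single _ hp (- i)) ?opprK //.
    by rewrite zeta_conj iE -z_conj opprK.
  by rewrite zeta_conj hj z_conj.
Qed.

End ZeroAsymptotics.

(** * The expansion of the workload transform *)

Lemma zero_has_pos_order (R : realType) (f : R[i] -> R[i]) w (k : nat) :
  analytic_at f w -> f w = 0 -> has_order f w k%:Z -> (0 < k)%N.
Proof.
move=> hf fw [g [hg g0 /dnbhsCP[r r0 E]]]; rewrite lt0n; apply: contraNN g0 => /eqP k0.
rewrite -fw; apply/eqP/esym; apply: punctured_eq_center hf hg _.
by apply/dnbhsCP; exists r => // v v0 vr; rewrite E // k0 expr0z mul1r.
Qed.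

Theorem theorem2p4 (R : realType)
  (d : measure_display) (T : measurableType d) (P : probability T R)
  (X Y : {RV P >-> R})
  (X_ge0 : forall t, 0 <= X t) (Y_ge0 : forall t, 0 <= Y t)
  (indepXY : independent P X Y)
  (EY_lt_EX : ('E_P[Y] < 'E_P[X])%E)
  (nonlattice : ~ lattice P X \/ ~ lattice P Y)
  (eps0 : R) (eps0_gt0 : 0 < eps0)
  (A_strip : laplace_analytic_on P X
    [set theta | - eps0 < complex.Re theta < eps0])
  (B_strip : laplace_analytic_on P Y
    [set theta | - eps0 < complex.Re theta < eps0])
  (F : R[i] -> R[i])
  (F_def : F = fun theta => laplace P Y theta * laplace P X (- theta) - 1)
  (d' : measure_display) (T' : measurableType d') (P' : probability T' R)
  (V : {RV P' >-> R}) (V_ge0 : forall t, 0 <= V t)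
  (V_stationary : stationary_workload P' P V (fun t => Y t - X t))
  (psi : R[i] -> R[i]) (psi_mero : meromorphic psi)
  (psi_laplace : forall theta : R[i],
    0 <= complex.Re theta -> psi theta = laplace P' V theta)
  (B_entire : laplace_analytic_on P Y setT)
  (alpha : R) (alpha_lt0 : alpha < 0)
  (F_order : exponential_order (fun x : R => complex.Re (F x%:C)) (- alpha)
    -oo%R)
  (zeta : int -> R[i]) (zeta_zeroes : lists_left_zeroes F zeta)
  (zeta_conj : forall n : int, zeta (- n) = (zeta n)^*)
  (zeta_Re : (fun n : nat => complex.Re (zeta n%:Z)) =o_\oo
    (fun n : nat => Num.sqrt n%:R))
  (beta : R)
  (zeta_Im : (fun n : nat =>
    complex.Im (zeta n%:Z) - (- (2 * pi * n%:R) / alpha)) @ \oo --> beta)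
  (eta eps : R) (eta_gt0 : 0 < eta) (eps_gt0 : 0 < eps)
  (n1 : nat) (r : nat -> R) (r_sublinear : sublinear eta n1 r)
  (r_infty : r @ \oo --> +oo%R)
  (F_large : forall (n : nat) (theta : R[i]), (n1 <= n)%N ->
    complex.Re theta < 0 -> `|theta| = (r n)%:C -> eps%:C < `|F theta|)
  (z : int -> R[i]) (z_inj : injective z) (z_range : range z = left_zeroes F)
  (z_conj : forall n : int, z (- n) = (z n)^*)
  (z_mono : exists N : int, forall m n : int,
    N <= m -> m <= n -> `|z m| <= `|z n|)
  (k : int -> nat) (k_mult : forall n : int, has_order F (z n) (k n)%:Z)
  (theta : R[i]) (theta_npole : ~ is_pole psi theta) :
  exists2 s : R[i],
    is_bilateral_sum (fun n : int =>
      \sum_(1 <= j < (k n).+1)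
        laurent_coef psi (z n) (- j%:Z) *
          ((theta - z n) ^ (- j%:Z) - (- z n) ^ (- j%:Z))) s &
    psi theta = 1 + s.
Proof.
subst F; set F := fun _ : R[i] => _ in zeta_zeroes F_large z_range k_mult.
have pi0 : 0 < pi :> R := pi_gt0 R.
(* The spacing of the imaginary parts, hence of the moduli, of the zeros. *)
pose a := - (2 * pi / alpha).
have a_gt0 : 0 < a by rewrite /a -mulrN -invrN divr_gt0 ?mulr_gt0 // oppr_gt0.
have zeta_Im' : (fun n : nat => complex.Im (zeta n%:Z) - a * n%:R) @ \oo --> beta.
  have aE n : a * n%:R = - (2 * pi * n%:R) / alpha by rewrite /a; field; rewrite lt_eqF.
  suff -> : (fun n : nat => complex.Im (zeta n%:Z) - a * n%:R) =
    (fun n : nat => complex.Im (zeta n%:Z) - (- (2 * pi * n%:R) / alpha)) by exact: zeta_Im.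
  by apply/funext => n; rewrite aE.
have z_left n : left_zeroes F (z n) by rewrite -z_range; exists n.
have leps w : complex.Re w < 0 -> complex.Re w < eps0 by move=> h; exact: lt_trans h eps0_gt0.
have Fan w : complex.Re w < 0 -> analytic_at F w.
  by move=> /leps; exact: (F_analytic X_ge0 eps0_gt0 A_strip B_entire).
have k_gt0 n : (0 < k n)%N.
  by have [h1 h2] := z_left n; exact: (zero_has_pos_order (Fan _ h1) h2 (k_mult n)).
have k_card n : ([set i : int | zeta i = z n] #= `I_(k n))%card.
  by have [_] := zeta_zeroes; apply; [exact: z_left|exact: k_mult].
have [p1 [gap conj_gap simple]] := zero_enumeration_gaps a_gt0 zeta_conj zeta_Re
  zeta_Im' z_inj z_conj z_mono k_card k_gt0.
have z_neq0 n : z n != 0.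
  by have [h _] := z_left n; apply/eqP => zn; move: h; rewrite zn /= ltxx.
have z_sym n : cabs (z (- n)) = cabs (z n) by rewrite z_conj cabs_conj.
have psi_left w : complex.Re w < 0 -> F w != 0 -> analytic_at psi w.
  move=> wl Fw; case: (psi_mero w) => [h|pol]; first exact: h.
  exfalso; move/eqP: Fw; apply.
  exact: (pole_zero X_ge0 Y_ge0 indepXY V_ge0 V_stationary eps0_gt0 A_strip B_entire
    psi_mero psi_laplace (leps _ wl) pol).
have psi_an w : (forall n, w != z n) -> analytic_at psi w.
  move=> wz; have [w0|w0] := leP 0 (complex.Re w).
    exact: (psi_analytic_right V_ge0 psi_mero psi_laplace w0).
  apply: psi_left => //; apply/eqP => Fw.
  have : left_zeroes F w by [].
  by rewrite -z_range => -[n _ zn]; move: (wz n); rewrite zn eqxx.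
have psi_order n : removable (fun w => (w - z n) ^+ k n * psi w) (z n).
  have [h _] := z_left n.
  exact: (psi_pole_order X_ge0 Y_ge0 indepXY V_ge0 V_stationary eps0_gt0 A_strip
    B_entire psi_mero psi_laplace (leps _ h) (k_mult n)).
have [_ [n0 n10 r_step]] := r_sublinear.
have r_infty' : (fun n => r (n + n0)%N) @ \oo --> +oo by rewrite cvg_shiftn.
(* On the right half of a circle [psi] is bounded by 2; on the left half it is
   [G / F] with [G] bounded by 3 and [F] bounded below by [eps]. *)
have circle n w : cabs w = r (n + n0)%N -> analytic_at psi w /\ cabs (psi w) <= 2 + 3 / eps.
  move=> wr; have e3 : 0 <= 3 / eps by rewrite divr_ge0 // ltW.
  have [w0|w0] := leP 0 (complex.Re w).
    split; first exact: (psi_analytic_right V_ge0 psi_mero psi_laplace w0).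
    by have := psi_bounded V_ge0 psi_laplace w0; lra.
  have Fbig : eps < cabs (F w).
    rewrite -ltcR -normC_cabs; apply: F_large w0 _.
      exact: leq_trans n10 (leq_addl _ _).
    by rewrite normC_cabs wr.
  have Fpos : 0 < cabs (F w) by exact: lt_trans Fbig.
  have pw : analytic_at psi w by apply: psi_left => //; rewrite -cabs_gt0.
  split=> //.
  have := functional_equation_at X_ge0 Y_ge0 indepXY V_ge0 V_stationary eps0_gt0
    A_strip B_entire psi_mero psi_laplace (leps _ w0) pw.
  move=> /(congr1 (@cabs R)); rewrite cabsM -/F => E.
  have := G_bounded X Y V (ltW w0); rewrite -E => h.
  have : cabs (psi w) * eps <= 3.
    by apply: le_trans h; rewrite ler_wpM2l ?cabs_ge0 // ltW.
  by rewrite -ler_pdivlMr //; lra.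
have psi_theta : analytic_at psi theta by case: (psi_mero theta).
have C0_ge0 : 0 <= 2 + 3 / eps by rewrite addr_ge0 // divr_ge0 // ltW.
have r_step' n : r (n.+1 + n0)%N - r (n + n0)%N < eta.
  by rewrite addSn; apply: r_step; exact: leq_addl.
have a2_gt0 : 0 < a / 2 by rewrite divr_gt0.
have psi00 : 0 <= complex.Re (0 : R[i]) by [].
exists (psi theta - 1); last by rewrite addrC subrK.
apply/ctends_cvg.
exact: (mittag_leffler z_inj z_neq0 z_sym psi_an psi_order a2_gt0 gap
  conj_gap simple r_step' r_infty' C0_ge0 circle psi_theta (psi_at0 psi_laplace)
  (psi_analytic_right V_ge0 psi_mero psi_laplace psi00)).
Qed.
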